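(* Let $L$ be a classical knot diagram with $n$ crossings, and suppose that $L$ is good. Then $L$ is minimal among classical diagrams: every classical knot diagram $L'$ representing the same knot as $L$ has at least $n$ crossings.
   Context: A classical knot diagram is an ordinary planar knot diagram (no virtual crossings); two diagrams represent the same knot if they are related by planar isotopy and Reidemeister moves. The atom $V(L)$ of a diagram $L$. An atom is a pair $(M,\Gamma)$, where $M$ is a connected closed $2$-manifold (not necessarily orientable) and $\Gamma\subset M$ is an embedded $4$-valent graph (the frame) whose complement $M\setminus\Gamma$ is a union of $2$-cells with a fixed black/white checkerboard colouring. The atom $V(L)$ is constructed as follows. The frame $\Gamma$ has one vertex for each crossing of $L$, and its edges correspond to the edges of the shadow of $L$ (the arcs connecting crossings), so that the four edge-ends at a vertex are the four branches emanating from the crossing. At each crossing $X$, enumerate the four emanating branches $x_1,x_2,x_3,x_4$ in clockwise order so that $x_1,x_3$ form the undercrossing and $x_2,x_4$ form the overcrossing. The black angles at $X$ are $(x_1,x_2)$ and $(x_3,x_4)$; the white angles are $(x_2,x_3)$ and $(x_4,x_1)$. The black $2$-cells are attached along the closed cycles in $\Gamma$ that follow edges and at each vertex turn through black angles (going from $x_1$ to $x_2$ or vice versa, or from $x_3$ to $x_4$ or vice versa); the white $2$-cells are attached along the closed cycles obtained in the same way from the white angles. Each vertex of $V(L)$ is thus incident to four pieces of cells, one for each of its four angles: two black and two white. Globally some of these pieces may belong to the same cell. The diagram $L$ is called good if at each vertex of $V(L)$ the four pieces belong to four pairwise different cells (equivalently, at each vertex the two black pieces belong to different black cells and the two white pieces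 belong to different white cells). *)

(* Defs.v *)
From Stdlib Require Import Relation_Operators.
From mathcomp Require Import all_boot all_fingroup.

Set Implicit Arguments.
Unset Strict Implicit.
Unset Printing Implicit Defensive.

(* The dart (x, i) is the i-th of the four branches emanating from the        *)
(* crossing x, numbered 0, 1, 2, 3 in clockwise order so that 0 and 2 form    *)
(* the undercrossing, and 1 and 3 the overcrossing.                           *)
Notation dart X := (X * 'I_4)%type.

Section Darts.
Variable X : finType.
Implicit Type d : dart X.

Definition cw d : dart X := (d.1, ordS d.2).
Definition ccw d : dart X := (d.1, ord_pred d.2).
Definition opp d : dart X := cw (cw d).

End Darts.

(* A knot diagram in the oriented plane, up to planar isotopy, given by the   *)
(* combinatorial map of its shadow: edge d is the other end of the arc that   *)
(* leaves its crossing along d.  Orienting each arc away from the crossing of *)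
(* its dart, face d is the next side of the region on the left of d, and      *)
(* regions are the orbits of face.  Planarity is Euler's formula; the shadow  *)
(* is connected by one_strand, which says that the curve, traversed straight  *)
(* ahead through the crossings, has a single component: every arc is met, in  *)
(* one direction or the other.  The unbounded region is recorded as a set of  *)
(* darts.  The diagram without crossings is the simple closed curve: it has   *)
(* no darts, and hence is exempt from the formula and has outer = set0.       *)
Record diagram : Type := Diagram {
  crossing : finType;
  edge : dart crossing -> dart crossing;
  outer : {set dart crossing};
  face := fun d => cw (edge d);
  ahead := fun d => opp (edge d);
  edgeK : involutive edge;
  edge_neq : forall d, edge d != d;
  one_strand : forall d e, fconnect ahead d e || fconnect ahead d (edge e);
  planar : 0 < #|crossing| ->
    #|crossing| + fcard face predT = fcard edge predT + 2;
  outer_nonempty : 0 < #|crossing| -> outer != set0;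
  outer_face : forall d e, d \in outer -> (e \in outer) = fconnect face d e
}.

(* Since only 0 and 2 are interchangeable in the numbering of the branches, a *)
(* crossing may be renumbered by a half turn.                                 *)
Definition planar_isotopic (L L' : diagram) : Prop :=
  exists (f : crossing L -> crossing L') (half : crossing L -> bool),
  let F d : dart (crossing L') :=
    let d' := (f d.1, d.2) in if half d.1 then opp d' else d' in
  [/\ bijective f,
      forall d, edge (F d) = F (edge d)
    & forall d, (F d \in outer L') = (d \in outer L)].

(* The corners between c and cw c, for c in cs, are those of a region with    *)
(* size cs sides and distinct vertices.                                       *)
Definition polygon (L : diagram) (cs : seq (dart (crossing L))) : bool :=
  uniq [seq c.1 | c <- cs] && fcycle (fun c => edge (cw c)) cs.

Definition sides (L : diagram) (cs : seq (dart (crossing L))) :=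
  cs ++ [seq cw c | c <- cs].

(* L is obtained from L' by pulling away the vertices of the polygon cs, the  *)
(* strands going straight through them being joined up: pass leads from a     *)
(* dart at which a removed crossing is entered to the one at which the next   *)
(* crossing is entered.  Hence the edge of L starting at d is cut in L' into  *)
(* the edges starting at those e for which there is a path of pass from       *)
(* edge (F d) to edge e; unless it is a side of the polygon, such an e has on *)
(* its left a part of the region of L that d has on its left.  The last       *)
(* clause thus says that the point at infinity is outside the disc in which   *)
(* the move takes place and stays where it is.                                *)
Definition removal (L L' : diagram) (cs : seq (dart (crossing L'))) : Prop :=
  exists f : crossing L -> crossing L',
  let F d : dart (crossing L') := (f d.1, d.2) in
  let removed := [seq c.1 | c <- cs] in
  let pass := [rel d e | (d.1 \in removed) && (e == edge (opp d))] in
  [/\ injective f,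
      forall x, (x \in codom f) = (x \notin removed),
      forall d, connect pass (edge (F d)) (F (edge d))
    & exists e, [/\ e \in outer L', e \notin sides cs
        & 0 < #|crossing L| ->
          exists2 d, d \in outer L & connect pass (edge (F d)) (edge e)]].

Definition reidemeister1 (L L' : diagram) : Prop :=
  exists p : dart (crossing L'), polygon [:: p] /\ removal L [:: p].

(* In view of polygon, odd p.2 != odd q.2 says that one of the two sides of   *)
(* the bigon is over at both ends, and the other under at both ends.          *)
Definition reidemeister2 (L L' : diagram) : Prop :=
  exists p q : dart (crossing L'),
  [/\ polygon [:: p; q], odd p.2 != odd q.2 & removal L [:: p; q]].

(* The strand through the side from cw p to q crosses p.1 and then q.1; this  *)
(* permutation exchanges its passages through p.1 and q.1.                    *)
Definition swap_crossings (X : finType) (p q : dart X) : {perm dart X} :=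
  (tperm (ccw p) q * tperm (cw p) (opp q))%g.

(* Moving a strand across the triangle p, q, r reverses the order in which    *)
(* each of the three strands meets the other two, and keeps the crossings     *)
(* themselves.  The crossings of the triangle come from a top, a middle and a *)
(* bottom strand unless the numbers of p, q and r have the same parity.       *)
Definition reidemeister3 (L L' : diagram) : Prop :=
  exists (f : crossing L -> crossing L') (p q r : dart (crossing L)),
  let F d : dart (crossing L') := (f d.1, d.2) in
  let s := (swap_crossings p q * swap_crossings q r * swap_crossings r p)%g in
  [/\ bijective f,
      polygon [:: p; q; r],
      ~~ ((odd p.2 == odd q.2) && (odd q.2 == odd r.2)),
      forall d, edge (F d) = F (s (edge (s d)))
    & exists d, [/\ d \in outer L, d \notin sides [:: p; q; r]
                  & F (s d) \in outer L']].

Definition elementary_move (L L' : diagram) : Prop :=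
  [\/ planar_isotopic L L', reidemeister1 L L', reidemeister2 L L'
    | reidemeister3 L L'].

Definition same_knot : diagram -> diagram -> Prop :=
  clos_refl_sym_trans diagram elementary_move.

(* The other branch of the black (resp. white) angle to which d belongs: the  *)
(* black angles are those between 0 and 1 and between 2 and 3, the white ones *)
(* those between 1 and 2 and between 3 and 0.                                 *)
Definition turn (X : finType) (black : bool) (d : dart X) : dart X :=
  if odd d.2 == black then ccw d else cw d.

(* A cell of the atom is attached along a closed cycle that alternately       *)
(* follows an edge of the frame and turns through an angle of the colour of   *)
(* the cell; it is given by its colour and by the darts on this cycle.        *)
Definition atom_cell (L : diagram) (black : bool) (d : dart (crossing L)) :
    bool * {set dart (crossing L)} :=
  (black,
   [set e | connect [rel a b | (b == edge a) || (b == turn black a)] d e]).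

(* The cell containing the piece in the angle at x between i and i + 1.       *)
Definition piece_cell (L : diagram) (x : crossing L) (i : 'I_4) :=
  atom_cell (~~ odd i) (x, i).

Definition good (L : diagram) : Prop :=
  forall x : crossing L, injective (piece_cell x).

(* Main.v *)
From Pilot Require Import Defs.
From Stdlib Require Import FunctionalExtensionality Relation_Operators.
From HB Require Import structures.
From mathcomp Require Import all_boot all_fingroup all_order all_algebra all_field.
From mathcomp Require Import ring zify.

(** Two estimates of a degree are compared, as in the proofs by Stong and by
    Lickorish and Thistlethwaite that adequate diagrams have as few crossings
    as possible.

    Expanding the Kauffman bracket of a diagram with n crossings over the 2^n
    ways to smooth all crossings, consider the state in which all crossings
    are smoothed along the angles of one colour.  Its loops run along the
    boundaries of the cells of that colour of the atom, and goodness says that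
    at each crossing two different loops meet (adequate, good_adequate).  Then
    every other state has smaller degree, so that the degree of the bracket is
    determined by n + 2 l, where l is the number of these loops; in general
    this is an upper bound.  Hence n + 2 l <= n' + 2 l' for two diagrams with
    the same bracket, if the first is adequate (degree_le).

    To get rid of the loops, each strand is replaced by 2^k parallel strands.
    This multiplies n by 4^k, but l at most by 2^k, and keeps the diagram
    adequate (double_adequate, loops_double); as k grows, n <= n' results
    (adequate_le).  That the brackets of the cables agree as well need not be
    followed through moves of cables: a state sum whose weights satisfy the
    second and the third move (model) is the bracket for suitable weights
    (bracket_model), and the state sum of a doubled diagram is that of the
    diagram itself for the weights of 2 x 2 grids of crossings, which again
    satisfy these moves (double_model, shadow_sum_double).  So it is enough
    that all models take equal values on diagrams of the same knot.

    This they do up to the first move, which multiplies a matrix inserted at a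
    base point by that of a kink.  Matrices of kinks slide through crossings
    (kink_central), hence commute and can be gathered at the base point.  The
    kinks come in two types, inverse to each other, and for diagrams of the
    same knot there are words u and u' in kinks of the first type such that L
    followed by u has the same state sums as L' followed by u'
    (same_knot_related).  Moving both words to the other sides by means of the
    second type, L followed by |u'| and L' followed by |u| kinks of this type
    have the same state sums, too.  Words are realised by adding kinks to the
    diagrams (kinked_shadow); those of either type preserve adequacy for one
    of the colours (adequate_kink).  The comparison above now gives
    n + |u| <= n' + |u'| from one colour and n + |u'| <= n' + |u| from the
    other, and the theorem is the sum of both. *)

Import Pilot.Defs.
Set Implicit Arguments.
Unset Strict Implicit.
Unset Printing Implicit Defensive.
Import GRing.Theory Num.Theory.
Local Open Scope ring_scope.

(** * Models: weights at crossings satisfying the second and third Reidemeister moves *)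

(** The weight wt b s0 s1 s2 s3 is that of a crossing whose branches carry
    the labels s0, ..., s3 in clockwise order, where b tells whether the
    first of them is odd, that is, over. The two ends of an arc carry labels
    exchanged by bar. In wt_bigon and wt_triangle, the labels of the sides
    of the polygon are summed over; wt_triangle says that the weights before
    and after a third move have the same sum if the three crossings have
    bits b, b and ~~ b; the other mixed cases are cyclic rotations of this
    one (wt_triangle_gen). *)
Record model : Type := Model {
  lab : finType;
  bar : lab -> lab;
  wt : bool -> lab -> lab -> lab -> lab -> algC;
  lab_gt0 : (0 < #|lab|)%N;
  barK : involutive bar;
  wt_rot : forall b s0 s1 s2 s3, wt b s0 s1 s2 s3 = wt (~~ b) s3 s0 s1 s2;
  wt_bigon : forall b p2 p3 q2 q3,
    \sum_s \sum_t wt b (bar t) s p2 p3 * wt (~~ b) (bar s) t q2 q3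
      = ((q2 == bar p3) && (q3 == bar p2))%:R;
  wt_triangle : forall b p2 p3 q2 q3 r2 r3,
    \sum_x \sum_y \sum_z
      wt b (bar z) x p2 p3 * wt b (bar x) y q2 q3 * wt (~~ b) (bar y) z r2 r3
    = \sum_x \sum_y \sum_z
      wt b r3 q2 (bar z) x * wt b p3 r2 (bar x) y * wt (~~ b) q3 p2 (bar y) z
}.

Lemma sum_bar (W : model) (F : lab W -> algC) : \sum_s F (bar s) = \sum_s F s.
Proof. by rewrite [RHS](reindex_inj (can_inj (@barK W))). Qed.

Lemma wt_half (W : model) b s0 s1 s2 s3 : wt (m := W) b s0 s1 s2 s3 = wt b s2 s3 s0 s1.
Proof. by rewrite 2!wt_rot negbK. Qed.

Lemma wt_rotV (W : model) b s0 s1 s2 s3 : wt (m := W) b s0 s1 s2 s3 = wt (~~ b) s1 s2 s3 s0.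
Proof. by rewrite wt_half wt_rot. Qed.

Lemma mulr_sum2 (S T : finType) (k : algC) (F : S -> T -> algC) :
  k * (\sum_s \sum_t F s t) = \sum_s \sum_t k * F s t.
Proof. by rewrite mulr_sumr; apply: eq_bigr => s _; rewrite mulr_sumr. Qed.

Lemma mulr_suml2 (S T : finType) (k : algC) (F : S -> T -> algC) :
  (\sum_s \sum_t F s t) * k = \sum_s \sum_t F s t * k.
Proof. by rewrite mulr_suml; apply: eq_bigr => s _; rewrite mulr_suml. Qed.

Lemma front_sum3 (S T U : finType) (F : S -> T -> U -> algC) :
  \sum_s \sum_t \sum_u F s t u = \sum_u \sum_s \sum_t F s t u.
Proof. by under eq_bigr => s _ do rewrite exchange_big /=; rewrite exchange_big. Qed.

Lemma front_sum4 (S T U V : finType) (F : S -> T -> U -> V -> algC) :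
  \sum_s \sum_t \sum_u \sum_v F s t u v = \sum_v \sum_s \sum_t \sum_u F s t u v.
Proof. by under eq_bigr => s _ do rewrite front_sum3 /=; rewrite exchange_big. Qed.

Lemma mulr_suml3 (S T U : finType) (k : algC) (F : S -> T -> U -> algC) :
  (\sum_s \sum_t \sum_u F s t u) * k = \sum_s \sum_t \sum_u F s t u * k.
Proof. by rewrite mulr_suml; apply: eq_bigr => s _; rewrite mulr_suml2. Qed.

Lemma sum_pair (S T : finType) (F : S * T -> algC) :
  \sum_u F u = \sum_s \sum_t F (s, t).
Proof. by rewrite pair_bigA; apply: eq_bigr => -[]. Qed.

Lemma exchange_sum4 (S T U V : finType) (F : S -> T -> U -> V -> algC) :
  \sum_s \sum_t \sum_u \sum_v F s t u v = \sum_u \sum_v \sum_s \sum_t F s t u v.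
Proof.
under eq_bigr => s _ do rewrite front_sum3 front_sum3.
by rewrite front_sum3 front_sum3; do 2!apply: eq_bigr => ? _; rewrite exchange_big.
Qed.

Definition put (I T : finType) (g : {ffun I -> T}) i s : {ffun I -> T} :=
  [ffun k => if k == i then s else g k].

(** A crossing of the strands i and j as an operator on functions of the
    labels of all strands; locked, as the many nested crossings of cables
    would otherwise be expanded at every unification. *)
HB.lock Definition cross (I T : finType) (V : T -> T -> T -> T -> algC) (i j : I)
    (f : {ffun {ffun I -> T} -> algC}) : {ffun {ffun I -> T} -> algC} :=
  [ffun g : {ffun I -> T} => \sum_s \sum_t V (g i) (g j) s t * f (put (put g i s) j t)].

Section Strands.
Variables (I T : finType).
Implicit Types (g : {ffun I -> T}) (f : {ffun {ffun I -> T} -> algC}).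
Implicit Types (V : T -> T -> T -> T -> algC).

Lemma crossE V i j f g :
  cross V i j f g = \sum_s \sum_t V (g i) (g j) s t * f (put (put g i s) j t).
Proof. by rewrite cross.unlock ffunE. Qed.

Lemma put_eq g i s : put g i s i = s. Proof. by rewrite ffunE eqxx. Qed.

Lemma put_neq g i s k : k != i -> put g i s k = g k.
Proof. by move=> /negPf ki; rewrite ffunE ki. Qed.

Lemma putC g i s j t : i != j -> put (put g i s) j t = put (put g j t) i s.
Proof.
move=> ij; apply/ffunP=> k; rewrite !ffunE; case: (eqVneq k j) => // ->.
by rewrite eq_sym (negPf ij).
Qed.

Lemma put_put g i s t : put (put g i s) i t = put g i t.
Proof. by apply/ffunP=> k; rewrite !ffunE; case: (k == i). Qed.

Lemma crossC V V' i j k l f : uniq [:: i; j; k; l] ->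
  cross V i j (cross V' k l f) = cross V' k l (cross V i j f).
Proof.
rewrite /= !inE !negb_or => /and4P[/and3P[ij ik il] /andP[jk jl] kl _].
have [ki kj li lj] : [/\ k != i, k != j, l != i & l != j] by rewrite !(eq_sym k, eq_sym l).
apply/ffunP=> g; rewrite !crossE.
under eq_bigr => s _ do under eq_bigr => t _ do rewrite crossE mulr_sum2.
under [RHS]eq_bigr => s _ do under eq_bigr => t _ do rewrite crossE mulr_sum2.
rewrite exchange_sum4; do 4!apply: eq_bigr => ? _; rewrite !mulrA [V' _ _ _ _ * _]mulrC !put_neq //.
congr (_ * f _); apply/ffunP=> m; rewrite !ffunE.
have [->|_] := eqVneq m l; first by rewrite (negPf li) (negPf lj).
by have [->|] := eqVneq m k; first by rewrite (negPf ki) (negPf kj).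
Qed.

(** The components of the operator equation in cross_triangle: B, M and T
    are the strands i, j and k, with labels indexed by 0 before the three
    crossings and by 2 after them. *)
Definition yang_baxter V := forall B0 M0 T0 B2 M2 T2,
  \sum_x \sum_y \sum_z V B0 M0 z x * V z T0 B2 y * V x y M2 T2
  = \sum_x \sum_y \sum_z V M0 T0 x y * V B0 y z T2 * V z x B2 M2.

Section Triangle.
Variables (V : T -> T -> T -> T -> algC) (i j k : I).
Hypothesis ijk : uniq [:: i; j; k].
Let distinct : [/\ i != j, i != k, j != k, j != i & k != i /\ k != j].
Proof.
move: ijk; rewrite /= !inE negb_or => /and3P[/andP[ij ik] jk _]; by rewrite (eq_sym j i) !(eq_sym k) ij ik jk.
Qed.

Let put3 g c d e := put (put (put g i c) j d) k e.

Lemma cross3_left f g :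
  cross V i j (cross V i k (cross V j k f)) g = \sum_c \sum_d \sum_e
    (\sum_x \sum_y \sum_z V (g i) (g j) z x * V z (g k) c y * V x y d e)
      * f (put3 g c d e).
Proof.
have [ij ik jk ji [ki kj]] := distinct.
rewrite crossE; under eq_bigr => z _ do under eq_bigr => x _ do rewrite crossE mulr_sum2.
under eq_bigr => z _ do under eq_bigr => x _ do under eq_bigr => c _ do
  under eq_bigr => y _ do rewrite crossE !mulr_sum2.
rewrite front_sum3; apply: eq_bigr => c _; rewrite front_sum4.
apply: eq_bigr => d _; rewrite front_sum4; apply: eq_bigr => e _.
rewrite mulr_suml3 [RHS]front_sum3; apply: eq_bigr => z _; apply: eq_bigr => x _.
apply: eq_bigr => y _; rewrite !mulrA !(put_eq, put_neq) //.
congr (_ * f _); apply/ffunP=> m; rewrite !ffunE.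
by case: (m == k); case: (m == j); case: (m == i).
Qed.

Lemma cross3_right f g :
  cross V j k (cross V i k (cross V i j f)) g = \sum_c \sum_d \sum_e
    (\sum_x \sum_y \sum_z V (g j) (g k) x y * V (g i) y z e * V z x c d)
      * f (put3 g c d e).
Proof.
have [ij ik jk ji [ki kj]] := distinct.
rewrite crossE; under eq_bigr => x _ do under eq_bigr => y _ do rewrite crossE mulr_sum2.
under eq_bigr => x _ do under eq_bigr => y _ do under eq_bigr => z _ do
  under eq_bigr => e _ do rewrite crossE !mulr_sum2.
under eq_bigr => x _ do under eq_bigr => y _ do rewrite exchange_sum4.
rewrite exchange_sum4; apply: eq_bigr => c _; apply: eq_bigr => d _.
rewrite front_sum4; apply: eq_bigr => e _; rewrite mulr_suml3.
apply: eq_bigr => x _; apply: eq_bigr => y _; apply: eq_bigr => z _.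
rewrite !mulrA !(put_eq, put_neq) //; congr (_ * f _); apply/ffunP=> m; rewrite !ffunE.
by case: (eqVneq m k) => [->|_]; rewrite ?(negPf ki) ?(negPf kj) //; case: (m == j);
  case: (m == i).
Qed.

Lemma cross_triangle f : yang_baxter V ->
  cross V i j (cross V i k (cross V j k f)) = cross V j k (cross V i k (cross V i j f)).
Proof.
move=> VYB; apply/ffunP=> g; rewrite cross3_left cross3_right.
by do 3!apply: eq_bigr => ? _; rewrite VYB.
Qed.
End Triangle.
End Strands.

Lemma sum3_pred1 (T : finType) (G : T -> T -> T -> algC) c0 d0 e0 :
  \sum_c \sum_d \sum_e G c d e * ((c == c0) && (d == d0) && (e == e0))%:R = G c0 d0 e0.
Proof.
rewrite (bigD1 c0) //= [X in _ + X]big1 ?addr0 => [|c /negPf nc]; last first.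
  by do 2!rewrite big1 // => ? _; rewrite nc mulr0.
rewrite (bigD1 d0) //= [X in _ + X]big1 ?addr0 => [|d /negPf nd]; last first.
  by rewrite big1 // => ? _; rewrite nd andbF mulr0.
rewrite (bigD1 e0) //= [X in _ + X]big1 ?addr0 => [|e /negPf ne]; last first.
  by rewrite ne andbF mulr0.
by rewrite !eqxx mulr1.
Qed.

(** Applied to the indicator function of one labeling, the operator equation
    becomes a single component. *)
Lemma triangle_yang_baxter (T : finType) (V : T -> T -> T -> T -> algC) :
    (forall f : {ffun {ffun 'I_3 -> T} -> algC},
      cross V (inord 0) (inord 1) (cross V (inord 0) (inord 2) (cross V (inord 1) (inord 2) f))
      = cross V (inord 1) (inord 2) (cross V (inord 0) (inord 2) (cross V (inord 0) (inord 1) f))) ->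
  yang_baxter V.
Proof.
have un : uniq [:: inord 0; inord 1; inord 2 : 'I_3] by rewrite /= !inE -!val_eqE /= !inordK.
move=> Vf B0 M0 T0 B2 M2 T2.
pose g : {ffun 'I_3 -> T} := [ffun k : 'I_3 => nth B0 [:: B0; M0; T0] k].
pose h (a : {ffun 'I_3 -> T}) :=
  (a (inord 0) == B2) && (a (inord 1) == M2) && (a (inord 2) == T2).
pose f : {ffun {ffun 'I_3 -> T} -> algC} := [ffun a => (h a)%:R].
have fE a : f a = (h a)%:R by rewrite ffunE.
have /ffunP/(_ g) := Vf f.
have hE c d e : h (put (put (put g (inord 0) c) (inord 1) d) (inord 2) e) =
   (c == B2) && (d == M2) && (e == T2).
  by rewrite /h !ffunE -!val_eqE /= !inordK.
rewrite cross3_left // cross3_right //.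
under eq_bigr => c _ do under eq_bigr => d _ do under eq_bigr => e _ do rewrite fE hE.
under [RHS]eq_bigr => c _ do under eq_bigr => d _ do under eq_bigr => e _ do rewrite fE hE.
by rewrite !sum3_pred1 !ffunE !inordK.
Qed.

(** Proves that explicit lists of strands of cables are duplicate-free. *)
Ltac distinct_pairs := rewrite /= ?inE ?xpair_eqE;
  repeat match goal with H : is_true (?a != ?b) |- _ => rewrite ?(negPf H); clear H end;
  rewrite ?eqxx ?andbF.

Section Cabling.
Variables (T : finType) (V : T -> T -> T -> T -> algC).

(** Two strands crossing two strands in a 2 x 2 grid; m0, ..., m3 label the
    four inner arcs. *)
Definition grid (a b c d : T * T) : algC :=
  \sum_m0 \sum_m1 \sum_m2 \sum_m3
    V a.1 b.2 m0 m3 * V m0 b.1 c.1 m1 * V a.2 m3 m2 d.2 * V m2 m1 c.2 d.1.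

Definition unzip (I : finType) (G : {ffun I -> T * T}) : {ffun I * bool -> T} :=
  [ffun k => if k.2 then (G k.1).2 else (G k.1).1].

Definition pull (I : finType) (f : {ffun {ffun I * bool -> T} -> algC}) :
    {ffun {ffun I -> T * T} -> algC} :=
  [ffun G => f (unzip G)].

Local Notation cr i j := (cross V i j).
Definition cross_pair (I : finType) (i j : I) (f : {ffun {ffun I * bool -> T} -> algC}) :=
  cr (i, false) (j, true) (cr (i, false) (j, false)
    (cr (i, true) (j, true) (cr (i, true) (j, false) f))).

(** A label of a double strand is a pair of labels, so a grid is the
    composition of four crossings of single strands. *)
Lemma cross_pairE (I : finType) (i j : I) f (G : {ffun I -> T * T}) : i != j ->
  cross_pair i j f (unzip G) = cross grid i j (pull f) G.
Proof.
move=> ij; have ji : j != i by rewrite eq_sym.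
rewrite /cross_pair !crossE.
under eq_bigr => m0 _ do under eq_bigr => m3 _ do rewrite crossE mulr_sum2.
under eq_bigr => m0 _ do under eq_bigr => m3 _ do under eq_bigr => c0 _ do
  under eq_bigr => m1 _ do rewrite crossE !mulr_sum2.
under eq_bigr => m0 _ do under eq_bigr => m3 _ do under eq_bigr => c0 _ do
  under eq_bigr => m1 _ do under eq_bigr => m2 _ do under eq_bigr => d1 _ do
  rewrite crossE !mulr_sum2.
under eq_bigr => m0 _ do under eq_bigr => m3 _ do under eq_bigr => c0 _ do
  under eq_bigr => m1 _ do rewrite exchange_sum4.
rewrite exchange_sum4 sum_pair; apply: eq_bigr => c0 _.
under eq_bigr => m1 _ do rewrite exchange_sum4.
rewrite exchange_big; apply: eq_bigr => c1 _.
rewrite exchange_big sum_pair; apply: eq_bigr => d0 _.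
under eq_bigr => m1 _ do rewrite front_sum4.
rewrite exchange_big; apply: eq_bigr => d1 _; rewrite exchange_big mulr_suml2.
apply: eq_bigr => m0 _; apply: eq_bigr => m1 _; rewrite exchange_big mulr_suml2.
apply: eq_bigr => m2 _; apply: eq_bigr => m3 _.
rewrite !ffunE !xpair_eqE !eqxx ?(negPf ij) ?(negPf ji) !mulrA /=; congr (_ * f _).
apply/ffunP=> -[m []]; rewrite !ffunE !xpair_eqE ?andbF ?andbT /=.
  by have [->|_] := eqVneq m i; rewrite ?(negPf ij) //; case: (m == j).
by have [->|_] := eqVneq m i; rewrite ?(negPf ij) //; case: (m == j).
Qed.

(** The three double strands consist of six single ones, among which there
    are eight triangles to be reversed; in between, crossings that have no
    strand in common are exchanged. *)
Lemma grid_yang_baxter : yang_baxter V -> yang_baxter grid.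
Proof.
move=> VYB; apply: triangle_yang_baxter => F.
have : [/\ inord 0 != inord 1 :> 'I_3, inord 0 != inord 2 :> 'I_3 & inord 1 != inord 2 :> 'I_3].
  by rewrite -!val_eqE /= !inordK.
move: (inord 0) (inord 1) (inord 2) => i j k [ij ik jk].
have ijk : uniq [:: i; j; k] by rewrite /= !inE negb_or ij ik jk.
pose zip (g : {ffun 'I_3 * bool -> T}) : {ffun 'I_3 -> T * T} := [ffun k => (g (k, false), g (k, true))].
pose f : {ffun {ffun 'I_3 * bool -> T} -> algC} := [ffun g => F (zip g)].
have -> : F = pull f.
  apply/ffunP=> G; rewrite [RHS]ffunE [RHS]ffunE; congr (F _).
  by apply/ffunP=> l; rewrite !ffunE; case: (G l).
have pairE a b (h : {ffun {ffun 'I_3 * bool -> T} -> algC}) : a != b ->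
    cross grid a b (pull h) = pull (cross_pair a b h).
  by move=> ab; apply/ffunP=> G; rewrite [RHS]ffunE cross_pairE.
rewrite !(pairE j k _ jk) !(pairE i k _ ik) !(pairE i j _ ij) !(pairE i k _ ik) !(pairE j k _ jk).
suff -> : cross_pair i j (cross_pair i k (cross_pair j k f)) =
  cross_pair j k (cross_pair i k (cross_pair i j f)) by [].
have comm (a b c d : 'I_3 * bool) h : uniq [:: a; b; c; d] -> cross V a b (cross V c d h) = cross V c d (cross V a b h).
  exact: crossC.
have [ji ki kj] : [/\ j != i, k != i & k != j] by rewrite (eq_sym j i) !(eq_sym k).
have tri (a b c : 'I_3 * bool) h : uniq [:: a; b; c] -> cross V a b (cross V a c (cross V b c h)) =
    cross V b c (cross V a c (cross V a b h)).
  by move=> abc; apply: cross_triangle.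
pose over (s : 'I_3) a h := cross V a (s, true) (cross V a (s, false) h).
have overC a b s e h : uniq [:: a; b; e; (s, true)] -> uniq [:: a; b; e; (s, false)] ->
    cross V a b (over s e h) = over s e (cross V a b h).
  by move=> u1 u2; rewrite /over (comm a b _ _ _ u1) (comm a b _ _ _ u2).
(* First a crossing of a strand of i with one of j is moved across the
   double strand k; then a whole strand of i is moved across the crossing of
   j with k. *)
have over_k c d h : cross V (i, c) (j, d) (over k (i, c) (over k (j, d) h))
    = over k (j, d) (over k (i, c) (cross V (i, c) (j, d) h)).
  rewrite /over [cross _ (i, c) (k, false) _]comm; last by distinct_pairs.
  rewrite tri; last by distinct_pairs.
  rewrite tri; last by distinct_pairs.
  by rewrite [cross _ (i, c) (k, true) (cross _ (j, d) _ _)]comm //; distinct_pairs.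
have over_j c h : over j (i, c) (over k (i, c) (over k (j, false) (over k (j, true) h)))
    = over k (j, false) (over k (j, true) (over k (i, c) (over j (i, c) h))).
  rewrite [over j _ (over _ _ _)]/over over_k overC; [| by distinct_pairs | by distinct_pairs].
  rewrite [cross V _ _ (over k (j, true) h)]overC; [| by distinct_pairs | by distinct_pairs].
  by rewrite over_k.
have over_i h : over j (i, true) (over k (i, false) h) = over k (i, false) (over j (i, true) h).
  rewrite {1}/over overC; [| by distinct_pairs | by distinct_pairs].
  by rewrite overC; [| by distinct_pairs | by distinct_pairs].
have over_ii h : over j (i, false) (over k (i, true) h) = over k (i, true) (over j (i, false) h).
  rewrite {1}/over overC; [| by distinct_pairs | by distinct_pairs].
  by rewrite overC; [| by distinct_pairs | by distinct_pairs].
change (over j (i, false) (over j (i, true) (over k (i, false) (over k (i, true)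
    (over k (j, false) (over k (j, true) f))))) = over k (j, false) (over k (j, true)
  (over k (i, false) (over k (i, true) (over j (i, false) (over j (i, true) f)))))).
by rewrite over_i over_j over_j over_ii.
Qed.
End Cabling.

(** * Two parallel strands in place of one *)

(** From its other end, a double strand shows its two strands in the
    opposite order. *)
Definition swap_bar (T : Type) (bar : T -> T) (s : T * T) := (bar s.2, bar s.1).

Lemma sum_pred2 (S T : finType) (c : S) (d : T) (F : S -> T -> algC) :
  \sum_s \sum_t ((s == c) && (t == d))%:R * F s t = F c d.
Proof.
rewrite (bigD1 c) //= [X in _ + X]big1 ?addr0 => [|s /negPf ns]; last first.
  by rewrite big1 // => t _; rewrite ns mul0r.
rewrite (bigD1 d) //= [X in _ + X]big1 ?addr0 => [|t /negPf nt]; last first.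
  by rewrite nt andbF mul0r.
by rewrite !eqxx mul1r.
Qed.

Section Unitary.

(** The second move for weights read along the strands, as in straight; the
    two strands may be of different kinds, so that single strands crossing
    double ones are included. *)
Definition unitary (A B : finType) (bar : B -> B) (X : A -> B -> A -> B -> algC) :=
  forall f e c d,
    \sum_t \sum_s X f (bar s) t e * X t s c d = ((c == f) && (d == bar e))%:R.

(** A first strand that is single crosses a second one that is double; in
    fuse_under it is the other way round. Together, they make up a grid
    (grid_fuse). *)
Definition fuse_over (A B : finType) (X : A -> B -> A -> B -> algC) a (b : B * B) c (d : B * B) :=
  \sum_m X a b.2 m d.2 * X m b.1 c d.1.

Definition fuse_under (A B : finType) (X : A -> B -> A -> B -> algC) (a : A * A) b (c : A * A) d :=
  \sum_m X a.1 b c.1 m * X a.2 m c.2 d.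

(** The bigon with a double side consists of two ordinary bigons, of which
    the inner one is removed first. *)
Lemma fuse_over_unitary (A B : finType) (bar : B -> B) (X : A -> B -> A -> B -> algC) :
  unitary bar X -> unitary (swap_bar bar) (fuse_over X).
Proof.
move=> XU f [e0 e1] c [d0 d1]; rewrite /fuse_over /=.
transitivity (\sum_m \sum_n (\sum_t \sum_s1 X m (bar s1) t e0 * X t s1 n d1) *
  \sum_s0 X f (bar s0) m e1 * X n s0 c d0).
  under eq_bigr => t _ do rewrite sum_pair.
  under eq_bigr => t _ do under eq_bigr => s0 _ do under eq_bigr => s1 _ do
    rewrite mulr_suml.
  under eq_bigr => t _ do rewrite front_sum3.
  rewrite exchange_big; apply: eq_bigr => m _.
  under eq_bigr => t _ do under eq_bigr => s0 _ do under eq_bigr => s1 _ do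
    rewrite mulr_sumr.
  under eq_bigr => t _ do rewrite front_sum3.
  rewrite exchange_big; apply: eq_bigr => n _.
  rewrite mulr_suml2; apply: eq_bigr => t _; rewrite exchange_big /=.
  apply: eq_bigr => s1 _; rewrite mulr_sumr; apply: eq_bigr => s0 _ /=.
  by rewrite !mulrA [X f _ _ _ * _]mulrC; do 2!rewrite -mulrA; rewrite -!mulrA; congr (_ * _);
    rewrite [RHS]mulrCA.
under eq_bigr => m _ do under eq_bigr => n _ do rewrite XU.
transitivity (\sum_m (d1 == bar e0)%:R * \sum_s X f (bar s) m e1 * X m s c d0).
  apply: eq_bigr => m _; rewrite (bigD1 m) //= eqxx [X in _ + X]big1 ?addr0 // => n /negPf nm.
  by rewrite nm mul0r.
by rewrite -mulr_sumr XU xpair_eqE -natrM mulnb; congr (_ %:R : algC); case: (c == f);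
  rewrite ?andbF //= andbC.
Qed.

Lemma fuse_under_unitary (A B : finType) (bar : B -> B) (X : A -> B -> A -> B -> algC) :
  involutive bar -> unitary bar X -> unitary bar (fuse_under X).
Proof.
move=> barK XU [f0 f1] e [c0 c1] d; rewrite /fuse_under /=.
transitivity (\sum_m \sum_n (\sum_t0 \sum_s X f0 (bar s) t0 m * X t0 s c0 n) *
  \sum_t1 X f1 m t1 e * X t1 n c1 d).
  rewrite sum_pair.
  under eq_bigr => t0 _ do under eq_bigr => t1 _ do under eq_bigr => s _ do
    rewrite mulr_suml.
  under eq_bigr => t0 _ do rewrite front_sum3.
  rewrite exchange_big; apply: eq_bigr => m _.
  under eq_bigr => t0 _ do under eq_bigr => t1 _ do under eq_bigr => s _ do
    rewrite mulr_sumr.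
  under eq_bigr => t0 _ do rewrite front_sum3.
  rewrite exchange_big; apply: eq_bigr => n _.
  rewrite mulr_suml2; apply: eq_bigr => t0 _; rewrite exchange_big /=.
  apply: eq_bigr => s _; rewrite mulr_sumr; apply: eq_bigr => t1 _ /=.
  by rewrite mulrACA.
under eq_bigr => m _ do under eq_bigr => n _ do rewrite XU.
transitivity ((c0 == f0)%:R * \sum_t1 \sum_n X f1 (bar n) t1 e * X t1 n c1 d).
  rewrite exchange_big [X in _ * X]exchange_big mulr_sumr; apply: eq_bigr => n _.
  rewrite (bigD1 (bar n)) //= barK eqxx andbT [X in _ + X]big1 ?addr0 // => m /eqP nm.
  by rewrite (_ : n == bar m = false) ?andbF ?mul0r //; apply/eqP=> nE; case: nm; rewrite nE barK.
by rewrite XU xpair_eqE -natrM mulnb andbA.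
Qed.

Lemma grid_fuse (T : finType) (V : T -> T -> T -> T -> algC) a b c d :
  grid V a b c d = fuse_under (fuse_over V) a b c d.
Proof.
rewrite /grid /fuse_under /fuse_over sum_pair /=.
rewrite exchange_big; apply: eq_bigr => m1 _ /=.
under eq_bigr => m0 _ do rewrite exchange_big /=.
rewrite exchange_big; apply: eq_bigr => m3 _ /=.
rewrite mulr_suml; apply: eq_bigr => m0 _; rewrite mulr_sumr; apply: eq_bigr => m2 _.
by rewrite !mulrA.
Qed.
End Unitary.

Section Straight.
Variables (T : finType) (bar : T -> T) (w : bool -> T -> T -> T -> T -> algC).
Hypothesis barK : involutive bar.
Hypothesis w_rot : forall b s0 s1 s2 s3, w b s0 s1 s2 s3 = w (~~ b) s3 s0 s1 s2.

Let sum_bar (F : T -> algC) : \sum_s F (bar s) = \sum_s F s.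
Proof. by rewrite [RHS](reindex_inj (can_inj barK)). Qed.

(** The first two labels are replaced by those at the other ends of their
    arcs. A strand that passes without interaction then keeps its label, and
    the two moves become unitarity (bigon_unitary) and the Yang-Baxter
    equation (triangle_straight), to which crossings as operators apply. *)
Definition straight b s0 s1 s2 s3 := w b (bar s0) (bar s1) s2 s3.

Let w_half b s0 s1 s2 s3 : w b s0 s1 s2 s3 = w b s2 s3 s0 s1.
Proof. by rewrite 2!w_rot negbK. Qed.

Let w_rotV b s0 s1 s2 s3 : w (~~ b) s0 s1 s2 s3 = w b s1 s2 s3 s0.
Proof. by rewrite w_half w_rot negbK. Qed.

Lemma bigon_unitary b :
  (forall p2 p3 q2 q3, \sum_s \sum_t w b (bar t) s p2 p3 * w (~~ b) (bar s) t q2 q3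
      = ((q2 == bar p3) && (q3 == bar p2))%:R) <-> unitary bar (straight b).
Proof.
have E f e c d : \sum_t \sum_s straight b f (bar s) t e * straight b t s c d
    = \sum_s \sum_t w b (bar t) s c d * w (~~ b) (bar s) t e (bar f).
  rewrite exchange_big -[RHS]sum_bar; apply: eq_bigr => s _; apply: eq_bigr => t _.
  by rewrite /straight barK w_rotV [w b t e _ _]w_half mulrC.
have eq_bar x y : (x == bar y) = (y == bar x).
  by rewrite -(inj_eq (can_inj barK)) barK eq_sym.
have dE p2 p3 q2 q3 : (p2 == bar q3) && (p3 == bar q2) = (q2 == bar p3) && (q3 == bar p2).
  by rewrite andbC (eq_bar p3) (eq_bar p2).
split=> [H f e c d | H p2 p3 q2 q3]; first by rewrite E H -dE barK.
by have := H (bar q3) q2 p2 p3; rewrite E barK dE.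
Qed.

Lemma triangle_straight b :
  (forall p2 p3 q2 q3 r2 r3,
    \sum_x \sum_y \sum_z
      w b (bar z) x p2 p3 * w b (bar x) y q2 q3 * w (~~ b) (bar y) z r2 r3
    = \sum_x \sum_y \sum_z
      w b r3 q2 (bar z) x * w b p3 r2 (bar x) y * w (~~ b) q3 p2 (bar y) z)
  <-> yang_baxter (straight b).
Proof.
have L p2 p3 q2 q3 r2 r3 : \sum_x \sum_y \sum_z
      w b (bar z) x p2 p3 * w b (bar x) y q2 q3 * w (~~ b) (bar y) z r2 r3
    = \sum_x \sum_y \sum_z straight b (bar p2) (bar p3) z x * straight b z (bar r2) r3 y
      * straight b x y q2 q3.
  apply: eq_bigr => x _; rewrite -[LHS]sum_bar; apply: eq_bigr => y _.
  rewrite -[LHS]sum_bar; apply: eq_bigr => z _; rewrite /straight !barK mulrAC.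
  by rewrite w_half [w (~~ b) _ _ _ _]w_rotV.
have R p2 p3 q2 q3 r2 r3 : \sum_x \sum_y \sum_z
      w b r3 q2 (bar z) x * w b p3 r2 (bar x) y * w (~~ b) q3 p2 (bar y) z
    = \sum_x \sum_y \sum_z straight b (bar p3) (bar r2) x y * straight b (bar p2) y z q3
      * straight b z x r3 q2.
  rewrite -[LHS]sum_bar; apply: eq_bigr => x _; apply: eq_bigr => y _; apply: eq_bigr => z _.
  by rewrite /straight !barK [w b r3 _ _ _]w_half w_rotV -mulrA mulrC.
split=> [H B0 M0 T0 B2 M2 T2 | H p2 p3 q2 q3 r2 r3]; last by rewrite L R H.
by have := H (bar B0) (bar M0) M2 T2 (bar T0) B2; rewrite L R !barK.
Qed.
End Straight.

Section Doubling.
Variable W : model.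
Local Notation T := (lab W).
Local Notation w := (wt (m := W)).
Local Notation bar := (@bar W).

(** The grid with the labels of each pair of parallel branches in clockwise
    order around it, so that t0.2 is next to t1.1. *)
Definition double_wt b (t0 t1 t2 t3 : T * T) : algC :=
  \sum_m0 \sum_m1 \sum_m2 \sum_m3
    w b t0.2 t1.1 m0 (bar m3) * w b (bar m0) t1.2 t2.1 m1 *
    w b m2 (bar m1) t2.2 t3.1 * w b t0.1 m3 (bar m2) t3.2.

Lemma double_lab_gt0 : (0 < #|{: T * T}|)%N.
Proof. by rewrite card_prod muln_gt0 lab_gt0. Qed.

Lemma swap_barK : involutive (swap_bar bar).
Proof. by case=> s t; rewrite /swap_bar /= !barK. Qed.

Lemma double_rot b s0 s1 s2 s3 : double_wt b s0 s1 s2 s3 = double_wt (~~ b) s3 s0 s1 s2.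
Proof.
rewrite /double_wt front_sum4; do 4!apply: eq_bigr => ? _.
rewrite [in LHS]wt_rot [w b _ s1.2 _ _]wt_rot [w b _ _ s2.2 _]wt_rot [w b s0.1 _ _ _]wt_rot.
by rewrite mulrC !mulrA.
Qed.

Lemma straight_double b a0 a1 a2 a3 :
  straight (swap_bar bar) double_wt b a0 a1 a2 a3 = grid (straight bar w b) a0 a1 a2 a3.
Proof.
apply: eq_bigr => m0 _; apply: eq_bigr => m1 _; rewrite -[LHS]sum_bar.
apply: eq_bigr => m2 _; rewrite -[LHS]sum_bar; apply: eq_bigr => m3 _.
by rewrite /straight /= !barK mulrAC.
Qed.

Lemma double_bigon b p2 p3 q2 q3 :
  \sum_s \sum_t double_wt b (swap_bar bar t) s p2 p3 * double_wt (~~ b) (swap_bar bar s) t q2 q3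
      = ((q2 == swap_bar bar p3) && (q3 == swap_bar bar p2))%:R.
Proof.
move: p2 p3 q2 q3; apply/(bigon_unitary swap_barK double_rot b) => f e c d.
under eq_bigr => t _ do under eq_bigr => s _ do rewrite !straight_double !grid_fuse.
apply: fuse_under_unitary swap_barK (fuse_over_unitary _) _ _ _ _.
by apply/(bigon_unitary (@barK W) (@wt_rot W)) => *; rewrite wt_bigon.
Qed.

Lemma double_triangle b p2 p3 q2 q3 r2 r3 :
  \sum_x \sum_y \sum_z
      double_wt b (swap_bar bar z) x p2 p3 * double_wt b (swap_bar bar x) y q2 q3 *
      double_wt (~~ b) (swap_bar bar y) z r2 r3
    = \sum_x \sum_y \sum_z
      double_wt b r3 q2 (swap_bar bar z) x * double_wt b p3 r2 (swap_bar bar x) y *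
      double_wt (~~ b) q3 p2 (swap_bar bar y) z.
Proof.
move: p2 p3 q2 q3 r2 r3; apply/(triangle_straight swap_barK double_rot b) => a m t a' m' t'.
under eq_bigr => x _ do under eq_bigr => y _ do under eq_bigr => z _ do rewrite !straight_double.
under [RHS]eq_bigr => x _ do under eq_bigr => y _ do under eq_bigr => z _ do
  rewrite !straight_double.
apply: grid_yang_baxter; apply/(triangle_straight (@barK W) (@wt_rot W) b) => *.
by rewrite wt_triangle.
Qed.

Definition double_model : model :=
  Model double_lab_gt0 swap_barK double_rot double_bigon double_triangle.
End Doubling.

(** * The Kauffman bracket as a model *)

Section Bracket.
Variables (N : nat) (A : algC).
Hypothesis AN : A ^+ 2 + A ^- 2 = - N.+1%:R.
Local Notation T := 'I_N.+1.

Definition smoothing_wt (b : bool) := if b then A^-1 else A.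

(** The two smoothings of a crossing connect the branches in pairs, which
    then carry equal labels. A loop can be labeled in N + 1 ways, which is
    the value -A^2 - A^-2 that the bracket assigns to it. *)
Definition bracket_wt b (s0 s1 s2 s3 : T) : algC :=
  smoothing_wt b * ((s0 == s1) && (s2 == s3))%:R
    + smoothing_wt (~~ b) * ((s1 == s2) && (s3 == s0))%:R.

Lemma bracket_neq0 : A != 0.
Proof.
apply/eqP=> A0; move/eqP: AN; rewrite A0 expr0n /= invr0 addr0 eq_sym oppr_eq0.
by rewrite pnatr_eq0.
Qed.

Lemma bracket_rot b s0 s1 s2 s3 : bracket_wt b s0 s1 s2 s3 = bracket_wt (~~ b) s3 s0 s1 s2.
Proof. by rewrite /bracket_wt negbK addrC; congr (_ * _%:R + _ * _%:R); rewrite andbC. Qed.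

Let delta (s t : T) : algC := (s == t)%:R.
Let deltaC s t : delta s t = delta t s. Proof. by rewrite /delta eq_sym. Qed.

Let sum_delta s (F : T -> algC) : \sum_t delta s t * F t = F s.
Proof.
rewrite (bigD1 s) //= /delta eqxx mul1r big1 ?addr0 // => t /negPf ts.
by rewrite eq_sym ts mul0r.
Qed.

Let wtE b s0 s1 s2 s3 : bracket_wt b s0 s1 s2 s3 =
  smoothing_wt b * delta s0 s1 * delta s2 s3 + smoothing_wt (~~ b) * delta s1 s2 * delta s3 s0.
Proof. by rewrite /bracket_wt /delta -!mulnb !natrM !mulrA. Qed.

Let sum0 b s1 s2 s3 (F : T -> algC) : \sum_t bracket_wt b t s1 s2 s3 * F t =
  smoothing_wt b * delta s2 s3 * F s1 + smoothing_wt (~~ b) * delta s1 s2 * F s3.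
Proof.
rewrite -[F s1 in RHS]sum_delta -[F s3 in RHS]sum_delta !mulr_sumr -big_split.
by apply: eq_bigr => t _; rewrite wtE /= (deltaC s1 t); ring.
Qed.

Let sum1 b s0 s2 s3 (F : T -> algC) : \sum_t bracket_wt b s0 t s2 s3 * F t =
  smoothing_wt b * delta s2 s3 * F s0 + smoothing_wt (~~ b) * delta s3 s0 * F s2.
Proof.
under eq_bigr => t _ do rewrite bracket_rot bracket_rot bracket_rot !negbK.
by rewrite sum0 negbK addrC.
Qed.

Let card_sum (c : algC) : \sum_(t : T) c = - (A ^+ 2 + A ^- 2) * c.
Proof. by rewrite sumr_const card_ord AN opprK mulr_natl. Qed.

Let sum_loop b s2 s3 : \sum_s bracket_wt b s s s2 s3 =
  smoothing_wt b * delta s2 s3 * (- (A ^+ 2 + A ^- 2)) + smoothing_wt (~~ b) * delta s2 s3.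
Proof.
under eq_bigr => s _ do rewrite wtE.
rewrite big_split /=; congr (_ + _).
  by under eq_bigr => s _ do rewrite {1}/delta eqxx mulr1; rewrite card_sum mulrC.
under eq_bigr => s _ do rewrite -mulrA.
rewrite -mulr_sumr -(sum_delta s2 (fun s => delta s s3)); congr (_ * _).
by apply: eq_bigr => s _; rewrite [delta s s2]deltaC [delta s3 s]deltaC.
Qed.

Lemma bracket_bigon b (p2 p3 q2 q3 : T) :
  \sum_s \sum_t bracket_wt b t s p2 p3 * bracket_wt (~~ b) s t q2 q3
      = ((q2 == p3) && (q3 == p2))%:R.
Proof.
have A0 := bracket_neq0.
under eq_bigr => s _ do rewrite sum0.
rewrite -mulnb natrM -/(delta q2 p3) -/(delta q3 p2) big_split /=.
have -> : \sum_s smoothing_wt b * delta p2 p3 * bracket_wt (~~ b) s s q2 q3 =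
  smoothing_wt b * delta p2 p3 * (smoothing_wt (~~ b) * delta q2 q3 * (- (A ^+ 2 + A ^- 2))
    + smoothing_wt b * delta q2 q3).
  by rewrite -mulr_sumr sum_loop negbK; ring.
have -> : \sum_s smoothing_wt (~~ b) * delta s p2 * bracket_wt (~~ b) s p3 q2 q3 =
  smoothing_wt (~~ b) * bracket_wt (~~ b) p2 p3 q2 q3.
  rewrite -[in RHS](sum_delta p2 (fun s => bracket_wt (~~ b) s p3 q2 q3)) mulr_sumr.
  by apply: eq_bigr => s _; rewrite mulrA (deltaC s).
rewrite wtE negbK (deltaC q3) (deltaC q2 p3) /smoothing_wt; case: b => /=; field; exact: A0.
Qed.

(** Smoothing the crossing p leaves a bigon, or else a crossing next to one
    that is smoothed in turn. *)
Let triangle_sum b p2 p3 q2 q3 r2 r3 :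
  \sum_x \sum_y \sum_z
      bracket_wt b z x p2 p3 * bracket_wt b x y q2 q3 * bracket_wt (~~ b) y z r2 r3
    = smoothing_wt b * delta p2 p3 * delta q3 r2 * delta q2 r3
      + smoothing_wt (~~ b) * (smoothing_wt b * delta q2 q3 * bracket_wt (~~ b) p2 p3 r2 r3
         + smoothing_wt (~~ b) * delta q3 p2 * bracket_wt (~~ b) q2 p3 r2 r3).
Proof.
under eq_bigr => x _ do under eq_bigr => y _ do under eq_bigr => z _ do rewrite -mulrA.
under eq_bigr => x _ do under eq_bigr => y _ do rewrite sum0.
under eq_bigr => x _ do rewrite big_split /=.
rewrite big_split /=; congr (_ + _).
  rewrite exchange_big /=; under eq_bigr => x _ do rewrite -mulr_sumr.
  by rewrite -mulr_sumr bracket_bigon -mulnb natrM (eq_sym r2) (eq_sym r3) !mulrA.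
rewrite exchange_big -(sum1 b p2 q2 q3 (fun y => bracket_wt (~~ b) y p3 r2 r3)) mulr_sumr.
apply: eq_bigr => y _.
rewrite -(sum_delta p2 (fun x => bracket_wt b x y q2 q3)) mulr_suml mulr_sumr.
by apply: eq_bigr => x _; rewrite (deltaC x) !mulrA.
Qed.

Lemma bracket_triangle b (p2 p3 q2 q3 r2 r3 : T) :
  \sum_x \sum_y \sum_z
      bracket_wt b z x p2 p3 * bracket_wt b x y q2 q3 * bracket_wt (~~ b) y z r2 r3
    = \sum_x \sum_y \sum_z
      bracket_wt b r3 q2 z x * bracket_wt b p3 r2 x y * bracket_wt (~~ b) q3 p2 y z.
Proof.
have A0 := bracket_neq0.
have half c s0 s1 s2 s3 : bracket_wt c s0 s1 s2 s3 = bracket_wt c s2 s3 s0 s1.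
  by rewrite 2!bracket_rot negbK.
under [RHS]eq_bigr => x _ do under eq_bigr => y _ do under eq_bigr => z _ do
  rewrite half [X in _ * X * _]half [X in _ * X]half.
rewrite !triangle_sum !wtE !negbK /smoothing_wt.
(* The arguments of all deltas are brought into one order, so that equal
   deltas become the same variable. *)
rewrite ?(deltaC p3 p2) ?(deltaC q2 p2) ?(deltaC q3 p2) ?(deltaC r2 p2)
  ?(deltaC r3 p2) ?(deltaC q2 p3) ?(deltaC q3 p3) ?(deltaC r2 p3)
  ?(deltaC r3 p3) ?(deltaC q3 q2) ?(deltaC r2 q2) ?(deltaC r3 q2)
  ?(deltaC r2 q3) ?(deltaC r3 q3) ?(deltaC r3 r2).
by case: b => /=; field.
Qed.
End Bracket.

Lemma ord_gt0 N : (0 < #|'I_N.+1|)%N.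
Proof. by rewrite card_ord. Qed.

(** Instead of a bracket with a variable A there is a model for each N,
    where A is one of the solutions of AN. The infinitely many values thus
    obtained suffice to compare polynomials in A. *)
Definition bracket_model N A (AN : A ^+ 2 + A ^- 2 = - N.+1%:R) : model :=
  @Model 'I_N.+1 id (bracket_wt (N := N) A) (ord_gt0 N)
   (fun _ => erefl) (@bracket_rot N A) (bracket_bigon AN) (bracket_triangle AN).

(** * Matrices that slide along a strand, and kinks *)

Section Kinks.
Variable W : model.
Local Notation T := (lab W).
Local Notation w := (wt (m := W)).
Local Notation bar := (@bar W).
Local Notation mat := (T -> T -> algC).
Local Notation tensor := (bool -> T -> T -> T -> T -> algC).
Implicit Types (M : mat) (V : tensor).

Definition mone : mat := fun s t => (s == t)%:R.
Definition mmul M M' : mat := fun s t => \sum_m M s m * M' m t.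
(** The matrix M as met when travelling along the strand in the opposite
    direction. *)
Definition dag M : mat := fun s t => M (bar t) (bar s).

Lemma sum_delta_l s (F : T -> algC) : \sum_t (s == t)%:R * F t = F s.
Proof.
rewrite (bigD1 s) //= eqxx mul1r big1 ?addr0 // => t /negPf ts.
by rewrite eq_sym ts mul0r.
Qed.

Lemma sum_delta_r s (F : T -> algC) : \sum_t F t * (t == s)%:R = F s.
Proof.
by rewrite -[RHS](sum_delta_l s F); apply: eq_bigr => t _; rewrite mulrC eq_sym.
Qed.

Lemma matP M M' : (forall s t, M s t = M' s t) -> M = M'.
Proof. by move=> MM'; do 2!apply: functional_extensionality => ?. Qed.

Lemma mmulA M M' M'' : mmul M (mmul M' M'') = mmul (mmul M M') M''.
Proof.
apply: matP => s t; rewrite /mmul; under eq_bigr => m _ do rewrite mulr_sumr.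
rewrite exchange_big; apply: eq_bigr => n _; rewrite mulr_suml.
by apply: eq_bigr => m _; rewrite mulrA.
Qed.

Lemma mmul1 M : mmul mone M = M.
Proof. by apply: matP => s t; rewrite /mmul /mone sum_delta_l. Qed.

Lemma mulm1 M : mmul M mone = M.
Proof. by apply: matP => s t; rewrite /mmul /mone sum_delta_r. Qed.

Lemma dagK M : dag (dag M) = M.
Proof. by apply: matP => s t; rewrite /dag !barK. Qed.

Lemma dag_mul M M' : dag (mmul M M') = mmul (dag M') (dag M).
Proof.
by apply: matP => s t; rewrite /dag /mmul -[RHS]sum_bar; apply: eq_bigr => m _;
  rewrite barK mulrC.
Qed.

Lemma dag_one : dag mone = mone.
Proof. by apply: matP => s t; rewrite /dag /mone (inj_eq (can_inj (@barK W))) eq_sym. Qed.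

Definition rotative (V : tensor) := forall b s0 s1 s2 s3, V b s0 s1 s2 s3 = V (~~ b) s3 s0 s1 s2.

(** M can be moved from the branch 0 of a crossing straight through to the
    branch 2. *)
Definition commutes (V : tensor) M := forall b s0 s1 s2 s3,
  \sum_m M s0 m * V b m s1 s2 s3 = \sum_m dag M s2 m * V b s0 s1 m s3.

Definition central := commutes w.

(** The weight of a crossing that both strands pass without interaction. *)
Definition virtual : tensor := fun _ s0 s1 s2 s3 => ((s2 == bar s0) && (s3 == bar s1))%:R.

Lemma eq_bar (s t : T) : (s == bar t) = (t == bar s).
Proof. by rewrite -(inj_eq (can_inj (@barK W))) barK eq_sym. Qed.

Lemma virtual_rotative : rotative virtual.
Proof. by move=> b s0 s1 s2 s3; rewrite /virtual andbC (eq_bar s1). Qed.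

Lemma virtual_commutes M : commutes virtual M.
Proof.
move=> b s0 s1 s2 s3; rewrite /virtual.
under eq_bigr => m _ do rewrite -mulnb natrM mulrA eq_bar.
under [RHS]eq_bigr => m _ do rewrite -mulnb natrM mulrA.
by rewrite -!mulr_suml !sum_delta_r /dag barK.
Qed.

(** The matrix of a curl: the branches 0 and 1 of a crossing are the two
    ends of one arc. *)
Definition kink b : mat := fun s t => \sum_u w b (bar u) u s (bar t).

Lemma central_one : central mone.
Proof.
by move=> b s0 s1 s2 s3; rewrite dag_one /mone !sum_delta_l.
Qed.

Lemma central_mul M M' : central M -> central M' -> central (mmul M M').
Proof.
move=> cM cM' b s0 s1 s2 s3; rewrite dag_mul /mmul.
under eq_bigr => m _ do rewrite mulr_suml.
under [RHS]eq_bigr => m _ do rewrite mulr_suml.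
rewrite exchange_big [RHS]exchange_big /=.
transitivity (\sum_n \sum_m M s0 n * (dag M' s2 m * w b n s1 m s3)).
  apply: eq_bigr => n _; rewrite -mulr_sumr -cM' mulr_sumr.
  by apply: eq_bigr => m _; rewrite mulrA.
transitivity (\sum_m \sum_n dag M' s2 m * (dag M m n * w b s0 s1 n s3)).
  rewrite exchange_big; apply: eq_bigr => m _ /=; rewrite -mulr_sumr -cM mulr_sumr.
  by apply: eq_bigr => n _; rewrite mulrCA.
by do 2!apply: eq_bigr => ? _; rewrite mulrA.
Qed.

Lemma commutes_dag V M : rotative V -> commutes V M -> commutes V (dag M).
Proof.
move=> rV cM b s0 s1 s2 s3; rewrite dagK.
have half t0 t1 t2 t3 : V b t0 t1 t2 t3 = V b t2 t3 t0 t1 by rewrite 2!rV negbK.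
under eq_bigr => m _ do rewrite half.
by rewrite -cM; apply: eq_bigr => m _; rewrite half.
Qed.

Lemma central_dag M : central M -> central (dag M).
Proof. by apply: commutes_dag => *; apply: wt_rot. Qed.

Lemma wt_triangle_gen bp bq br p2 p3 q2 q3 r2 r3 : ~~ ((bp == bq) && (bq == br)) ->
  \sum_x \sum_y \sum_z w bp (bar z) x p2 p3 * w bq (bar x) y q2 q3 * w br (bar y) z r2 r3
  = \sum_x \sum_y \sum_z w bp r3 q2 (bar z) x * w bq p3 r2 (bar x) y * w br q3 p2 (bar y) z.
Proof.
have [->|pq] := eqVneq bp bq; first by move=> qr; rewrite (_ : br = ~~ bq) ?wt_triangle //;
  move: qr; case: bq; case: br.
move=> _; have [->|pr] := eqVneq br bp.
  rewrite front_sum3 [RHS]front_sum3 (_ : bq = ~~ bp); last by move: pq; case: bq; case: bp.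
  have E := wt_triangle bp r2 r3 p2 p3 q2 q3.
  etransitivity; [|etransitivity; [exact: E|]]; do 3!apply: eq_bigr => ? _.
    by rewrite mulrC mulrA.
  by rewrite -mulrA mulrC.
have [-> ->] : br = bq /\ bp = ~~ bq by move: pq pr; case: bq; case: bp; case: br.
have E := wt_triangle bq q2 q3 r2 r3 p2 p3; rewrite front_sum3 [RHS]front_sum3 in E.
etransitivity; [|etransitivity; [exact: E|]]; do 3!apply: eq_bigr => ? _.
  by rewrite -mulrA mulrC.
by rewrite mulrC mulrA.
Qed.

(** A strand is pulled across a curl by a third move, which makes a bigon
    with the strand, and a second one. *)
Let kink_slide b c p2 p3 q2 q3 :
  \sum_x \sum_y \sum_z w b (bar z) x p2 p3 * w (~~ b) (bar x) y q2 q3 * kink c (bar y) (bar z)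
    = (p3 == bar q2)%:R * kink c q3 (bar p2).
Proof.
transitivity (\sum_t \sum_x \sum_y \sum_z w b (bar z) x p2 p3 * w (~~ b) (bar x) y q2 q3 *
    w c (bar y) z (bar t) t).
  rewrite -[RHS]front_sum4; do 3!apply: eq_bigr => ? _; rewrite -mulr_sumr; congr (_ * _).
  by apply: eq_bigr => u _; rewrite barK wt_half.
have bits : ~~ ((b == ~~ b) && (~~ b == c)) by case: (b).
under eq_bigr => t _ do rewrite (wt_triangle_gen _ _ _ _ _ _ bits).
transitivity (\sum_y \sum_z ((y == z) && (p3 == bar q2))%:R * w c q3 p2 (bar y) z).
  rewrite exchange_sum4; apply: eq_bigr => y _; apply: eq_bigr => z _.
  rewrite -mulr_suml2; congr (_ * _).
  rewrite -[z in y == z](@barK W) -(wt_bigon (~~ b) q2 (bar z)).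
  apply: eq_bigr => t _; rewrite -[LHS]sum_bar; apply: eq_bigr => x _.
  by rewrite [w b t _ _ _]wt_rot barK [w (~~ b) p3 _ _ _]wt_rotV.
under eq_bigr => y _ do under eq_bigr => z _ do rewrite -mulnb natrM -mulrA.
under eq_bigr => y _ do rewrite sum_delta_l.
by rewrite -mulr_sumr; congr (_ * _); apply: eq_bigr => y _; rewrite barK wt_half.
Qed.

Lemma kink_central c : central (kink c).
Proof.
move=> b s0 s1 s2 s3.
have E q3 q2 c' d' : \sum_m kink c q3 m * w (~~ b) q2 m c' d'
   = \sum_y kink c (bar y) (bar d') * w (~~ b) c' y q2 q3.
  transitivity (\sum_m \sum_n (n == bar q2)%:R * kink c q3 (bar m) * w (~~ b) (bar n) (bar m) c' d').
    rewrite -[LHS]sum_bar; apply: eq_bigr => m _.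
    under eq_bigr => n _ do rewrite eq_sym -mulrA.
    by rewrite sum_delta_l barK.
  under eq_bigr => m _ do under eq_bigr => n _ do rewrite -(kink_slide b) mulr_suml3.
  rewrite exchange_sum4; under eq_bigr => x _ do under eq_bigr => y _ do rewrite front_sum3.
  transitivity (\sum_x \sum_y \sum_z ((c' == bar x) && (d' == z))%:R *
      (w (~~ b) (bar x) y q2 q3 * kink c (bar y) (bar z))).
    do 3!apply: eq_bigr => ? _; rewrite -[X in _ && (_ == X)](@barK W) -(wt_bigon b) mulr_suml2.
    rewrite exchange_big; apply: eq_bigr => n _; rewrite -[LHS]sum_bar; apply: eq_bigr => m _.
    by rewrite barK wt_half; ring.
  rewrite -[LHS]sum_bar exchange_big; apply: eq_bigr => y _.
  under eq_bigr => x _ do under eq_bigr => z _ do rewrite barK -mulnb natrM -mulrA.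
  under eq_bigr => x _ do rewrite -mulr_sumr sum_delta_l.
  by rewrite sum_delta_l mulrC.
under eq_bigr => m _ do rewrite wt_rot.
by rewrite E; apply: eq_bigr => m _; rewrite /dag [w b _ _ _ _]wt_rotV.
Qed.

(** M travels through the kink, passing its crossing twice. *)
Lemma kink_comm M b : central M -> mmul M (kink b) = mmul (kink b) M.
Proof.
move=> cM; apply: matP => a c; rewrite /mmul.
transitivity (\sum_s \sum_m M a m * w b m (bar c) (bar s) s).
  under eq_bigr => m _ do rewrite mulr_sumr.
  by rewrite exchange_big; do 2!apply: eq_bigr => ? _; rewrite wt_half.
under eq_bigr => s _ do rewrite cM.
under [RHS]eq_bigr => m _ do rewrite mulr_suml.
rewrite [RHS]exchange_big [LHS]exchange_big -[LHS]sum_bar; apply: eq_bigr => u _ /=.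
transitivity (\sum_m M u m * w (~~ b) m a (bar c) (bar u)).
  by apply: eq_bigr => m _; rewrite /dag !barK wt_rot.
rewrite cM -[LHS]sum_bar; apply: eq_bigr => m _.
by rewrite /dag !barK [w b _ _ _ _]wt_rotV mulrC.
Qed.

(** If one of two curls of opposite types is slid into the loop of the
    other, the two crossings form a bigon. *)
Lemma kink_inv b : mmul (dag (kink (~~ b))) (kink b) = mone.
Proof.
apply: matP => a c; rewrite /mmul.
transitivity (\sum_s \sum_m dag (kink (~~ b)) a m * w b m (bar c) (bar s) s).
  under eq_bigr => m _ do rewrite mulr_sumr.
  by rewrite exchange_big; do 2!apply: eq_bigr => ? _; rewrite wt_half.
under eq_bigr => s _ do rewrite (central_dag (kink_central _)) dagK.
under eq_bigr => s _ do under eq_bigr => m _ do rewrite mulr_suml.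
under eq_bigr => s _ do rewrite exchange_big.
rewrite exchange_big /=.
transitivity (\sum_u ((bar u == c) && (u == bar a))%:R : algC).
  apply: eq_bigr => u _; rewrite -[X in _ == X](@barK W) -(wt_bigon b).
  apply: eq_bigr => s _; rewrite -[LHS]sum_bar; apply: eq_bigr => m _.
  by rewrite mulrC wt_half [w (~~ b) _ _ _ _]wt_half barK.
rewrite (bigD1 (bar a)) //= eqxx andbT barK big1 ?addr0 // => u /negPf ->.
by rewrite andbF.
Qed.

(** The bit e tells on which side of the oriented strand the loop of the
    kink lies. *)
Definition letter b (e : bool) : mat := if e then dag (kink b) else kink b.
Definition word b (u : seq bool) : mat := foldr (fun e => mmul (letter b e)) mone u.

Lemma letter_central b e : central (letter b e).
Proof. by case: e; [apply: central_dag|]; apply: kink_central. Qed.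

Lemma word_central b u : central (word b u).
Proof.
by elim: u => [|e u IHu]; [apply: central_one | apply: central_mul => //; apply: letter_central].
Qed.

Lemma letter_comm M b e : central M -> mmul M (letter b e) = mmul (letter b e) M.
Proof.
move=> cM; case: e; rewrite /letter; last exact: kink_comm.
by rewrite -[M]dagK -!dag_mul kink_comm //; apply: central_dag.
Qed.

Lemma word_comm M b u : central M -> mmul M (word b u) = mmul (word b u) M.
Proof.
move=> cM; elim: u => [|e u IHu] /=; first by rewrite mulm1 mmul1.
by rewrite mmulA letter_comm // -mmulA IHu mmulA.
Qed.

Lemma letter_inv b e : mmul (letter b e) (letter (~~ b) (~~ e)) = mone.
Proof.
case: e; rewrite /letter /=; first by rewrite -{1}[b]negbK kink_inv.
by rewrite -kink_comm ?kink_inv //; apply: central_dag; apply: kink_central.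
Qed.

Lemma word_inv b u : mmul (word b u) (word (~~ b) (map negb u)) = mone.
Proof.
elim: u => [|e u IHu] /=; first by rewrite mmul1.
rewrite -mmulA [mmul (word b u) _]mmulA letter_comm; last exact: word_central.
by rewrite -mmulA IHu mulm1 letter_inv.
Qed.

Lemma dag_word b u : dag (word b u) = word b (map negb u).
Proof.
elim: u => [|e u IHu] /=; first exact: dag_one.
rewrite dag_mul IHu (_ : dag (letter b e) = letter b (~~ e)); last first.
  by case: e; rewrite /letter ?dagK.
by apply: letter_comm; apply: word_central.
Qed.
End Kinks.

(** * State sums of diagrams *)

Section DartFacts.
Variable X : finType.
Implicit Type d : dart X.

Lemma cwK : cancel (@cw X) (@ccw X).
Proof. by case=> x i; rewrite /cw /ccw /= ordSK. Qed.

Lemma ccwK : cancel (@ccw X) (@cw X).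
Proof. by case=> x i; rewrite /cw /ccw /= ord_predK. Qed.

Lemma cw3 d : cw (opp d) = ccw d.
Proof. by case: d => x i; congr (_, _); apply/val_inj; case: i => [[|[|[|[]]]]]. Qed.

Lemma oppK : involutive (@opp X).
Proof. by case=> x i; congr (_, _); apply/val_inj; case: i => [[|[|[|[]]]]]. Qed.

Lemma opp_cw d : opp (cw d) = ccw d. Proof. exact: cw3. Qed.

Lemma opp_ccw d : opp (ccw d) = cw d. Proof. by rewrite -opp_cw oppK. Qed.

Lemma ccw_opp d : ccw (opp d) = cw d. Proof. by rewrite -cw3 oppK. Qed.

Lemma odd_cw d : odd (cw d).2 = ~~ odd d.2.
Proof. by case: d => x [[|[|[|[]]]]]. Qed.

Lemma cw_neq d : cw d != d.
Proof. by case: d => x [[|[|[|[]]]]] //= i; rewrite xpair_eqE -val_eqE /= andbF. Qed.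

Lemma opp_neq d : opp d != d.
Proof. by case: d => x [[|[|[|[]]]]] //= i; rewrite xpair_eqE -val_eqE /= andbF. Qed.

Lemma ccw_neq d : ccw d != d.
Proof. by case: d => x [[|[|[|[]]]]] //= i; rewrite xpair_eqE -val_eqE /= andbF. Qed.

Lemma opp_inj : injective (@opp X). Proof. exact: can_inj oppK. Qed.

Lemma dart_cases d d' : d'.1 = d.1 -> [\/ d' = d, d' = cw d, d' = opp d | d' = ccw d].
Proof.
case: d d' => x i [y j] /= ->.
have E k : (x, j) = (x, k) <-> nat_of_ord j = k by split=> [[->]|/val_inj ->].
case: i => [[|[|[|[|]]]]] // ?; case: j E => [[|[|[|[|]]]]] // ? E;
 solve [constructor 1; exact/E | constructor 2; exact/E | constructor 3; exact/E | constructor 4; exact/E].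
Qed.
End DartFacts.

Section StateSum.
Variables (W : model) (X : finType) (e : dart X -> dart X).
Local Notation T := (lab W).
Local Notation bar := (@bar W).
Local Notation mat := (T -> T -> algC).
Local Notation labeling := {ffun dart X -> T}.
Local Notation tensor := (bool -> T -> T -> T -> T -> algC).
Hypothesis eK : involutive e.
Hypothesis e_neq : forall d, e d != d.
Implicit Types (g h : labeling) (d : dart X) (M : mat) (f : labeling -> algC).

Definition compatible g := [forall d, g (e d) == bar (g d)].

Definition state_sum f : algC := \sum_(g | compatible g) f g.

(** M acts at the end d of its arc: it stands between the arc and the
    crossing of d. *)
Definition insert d M f g : algC := \sum_m M (g d) m * f (put g d m).

Definition vertex (V : tensor) g d : algC := V (odd d.2) (g d) (g (cw d)) (g (opp d)) (g (ccw d)).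

Definition weight (V : X -> tensor) g : algC := \prod_x vertex (V x) g (x, ord0).

Lemma vertex_rot V g d d' : rotative V -> d'.1 = d.1 -> vertex V g d' = vertex V g d.
Proof.
move=> rV; have R d0 : vertex V g (cw d0) = vertex V g d0.
  by rewrite /vertex rV odd_cw negbK cwK opp_cw.
by case/dart_cases=> ->; rewrite -?cw3 /opp ?R.
Qed.

(** The weight of the crossings outside of s, in which labels of darts at
    the crossings in s do not occur (rest_put). *)
Definition rest (V : X -> tensor) (s : seq X) g := \prod_(x | x \notin s) vertex (V x) g (x, ord0).

Lemma weight1 V g d : rotative (V d.1) ->
  weight V g = vertex (V d.1) g d * rest V [:: d.1] g.
Proof.
move=> rV; rewrite /weight (bigD1 d.1) //= (vertex_rot g (d := d)) //; congr (_ * _).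
by apply: eq_bigl => x; rewrite inE.
Qed.

Lemma rest_put V s g d m : d.1 \in s -> rest V s (put g d m) = rest V s g.
Proof.
move=> ds; apply: eq_bigr => x xs.
have xd d' : d'.1 = x -> d' != d by move=> d'x; apply: contraNneq xs => dd; rewrite -d'x dd.
by rewrite /vertex !put_neq //; apply: xd.
Qed.

Lemma insert_opp V M d g : rotative (V d.1) -> commutes (V d.1) M ->
  insert d M (weight V) g = insert (opp d) (dag M) (weight V) g.
Proof.
move=> rV cM; rewrite /insert.
under eq_bigr => m _ do rewrite (weight1 _ rV) // rest_put ?inE // mulrA.
under [RHS]eq_bigr => m _ do rewrite (weight1 _ rV) // rest_put ?inE // mulrA.
rewrite -!mulr_suml; congr (_ * _); rewrite /vertex.
have [n1 n2 n3] : [/\ cw d != d, opp d != d & ccw d != d] by rewrite cw_neq opp_neq ccw_neq.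
have [m1 m2] : cw d != opp d /\ ccw d != opp d.
  by split; [rewrite eq_sym cw_neq | rewrite -cw3 cw_neq].
under eq_bigr => m _ do rewrite put_eq !put_neq //.
have m3 : d != opp d by rewrite eq_sym.
under [RHS]eq_bigr => m _ do rewrite put_eq !put_neq //.
by rewrite cM.
Qed.

Definition put_edge g d s := put (put g d s) (e d) (bar s).

Lemma compatible_put_edge g d s : compatible g -> compatible (put_edge g d s).
Proof.
move=> /forallP cg; apply/forallP=> d'; rewrite /put_edge !ffunE.
rewrite (inj_eq (can_inj eK)); have [->|ne] := eqVneq d' (e d).
  by rewrite eK eqxx barK eq_sym (negPf (e_neq d)).
have [_|nd] := eqVneq d' d; first by rewrite eqxx.
rewrite (_ : e d' == d = false) //; apply/eqP=> dE.
by case/eqP: ne; rewrite -dE eK.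
Qed.

Lemma put_edge_id g d s t : compatible g -> s = g d -> put_edge (put_edge g d t) d s = g.
Proof.
move=> /forallP cg ->; apply/ffunP=> d'; rewrite !ffunE.
have [->|_] := eqVneq d' (e d); first by rewrite (eqP (cg d)).
by have [->|] := eqVneq d' d.
Qed.

Lemma put_edge_d g d s : put_edge g d s d = s.
Proof. by rewrite !ffunE eq_sym (negPf (e_neq d)) eqxx. Qed.

(** Changing the label of an arc is a bijection between pairs of a
    compatible labeling and a new label. *)
Lemma state_sum_put_edge d f :
  state_sum (fun g => \sum_s f (put_edge g d s)) = #|T|%:R * state_sum f.
Proof.
rewrite /state_sum mulr_natl -sumr_const [RHS]exchange_big.
rewrite [LHS]pair_big [RHS]pair_big /=.
pose swap (u : labeling * T) := (put_edge u.1 d u.2, u.1 d).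
have swapK u : compatible u.1 && true -> swap (swap u) = u.
  by case: u => g s /andP[/= cg _]; rewrite /swap /= put_edge_id // put_edge_d.
rewrite [RHS](reindex_onto swap swap) => [|u cu]; last exact: swapK.
apply: eq_big => [u|//]; apply/idP/idP => [cu|/andP[/andP[cu _] /eqP uE]].
  by rewrite swapK // eqxx !andbT compatible_put_edge //; case/andP: cu.
by rewrite -uE /= compatible_put_edge.
Qed.

(** Summing over the label of the arc first, M acts on it from either end. *)
Lemma insert_edge d M f : state_sum (insert d M f) = state_sum (insert (e d) (dag M) f).
Proof.
have T0 : #|T|%:R != 0 :> algC by rewrite pnatr_eq0 -lt0n lab_gt0.
apply: (mulfI T0); rewrite -!(state_sum_put_edge d); apply: eq_bigr => g cg.
have put2 s m : put (put_edge g d s) (e d) m = put (put g d s) (e d) m by rewrite /put_edge put_put.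
have put1 s m : put (put_edge g d s) d m = put (put g d m) (e d) (bar s).
  by rewrite /put_edge putC ?e_neq // put_put.
have ed s : put_edge g d s (e d) = bar s by rewrite /put_edge put_eq.
under eq_bigr => s _ do (rewrite /insert put_edge_d; under eq_bigr => m _ do rewrite put1).
under [RHS]eq_bigr => s _ do (rewrite /insert ed; under eq_bigr => m _ do rewrite put2).
rewrite [RHS]exchange_big -[RHS]sum_bar; apply: eq_bigr => s _.
by apply: eq_bigr => m _; rewrite /dag !barK.
Qed.

Lemma insert_put_edge d d0 M f g : d != d0 -> d != e d0 ->
  insert d M (fun h => \sum_s f (put_edge h d0 s)) g
    = \sum_s insert d M f (put_edge g d0 s).
Proof.
move=> nd0 ned0; rewrite /insert exchange_big; apply: eq_bigr => m _ /=.
rewrite mulr_sumr; apply: eq_bigr => s _; rewrite /put_edge !put_neq //.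
by rewrite [put (put (put g d0 s) _ _) _ _]putC 1?eq_sym // [put (put g d0 _) _ _]putC // eq_sym.
Qed.

(** The sum over the labels of one arc. By insert_contract, weights may be
    replaced locally as soon as they agree after contraction of the inner
    arcs, that is, as functions of the remaining labels. *)
Definition contract d f : labeling -> algC := fun h => \sum_s f (put_edge h d s).

Lemma insert_contract d d0 M f : d != d0 -> d != e d0 ->
  state_sum (insert d M (contract d0 f)) = #|T|%:R * state_sum (insert d M f).
Proof.
move=> nd0 ned0; rewrite -(state_sum_put_edge d0); apply: eq_bigr => g _.
exact: insert_put_edge.
Qed.

Lemma insert_comp d M M' f g : insert d M (insert d M' f) g = insert d (mmul M M') f g.
Proof.
rewrite /insert /mmul; under [RHS]eq_bigr => m _ do rewrite mulr_suml.
rewrite exchange_big; apply: eq_bigr => n _; rewrite mulr_sumr; apply: eq_bigr => m _.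
by rewrite put_eq put_put mulrA.
Qed.
End StateSum.

(** * Strands and their orientation *)

Section Dihedral.
Variables (D : finType) (a b : D -> D).
Hypotheses (aK : involutive a) (bK : involutive b).
Hypotheses (a_neq : forall d, a d != d) (b_neq : forall d, b d != d).
Let go d := b (a d).

Lemma go_inj : injective go.
Proof. exact: inj_comp (can_inj bK) (can_inj aK). Qed.

Lemma iter_go_inj n : injective (iter n go).
Proof. by elim: n => // n IHn x y /= /go_inj/IHn. Qed.

Lemma iter_go_back n d : iter n go (a (iter n go d)) = a d.
Proof.
have gag x : go (a (go x)) = a x by rewrite /go aK bK.
by elim: n d => // n IHn d; rewrite iterSr iterS gag IHn.
Qed.

(** Otherwise, d is fixed by some a (b a)^n. This word is a palindrome of
    odd length, so that its middle letter has a fixed point. *)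
Lemma dihedral_neq d : ~~ fconnect go d (a d).
Proof.
apply/negP=> /iter_findex; move: (findex _ _ _) => n.
rewrite -(odd_double_half n) -addnn; set k := n./2; rewrite addnC -addnA iterD.
rewrite -(iter_go_back k d) addnC iterD => /iter_go_inj.
by case: (odd n) => /= /eqP; [rewrite (negPf (b_neq _)) | rewrite eq_sym (negPf (a_neq _))].
Qed.

Let conn_sym x y : fconnect go x y = fconnect go y x.
Proof. exact: (fconnect_sym go_inj). Qed.

Lemma fconnect_a d y : fconnect go (a d) (a y) = fconnect go d y.
Proof.
suff imp u v : fconnect go u v -> fconnect go (a u) (a v).
  by apply/idP/idP => [/imp|/imp//]; rewrite !aK.
move=> /iter_findex <-; rewrite conn_sym -(iter_go_back (findex go u v) u).
exact: fconnect_iter.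
Qed.

Lemma fconnect_b d y : fconnect go (b d) y = fconnect go (a d) y.
Proof. by rewrite (same_fconnect1 go_inj (a d)) /go aK. Qed.

Let strand d := [set y | fconnect go d y || fconnect go d (a y)].

Let strand_a d : strand (a d) = strand d.
Proof.
apply/setP=> y; rewrite !inE orbC fconnect_a; congr (_ || _).
by rewrite -{1}[y]aK fconnect_a.
Qed.

Let strand_b d : strand (b d) = strand d.
Proof. by rewrite -(strand_a d); apply/setP=> y; rewrite !inE !fconnect_b. Qed.

(** An orbit of the group generated by a and b consists of two orbits of go,
    which a and b exchange; both are traversals of the same closed curve, in
    opposite directions. *)
Lemma orientation_exists : exists o : D -> bool, forall d, o (a d) = ~~ o d /\ o (b d) = ~~ o d.
Proof.
pose rep d := odflt d [pick y in strand d].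
have repE d d' : strand d = strand d' -> rep d = rep d'.
  move=> dd; rewrite /rep dd; case: pickP => // /(_ d'); rewrite inE connect0.
  by [].
have rep_in d : rep d \in strand d.
  by rewrite /rep; case: pickP => // _; rewrite inE connect0.
exists (fun d => fconnect go (rep d) d) => d.
rewrite [_ _ (b d)]conn_sym fconnect_b [_ (a d) _]conn_sym (repE (b d) d) // (repE (a d) d) //.
suff -> : fconnect go (rep d) (a d) = ~~ fconnect go (rep d) d by [].
have := rep_in d; rewrite inE => inr; apply/idP/idP => [ra|nr].
  apply: contra (dihedral_neq d) => rd; apply: connect_trans ra; by rewrite conn_sym.
by move: inr; rewrite conn_sym (negPf nr) /= -[d in fconnect _ d _]aK fconnect_a conn_sym.
Qed.
End Dihedral.

Section Strands.
Variables (W : model) (X : finType) (e : dart X -> dart X).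
Local Notation T := (lab W).
Local Notation bar := (@bar W).
Local Notation labeling := {ffun dart X -> T}.
Local Notation tensor := (bool -> T -> T -> T -> T -> algC).
Hypothesis eK : involutive e.
Hypothesis e_neq : forall d, e d != d.
Implicit Types (V : X -> tensor) (M : T -> T -> algC) (d : dart X).
Let next d := opp (e d).

Definition evaluate V d M : algC := state_sum e (insert d M (weight V)).

Lemma evaluate_edge V d M : evaluate V d M = evaluate V (e d) (dag M).
Proof. exact: insert_edge. Qed.

Lemma evaluate_next V d M : (forall x, rotative (V x)) -> (forall x, commutes (V x) M) ->
  evaluate V d M = evaluate V (next d) M.
Proof.
move=> rV cM; rewrite evaluate_edge -[M in RHS]dagK.
apply: eq_bigr => g _; apply: insert_opp => //; exact: commutes_dag.
Qed.

Lemma evaluate_connect V d d' M : (forall x, rotative (V x)) -> (forall x, commutes (V x) M) ->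
  fconnect next d d' -> evaluate V d M = evaluate V d' M.
Proof.
move=> rV cM /iter_findex <-; elim: (findex _ _ _) => //= n ->.
exact: evaluate_next.
Qed.

Definition straight_at (g : labeling) x := [forall i, g (opp (x, i)) == bar (g (x, i))].

Lemma vertex_virtual g x : vertex (@virtual W) g (x, ord0) = (straight_at g x)%:R.
Proof.
rewrite /vertex /virtual; congr (nat_of_bool _)%:R; apply/andP/forallP => [[g0 g1] i|sg].
  have [->|->|->|->] := @dart_cases X (x, ord0) (x, i) erefl; rewrite ?opp_cw ?opp_ccw ?oppK //.
    by rewrite cwK eq_bar.
  by rewrite eq_bar.
split; first exact: sg.
by have := sg (ordS ord0); rewrite -/(cw (x, ord0)) opp_cw.
Qed.

Lemma prod_indicator (I : finType) (P Q : pred I) :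
  \prod_(x | P x) (Q x)%:R = ([forall x, P x ==> Q x])%:R :> algC.
Proof.
have [/forallP PQ|/forallPn[x]] := boolP [forall x, P x ==> Q x].
  by rewrite big1 // => x Px; have /implyP-> := PQ x.
by rewrite negb_imply => /andP[Px /negPf Qx]; rewrite (bigD1 x) //= Qx mul0r.
Qed.

Lemma weight_virtual g :
  weight (fun _ : X => @virtual W) g = ([forall d, g (opp d) == bar (g d)])%:R.
Proof.
rewrite /weight; under eq_bigr => x _ do rewrite vertex_virtual.
rewrite prod_indicator; congr (nat_of_bool _)%:R; apply/forallP/forallP => [sg [x i]|sg x].
  by have /forallP := sg x; apply.
by apply/forallP=> i; apply: sg.
Qed.

(** Without interaction, labels are transported along the curve. As there is
    only one strand, a labeling is determined by its value at d, and M
    closes up to its trace. *)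
Lemma evaluate_virtual d M : (forall d', fconnect next d d' || fconnect next d (e d')) ->
  evaluate (fun _ : X => @virtual W) d M = \sum_t M t t.
Proof.
move=> strand1; have next_inj : injective next by apply: inj_comp (can_inj eK); apply: opp_inj.
have not_both d' : fconnect next d d' -> ~~ fconnect next d (e d').
  move=> dd'; apply: contra (dihedral_neq eK (@oppK X) e_neq (@opp_neq X) d') => de.
  by apply: connect_trans de; rewrite fconnect_sym.
pose c t : labeling := [ffun d' => if fconnect next d d' then t else bar t].
rewrite /evaluate /state_sum; under eq_bigr => g _ do
  (rewrite /insert; under eq_bigr => m _ do rewrite weight_virtual).
rewrite pair_big.
pose good (u : labeling * T) := compatible e u.1 && [forall d', put u.1 d u.2 (opp d') == bar (put u.1 d u.2 d')].
transitivity (\sum_(u | good u) M (u.1 d) u.2).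
  rewrite [RHS]big_mkcond [LHS]big_mkcond; apply: eq_bigr => u _ /=.
  by rewrite /good andbT; case: (compatible e u.1) => //=; case: [forall _, _]; rewrite ?mulr1 ?mulr0.
(* The label g d is transported along the curve from the arc of d on, until
   it returns to d and meets m there. *)
have goodE u : good u -> c u.2 = u.1.
  case: u => g m /andP[/= /forallP cg /forallP sg].
  set h := put g d m in sg *.
  have h1 : h (next d) = g d.
    by rewrite (eqP (sg _)) /h put_neq // (eqP (cg _)) barK.
  have hn n : h (iter n.+1 next d) = g d.
    elim: n => // n IHn; rewrite iterS; set d' := iter n.+1 next d in IHn *.
    have [->//|d'd] := eqVneq d' d.
    have ed' : e d' != d.
      by apply: contraNneq (not_both d' (fconnect_iter _ n.+1 d)) => ->; apply: connect0.
    by rewrite (eqP (sg _)) /h put_neq // (eqP (cg _)) barK -IHn /h put_neq.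
  have mE : m = g d.
    have := hn (fingraph.order next d).-1; rewrite prednK ?fingraph.order_gt0 // iter_order //.
    by rewrite /h put_eq.
  have gE d' : fconnect next d d' -> g d' = g d.
    move=> /iter_findex <-; case: (findex _ _ _) => // n; rewrite -[RHS](hn n) /h.
    by rewrite [RHS]ffunE; case: eqP => // ->.
  apply/ffunP=> d'; rewrite ffunE mE; case: ifPn => [/gE //|nd].
  have := strand1 d'; rewrite (negPf nd) /= => /gE.
  by rewrite (eqP (cg d')) => <-; rewrite barK.
rewrite (reindex_onto (fun t => (c t, t)) snd) /= => [|[g m] /goodE /= <- //].
apply: eq_big => [t|t _]; last by rewrite ffunE connect0.
have ce d' : c t (e d') = bar (c t d').
  rewrite !ffunE; have := strand1 d'; have := not_both d'.
  by case: (fconnect next d d') => [/(_ isT)/negPf->|_ /= ->] //; rewrite barK.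
rewrite eqxx andbT; apply/andP; split; first by apply/forallP=> d'; rewrite /= ce.
have -> : put (c t) d t = c t.
  by apply/ffunP=> d'; rewrite ffunE; case: eqP => // ->; rewrite ffunE connect0.
apply/forallP=> d' /=; rewrite -ce !ffunE.
by rewrite [fconnect next d (e d')](same_fconnect1_r next_inj) /next eK.
Qed.
End Strands.

(** * Removing crossings where strands go straight through *)

Section Removal.
Variables (X X' : finType) (e : dart X -> dart X) (e' : dart X' -> dart X').
Variables (f : X -> X') (removed : seq X').
Hypotheses (eK : involutive e) (e'K : involutive e').
Let F d : dart X' := (f d.1, d.2).
Hypothesis f_inj : injective f.
Hypothesis codom_f : forall x, (x \in codom f) = (x \notin removed).
Let pass := [rel d e | (d.1 \in removed) && (e == e' (opp d))].
Hypothesis passed : forall d, connect pass (e' (F d)) (F (e d)).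
(** Iterating step leads from a dart straight through the removed crossings
    to the first one that is kept. *)
Let step (d : dart X') := if d.1 \in removed then e' (opp d) else d.

Let F_kept d : (F d).1 \in removed = false.
Proof. by apply/negbTE; rewrite -codom_f; apply/codomP; exists d.1. Qed.

Let F_inj : injective F.
Proof. by case=> x i [y j] [/f_inj-> ->]. Qed.

Let kept d : d.1 \notin removed -> exists d0, d = F d0.
Proof.
by case: d => x i; rewrite /= -codom_f => /codomP[y ->]; exists (y, i).
Qed.

Let iter_stepF n d : iter n step (F d) = F d.
Proof. by elim: n => //= n ->; rewrite /step F_kept. Qed.

Let reach r d := exists n, iter n step r = F d.

Let reach_uniq r d d' : reach r d -> reach r d' -> d = d'.
Proof.
case=> n En [m Em]; apply: F_inj.
by rewrite -(iter_stepF m d) -En -iterD addnC iterD Em iter_stepF.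
Qed.

Let reach_step r d : reach (step r) d <-> reach r d.
Proof.
split=> [[n En]|[n En]]; first by exists n.+1; rewrite iterSr.
by exists n; rewrite -iterSr iterS En /step F_kept.
Qed.

Let pass_reach r d : connect pass r (F d) -> reach r d.
Proof.
case/connectP=> p; elim: p r => [|d1 p IHp] d2 /=; first by move=> _ E; exists 0.
case/andP=> /andP[rd2 /eqP d1E] pp lp; apply/reach_step.
by rewrite /step rd2 -d1E; apply: IHp.
Qed.

(** Removed crossings can be passed in either direction, so that the edge of
    the small diagram of which the arc of r is a part leads from r and from
    e' r to its two ends. *)
Let reach_edge r d : reach r d -> reach (e' r) (e d).
Proof.
case=> n; elim: n r => [|n IHn] r; first by move=> /= ->; apply: pass_reach; apply: passed.
rewrite iterSr; have [rr|/kept[d0 ->]] := boolP (r.1 \in removed); last first.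
  by rewrite /step F_kept iter_stepF => /F_inj ->; apply: pass_reach; apply: passed.
rewrite {2}/step rr => /IHn; rewrite e'K => /reach_step.
by rewrite /step rr oppK.
Qed.

Section OneStrand.
Hypothesis strand1 : forall d d' : dart X',
  fconnect (fun d => opp (e' d)) d d' || fconnect (fun d => opp (e' d)) d (e' d').
Variable inhabited : dart X.
Let next d := opp (e' d).

Lemma next_kept r : exists d, fconnect next r (F d).
Proof.
have /orP[?|rF] := strand1 r (F inhabited); first by exists inhabited.
exists (opp inhabited); apply: connect_trans rF _.
by apply/connect1; rewrite /next /= e'K.
Qed.

(** Being closed, the strand returns to a crossing that is kept and cannot
    pass through removed ones forever. *)
Lemma pass_kept r : exists d, connect pass r (F d).
Proof.
have next_inj : injective next by apply: inj_comp (can_inj e'K); apply: opp_inj.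
have [d] := next_kept r; rewrite fconnect_sym // => /iter_findex.
move: (findex _ _ _) => n; elim: n r => [|n IHn] r; first by move=> <-; exists d.
have [rr|/kept[d0 ->] _] := boolP (r.1 \in removed); last by exists d0.
rewrite iterS => rE; have [|d0 rd0] := IHn (step r).
  by rewrite /step rr -rE /next oppK e'K.
exists d0; apply: connect_trans rd0; apply: connect1.
by rewrite /= rr /step rr eqxx.
Qed.
End OneStrand.

Hypothesis kept_reached : forall r, exists d, connect pass r (F d).
Variable inhabited : dart X.

Let reachable r : exists d, reach r d.
Proof. by have [d /pass_reach] := kept_reached r; exists d. Qed.

Variable W : model.
Local Notation T := (lab W).
Local Notation bar := (@bar W).
Local Notation tensor := (bool -> T -> T -> T -> T -> algC).
Variables (V : X -> tensor) (V' : X' -> tensor).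
Hypothesis V'_kept : forall x, V' (f x) = V x.
Hypothesis V'_removed : forall x, x \in removed -> V' x = @virtual W.

Let straight_removed (g : {ffun dart X' -> T}) := [forall x, (x \in removed) ==> straight_at g x].

Lemma weight_removal g :
  weight V' g = (straight_removed g)%:R * weight V [ffun d => g (F d)].
Proof.
rewrite /weight (bigID (mem removed)) /=; congr (_ * _).
  rewrite -prod_indicator; apply: eq_bigr => x rx.
  by rewrite V'_removed // vertex_virtual.
rewrite (reindex_onto f (fun x' => odflt inhabited.1 [pick x | f x == x'])) /=; last first.
  move=> x'; rewrite -codom_f => /codomP[x ->]; case: pickP => [y /eqP //|/(_ x)].
  by rewrite eqxx.
apply: eq_big => [x|x _].
  have -> : f x \notin removed by rewrite -codom_f; apply/codomP; exists x.
  by case: pickP => [y /eqP/f_inj-> | /(_ x)]; rewrite eqxx.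
by rewrite V'_kept /vertex !ffunE.
Qed.

(** Labelings of the small diagram extend uniquely to labelings of the large
    one that are straight at the removed crossings: r gets the label of the
    dart that it leads to. *)
Lemma evaluate_removal d M : evaluate e' V' (F d) M = evaluate e V d M.
Proof.
pose restrict (g : {ffun dart X' -> T}) : {ffun dart X -> T} := [ffun d => g (F d)].
have exd r : exists d, fconnect step r (F d).
  by have [d0 [n En]] := reachable r; exists d0; rewrite -En; apply: fconnect_iter.
have destP r : reach r (xchoose (exd r)).
  by exists (findex step r (F (xchoose (exd r)))); apply: iter_findex; exact: (xchooseP (exd r)).
pose extend (g : {ffun dart X -> T}) : {ffun dart X' -> T} := [ffun r => g (xchoose (exd r))].
have extendE g r d0 : reach r d0 -> extend g r = g d0.
  by move=> rd; rewrite ffunE (reach_uniq (destP r) rd).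
have restrictK g : restrict (extend g) = g.
  by apply/ffunP=> d0; rewrite ffunE (extendE g _ d0) //; exists 0.
have extend_compat g : compatible e g -> compatible e' (extend g).
  move=> /forallP cg; apply/forallP=> r; have [d0 rd] := reachable r.
  by rewrite (extendE g _ _ rd) (extendE g _ _ (reach_edge rd)).
have extend_straight g : compatible e g -> straight_removed (extend g).
  move=> cg; apply/forallP=> x; apply/implyP=> rx; apply/forallP=> i.
  have /forallP/(_ (x, i)) := extend_compat g cg; rewrite !(eq_sym _ (bar _)) => /eqP->.
  have [d0 rd] := reachable (opp (x, i)); apply/eqP; rewrite (extendE g _ _ rd); apply: extendE.
  by move/reach_step: rd; rewrite /step /= rx oppK.
have extendK g : compatible e' g -> straight_removed g -> extend (restrict g) = g.
  move=> /forallP cg /forallP sg; apply/ffunP=> r; have [d0 [n rd]] := reachable r.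
  rewrite (extendE _ _ d0); last by exists n.
  rewrite ffunE -rd; elim: n r {rd} => //= n IHn r; rewrite -iterS iterSr IHn /step.
  case: ifP => // rr; rewrite (eqP (cg _)).
  by have /implyP/(_ rr)/forallP/(_ r.2) := sg r.1; rewrite -surjective_pairing => /eqP->; rewrite barK.
have restrict_compat g : compatible e' g -> straight_removed g -> compatible e (restrict g).
  move=> cg sg; apply/forallP=> d0; have := cg => /forallP/(_ (F d0)).
  have rd : reach (e' (F d0)) (e d0) by apply: reach_edge; exists 0.
  have := extendE (restrict g) _ _ rd; rewrite extendK // => ->.
  by rewrite [restrict g d0]ffunE.
have restrict_put g m : restrict (put g (F d) m) = put (restrict g) d m.
  by apply/ffunP=> d0; rewrite !ffunE (inj_eq F_inj).
have put_straight g m : straight_removed (put g (F d) m) = straight_removed g.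
  apply: eq_forallb => x; case rx: (x \in removed) => //=; apply: eq_forallb => i.
  have nF d1 : d1.1 = x -> d1 != F d.
    by move=> d1x; apply: contraTneq rx => d1F; rewrite -d1x d1F F_kept.
  by rewrite !put_neq //; apply: nF.
rewrite /evaluate /state_sum.
transitivity (\sum_(g | compatible e' g && straight_removed g) insert d M (weight V) (restrict g)).
  rewrite [RHS]big_mkcondr; apply: eq_bigr => g _; rewrite /insert.
  under eq_bigr => m _ do rewrite weight_removal -/(restrict _) restrict_put put_straight.
  case: (straight_removed g); last by rewrite big1 // => m _; rewrite mul0r mulr0.
  by apply: eq_bigr => m _; rewrite mul1r ffunE.
rewrite (reindex_onto extend restrict) /=; last by move=> g /andP[]; apply: extendK.
apply: eq_big => [g|g _]; last by rewrite restrictK.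
rewrite restrictK eqxx andbT; apply/andP/idP => [[cg sg]|cg]; last first.
  by rewrite extend_compat ?extend_straight.
by rewrite -(restrictK g) restrict_compat.
Qed.

End Removal.

(** * The first and the second move *)

Section DartNeq.
Variable X : finType.
Implicit Types d p q : dart X.

Lemma corner_neq d :
  (((d == cw d) = false) * ((d == opp d) = false) *
    ((d == ccw d) = false) * ((cw d == d) = false) *
    ((cw d == opp d) = false) * ((cw d == ccw d) = false) *
    ((opp d == d) = false) * ((opp d == cw d) = false) *
    ((opp d == ccw d) = false) * ((ccw d == d) = false) *
    ((ccw d == cw d) = false) * ((ccw d == opp d) = false))%type.
Proof.
have ncc : ccw d != cw d by rewrite -opp_cw opp_neq.
have ncp : ccw d != opp d by rewrite -cw3 cw_neq.
have noc : opp d != cw d by apply: cw_neq.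
by do !split; apply/negbTE; rewrite ?(cw_neq, opp_neq, ccw_neq) // eq_sym ?(cw_neq, opp_neq, ccw_neq).
Qed.

Lemma far_neq p q : p.1 != q.1 ->
  (((p == q) = false) * ((p == cw q) = false) *
    ((p == opp q) = false) * ((p == ccw q) = false) *
    ((cw p == q) = false) * ((cw p == cw q) = false) *
    ((cw p == opp q) = false) * ((cw p == ccw q) = false) *
    ((opp p == q) = false) * ((opp p == cw q) = false) *
    ((opp p == opp q) = false) * ((opp p == ccw q) = false) *
    ((ccw p == q) = false) * ((ccw p == cw q) = false) *
    ((ccw p == opp q) = false) * ((ccw p == ccw q) = false))%type.
Proof.
move=> pq; do !split; by apply/negbTE; apply: contraNneq pq => /(congr1 fst)/= ->.
Qed.
End DartNeq.

Section LocalMoves.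
Variables (W : model) (X : finType) (e : dart X -> dart X).
Local Notation T := (lab W).
Local Notation bar := (@bar W).
Local Notation labeling := {ffun dart X -> T}.
Local Notation tensor := (bool -> T -> T -> T -> T -> algC).
Local Notation w := (wt (m := W)).
Hypothesis eK : involutive e.
Hypothesis e_neq : forall d, e d != d.
Implicit Types (V : X -> tensor) (M : T -> T -> algC) (d : dart X).

Lemma wt_rotative : rotative w. Proof. exact: wt_rot. Qed.

Lemma weight_rest V (g : labeling) : weight V g = rest V [::] g.
Proof. by apply: eq_bigl. Qed.

Lemma rest_cons V s (g : labeling) d : rotative (V d.1) -> d.1 \notin s ->
  rest V s g = vertex (V d.1) g d * rest V (d.1 :: s) g.
Proof.
move=> rV ds; rewrite /rest (bigD1 d.1) //= (vertex_rot g (d := d)) //; congr (_ * _).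
by apply: eq_bigl => x; rewrite inE negb_or andbC.
Qed.

Arguments rest_cons : clear implicits.

(** The crossings in s are made virtual, which by evaluate_removal amounts
    to removing them. *)
Definition untie (s : seq X) : X -> tensor := fun x => if x \in s then @virtual W else w.

Lemma untie_rotative s x : rotative (untie s x).
Proof. by rewrite /untie; case: ifP => _; [apply: virtual_rotative | apply: wt_rotative]. Qed.

Lemma untie_commutes s x M : central M -> commutes (untie s x) M.
Proof. by rewrite /untie; case: ifP => // _ _; apply: virtual_commutes. Qed.

Lemma rest_untie s (g : labeling) : rest (untie s) s g = rest (fun=> w) s g.
Proof. by apply: eq_bigr => x /negPf xs; rewrite /untie xs. Qed.

Lemma rest_put_edge V s (g : labeling) d t : d.1 \in s -> (e d).1 \in s ->
  rest V s (put_edge e g d t) = rest V s g.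
Proof. by move=> ds es; rewrite /put_edge !rest_put. Qed.

Lemma evaluate_contract (ds : seq (dart X)) d M (f f' : labeling -> algC) :
  all (fun d0 => (d != d0) && (d != e d0)) ds ->
  foldr (contract e) f ds =1 foldr (contract e) f' ds ->
  state_sum e (insert d M f) = state_sum e (insert d M f').
Proof.
have T0 : #|T|%:R != 0 :> algC by rewrite pnatr_eq0 -lt0n lab_gt0.
move=> ads ff; apply: (mulfI (expf_neq0 (size ds) T0)).
have E f0 : state_sum e (insert d M (foldr (contract e) f0 ds)) =
    #|T|%:R ^+ size ds * state_sum e (insert d M f0).
  elim: ds ads {ff} => [|d0 ds IHds] /=; first by rewrite expr0 mul1r.
  by case/andP=> /andP[n1 n2] ads; rewrite insert_contract // IHds // exprS mulrA.
rewrite -!E; apply: eq_bigr => g _; apply: eq_bigr => m _; by rewrite ff.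
Qed.

(** When the label of the loop is summed over, the crossing p becomes a
    matrix acting on the strand. *)
Lemma untie_kink p M : e (cw p) = p ->
  evaluate e (fun=> w) (opp p) M = evaluate e (untie [:: p.1]) (opp p) (mmul M (kink (odd p.2))).
Proof.
move=> loop; rewrite /evaluate.
transitivity (state_sum e (insert (opp p) M
    (insert (opp p) (kink (odd p.2)) (weight (untie [:: p.1]))))); last first.
  by apply: eq_bigr => g _; rewrite insert_comp.
apply: (evaluate_contract (ds := [:: cw p])) => [|h]; first by rewrite /= loop !corner_neq.
rewrite /= /contract.
have vP : p.1 \notin [::] by [].
under eq_bigr => s _ do
  rewrite weight_rest (rest_cons _ _ _ _ wt_rotative vP) rest_put_edge ?loop ?inE //.
under [RHS]eq_bigr => s _ do (rewrite /insert; under eq_bigr => m _ do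
  rewrite weight_rest (rest_cons _ _ _ _ (@untie_rotative _ _) vP) rest_untie rest_put ?inE //
    rest_put_edge ?loop ?inE // mulrA).
rewrite -mulr_suml; under [RHS]eq_bigr => s _ do rewrite -mulr_suml.
rewrite -mulr_suml; congr (_ * _).
rewrite /vertex /put_edge /untie loop inE eqxx /virtual.
under eq_bigr => s _ do rewrite !ffunE !(corner_neq, eqxx).
under [RHS]eq_bigr => s _ do under eq_bigr => m _ do rewrite !ffunE !(corner_neq, eqxx) barK.
under [RHS]eq_bigr => s _ do under eq_bigr => m _ do rewrite -mulnb natrM mulrA.
under [RHS]eq_bigr => s _ do rewrite -mulr_suml sum_delta_r eq_bar.
by rewrite sum_delta_r /kink barK.
Qed.

Lemma untie_bigon p q M : p.1 != q.1 -> e (cw p) = q -> e (cw q) = p -> odd p.2 != odd q.2 ->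
  evaluate e (fun=> w) (opp p) M = evaluate e (untie [:: p.1; q.1]) (opp p) M.
Proof.
move=> pq ep eq' bits; have qp : q.1 != p.1 by rewrite eq_sym.
have bq : odd q.2 = ~~ odd p.2 by move: bits; do 2!case: odd.
pose neqs := (corner_neq p, corner_neq q, far_neq pq, far_neq qp, eqxx).
apply: (evaluate_contract (ds := [:: cw p; cw q])) => [|h].
  by rewrite /= ep eq' !neqs.
have qP : q.1 \notin [:: p.1] by rewrite inE.
have pP : p.1 \notin [::] by [].
have split V g : (forall x, rotative (V x)) -> weight V g =
    vertex (V p.1) g p * vertex (V q.1) g q * rest V [:: q.1; p.1] g.
  by move=> rV; rewrite weight_rest (rest_cons _ _ _ _ (rV _) pP) (rest_cons _ _ _ _ (rV _) qP) mulrA.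
rewrite /= /contract.
have rw : forall x : X, rotative ((fun=> w) x) by move=> x; apply: wt_rotative.
have inr : (p.1 \in [:: q.1; p.1]) * (q.1 \in [:: q.1; p.1]) by rewrite !inE !eqxx orbT.
have restE V g s t : rest V [:: q.1; p.1] (put_edge e (put_edge e g (cw p) s) (cw q) t)
    = rest V [:: q.1; p.1] g.
  by rewrite !rest_put_edge ?ep ?eq' ?inr.
under eq_bigr => s _ do under eq_bigr => t _ do rewrite (split _ _ rw) restE.
under [RHS]eq_bigr => s _ do under eq_bigr => t _ do
  rewrite (split _ _ (@untie_rotative _)) restE.
rewrite -!mulr_suml2; congr (_ * _); last first.
  apply: eq_bigr => x xs; rewrite /untie (_ : (x \in [:: p.1; q.1]) = false) //.
  by apply: negbTE; move: xs; rewrite !inE orbC.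
rewrite /vertex /put_edge /untie !inE !eqxx orbT /virtual ep eq' bq.
under eq_bigr => s _ do under eq_bigr => t _ do rewrite !ffunE !neqs.
under [RHS]eq_bigr => s _ do under eq_bigr => t _ do rewrite !ffunE !neqs.
rewrite wt_bigon.
transitivity (\sum_s \sum_t ((s == h (opp q)) && (t == h (opp p)))%:R *
    ((h (ccw p) == bar s) && (h (ccw q) == bar t))%:R : algC); last first.
  do 2!apply: eq_bigr => ? _; rewrite !barK -!natrM !mulnb; congr (nat_of_bool _)%:R.
  rewrite [_ == h (opp q)]eq_sym [_ == h (opp p)]eq_sym.
  by rewrite ?barK; do 4!case: (_ == _).
rewrite sum_pred2; congr (nat_of_bool _)%:R.
by rewrite (eq_bar (h (opp q))).
Qed.
End LocalMoves.

(** * The third move *)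

Lemma insert_transport (W : model) (X X' : finType) (e : dart X -> dart X)
    (e' : dart X' -> dart X') (phi : dart X -> dart X') d M
    (f : {ffun dart X -> lab W} -> algC) (f' : {ffun dart X' -> lab W} -> algC) :
    bijective phi -> (forall d, e' (phi d) = phi (e d)) ->
    (forall g, f' g = f [ffun d => g (phi d)]) ->
  state_sum e' (insert (phi d) M f') = state_sum e (insert d M f).
Proof.
move=> [psi phiK psiK] ephi ff.
pose pull (g : {ffun dart X' -> lab W}) : {ffun dart X -> lab W} := [ffun d => g (phi d)].
pose push (g : {ffun dart X -> lab W}) : {ffun dart X' -> lab W} := [ffun d => g (psi d)].
have pushK g : pull (push g) = g by apply/ffunP=> d0; rewrite !ffunE phiK.
have pullK g : push (pull g) = g by apply/ffunP=> d0; rewrite !ffunE psiK.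
have phi_inj := can_inj phiK.
rewrite /state_sum (reindex push) /=; last by exists pull => g _.
apply: eq_big => [g|g _].
  apply/forallP/forallP => cg d0; last by rewrite !ffunE -{1}[d0]psiK ephi !phiK.
  by have := cg (phi d0); rewrite ephi !ffunE !phiK.
rewrite /insert ffunE phiK; apply: eq_bigr => m _; rewrite ff; congr (_ * f _).
by apply/ffunP=> d0; rewrite !ffunE phiK (inj_eq phi_inj).
Qed.

Section Swap.
Variable X : finType.
Implicit Types p q r d : dart X.

Lemma swap_crossingsE p q : p.1 != q.1 ->
  [/\ swap_crossings p q (ccw p) = q, swap_crossings p q q = ccw p,
      swap_crossings p q (cw p) = opp q & swap_crossings p q (opp q) = cw p].
Proof.
move=> pq; have qp : q.1 != p.1 by rewrite eq_sym.
pose neqs := (corner_neq p, corner_neq q, far_neq pq, far_neq qp).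
rewrite /swap_crossings !permM; split.
- by rewrite tpermL tpermD ?neqs.
- by rewrite tpermR tpermD ?neqs.
- by rewrite [tperm (ccw p) q _]tpermD ?neqs // tpermL.
- by rewrite [tperm (ccw p) q _]tpermD ?neqs // tpermR.
Qed.

Lemma swap_crossings_id p q d :
  d \notin [:: ccw p; q; cw p; opp q] -> swap_crossings p q d = d.
Proof.
rewrite !inE !negb_or /swap_crossings permM => /and4P[n1 n2 n3 n4].
by rewrite !tpermD // eq_sym.
Qed.

Section Triangle.
Variables p q r : dart X.
Hypotheses (pq : p.1 != q.1) (qr : q.1 != r.1) (rp : r.1 != p.1).
Let s := (swap_crossings p q * swap_crossings q r * swap_crossings r p)%g.
Let qp : q.1 != p.1. Proof. by rewrite eq_sym. Qed.
Let rq : r.1 != q.1. Proof. by rewrite eq_sym. Qed.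
Let pr : p.1 != r.1. Proof. by rewrite eq_sym. Qed.
Let neqs := (corner_neq p, corner_neq q, corner_neq r, far_neq pq, far_neq qp, far_neq qr,
  far_neq rq, far_neq rp, far_neq pr).

Lemma triangle_swapE d :
  s d = swap_crossings r p (swap_crossings q r (swap_crossings p q d)).
Proof. by rewrite /s !permM. Qed.

Lemma triangle_swap :
  ((s p = ccw r) * (s (cw p) = opp q) * (s (opp p) = cw r) * (s (ccw p) = q) *
   (s q = ccw p) * (s (cw q) = opp r) * (s (opp q) = cw p) * (s (ccw q) = r) *
   (s r = ccw q) * (s (cw r) = opp p) * (s (opp r) = cw q) * (s (ccw r) = p))%type.
Proof.
have [p1 p2 p3 p4] := swap_crossingsE pq; have [q1 q2 q3 q4] := swap_crossingsE qr.
have [r1 r2 r3 r4] := swap_crossingsE rp.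
rewrite !triangle_swapE; do !split;
  (rewrite ?(p1, p2, p3, p4); try (rewrite [swap_crossings p q _]swap_crossings_id; last by rewrite !inE !neqs));
  (rewrite ?(q1, q2, q3, q4); try (rewrite [swap_crossings q r _]swap_crossings_id; last by rewrite !inE !neqs));
  (rewrite ?(r1, r2, r3, r4); try (rewrite [swap_crossings r p _]swap_crossings_id; last by rewrite !inE !neqs)) => //.
Qed.

Lemma triangle_swap_id d : d.1 \notin [:: p.1; q.1; r.1] -> s d = d.
Proof.
rewrite !inE !negb_or => /and3P[dp dq dr].
by rewrite triangle_swapE !swap_crossings_id // !inE ?(far_neq dp, far_neq dq, far_neq dr).
Qed.

Lemma triangle_swapK d : s (s d) = d.
Proof.
have [|out] := boolP (d.1 \in [:: p.1; q.1; r.1]); last by rewrite !triangle_swap_id.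
by rewrite !inE => /or3P[] /eqP/dart_cases[]->; rewrite !triangle_swap.
Qed.
End Triangle.
End Swap.

Section Moves.
Variable W : model.
Local Notation T := (lab W).
Local Notation bar := (@bar W).
Local Notation w := (wt (m := W)).

(** After contraction of the three sides, this is the triangle equation. *)
Lemma weight_triangle (X : finType) (e : dart X -> dart X) (p q r : dart X) M :
    involutive e -> (forall d, e d != d) ->
    p.1 != q.1 -> q.1 != r.1 -> r.1 != p.1 ->
    e (cw p) = q -> e (cw q) = r -> e (cw r) = p ->
    ~~ ((odd p.2 == odd q.2) && (odd q.2 == odd r.2)) ->
  let s := (swap_crossings p q * swap_crossings q r * swap_crossings r p)%g in
  state_sum e (insert (opp p) M (weight (fun=> w))) =
  state_sum e (insert (opp p) M (fun g => weight (fun=> w) [ffun d => g (s d)])).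
Proof.
move=> eK e_neq pq qr rp ep eq' er bits s.
have [qp rq pr] : [/\ q.1 != p.1, r.1 != q.1 & p.1 != r.1] by split; rewrite eq_sym.
pose neqs := (corner_neq p, corner_neq q, corner_neq r, far_neq pq, far_neq qp, far_neq qr,
  far_neq rq, far_neq rp, far_neq pr, eqxx).
apply: (evaluate_contract eK e_neq (ds := [:: cw p; cw q; cw r])) => [|h].
  by rewrite /= ep eq' er !neqs.
have rw : forall x : X, rotative ((fun=> w) x) by move=> x; apply: wt_rotative.
have splitE (g : {ffun dart X -> T}) : weight (fun=> w) g =
    vertex w g p * vertex w g q * vertex w g r * rest (fun=> w) [:: r.1; q.1; p.1] g.
  have [p0 q0 r0] : [/\ p.1 \notin [::], q.1 \notin [:: p.1] & r.1 \notin [:: q.1; p.1]].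
    by rewrite !inE negb_or qp rq rp.
  rewrite weight_rest (rest_cons (V := fun _ : X => w) (d := p) _ (rw p.1) p0)
    (rest_cons (V := fun _ : X => w) (d := q) _ (rw q.1) q0).
  by rewrite (rest_cons (V := fun _ : X => w) (d := r) _ (rw r.1) r0) !mulrA.
have restE x y z : rest (fun=> w) [:: r.1; q.1; p.1]
   (put_edge e (put_edge e (put_edge e h (cw p) x) (cw q) y) (cw r) z)
    = rest (fun=> w) [:: r.1; q.1; p.1] h.
  by rewrite !rest_put_edge ?ep ?eq' ?er //= !inE eqxx ?orbT.
have restsE (g : {ffun dart X -> T}) : rest (fun=> w) [:: r.1; q.1; p.1] [ffun d => g (s d)] =
   rest (fun=> w) [:: r.1; q.1; p.1] g.
  apply: eq_bigr => x xs; have idE d : d.1 = x -> s d = d.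
    by move=> dx; apply: triangle_swap_id => //; rewrite dx; move: xs; rewrite !inE !negb_or andbC -andbA andbCA andbA.
  by rewrite /vertex !ffunE !idE.
rewrite /= /contract.
under eq_bigr => x _ do under eq_bigr => y _ do under eq_bigr => z _ do rewrite splitE restE.
under [RHS]eq_bigr => x _ do under eq_bigr => y _ do under eq_bigr => z _ do
  rewrite splitE restsE restE.
rewrite -!mulr_suml3; congr (_ * _).
pose sE := triangle_swap pq qr rp.
rewrite /vertex /put_edge ep eq' er.
under eq_bigr => x _ do under eq_bigr => y _ do under eq_bigr => z _ do rewrite !ffunE !neqs.
rewrite (wt_triangle_gen _ _ _ _ _ _ bits) -[RHS]sum_bar; apply: eq_bigr => x _.
rewrite -[RHS]sum_bar; apply: eq_bigr => y _; rewrite -[RHS]sum_bar; apply: eq_bigr => z _.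
by rewrite !ffunE !sE !neqs !barK.
Qed.
End Moves.

(** * Diagrams of the same knot *)

Local Notation weights W := (fun=> wt (m := W)).

(** The place where matrices are inserted; None stands for a point on the
    diagram without crossings. *)
Definition based (L : diagram) := option (dart (crossing L)).

Definition valid (L : diagram) (od : based L) : Prop :=
  od = None -> #|crossing L| = 0%N.

Definition invariant (W : model) (L : diagram) (od : based L) (M : lab W -> lab W -> algC) : algC :=
  if od is Some d then evaluate (@edge L) (weights W) d M else \sum_t M t t.

Definition turn_round (L : diagram) (od : based L) : based L := omap (@edge L) od.

Lemma invariant_turn W L (od : based L) M :
  invariant (W := W) od M = invariant (turn_round od) (dag M).
Proof.
case: od => [d|] /=; first by apply: evaluate_edge; [apply: edgeK | apply: edge_neq].
by rewrite -[LHS]sum_bar.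
Qed.

Lemma valid_turn (L : diagram) (od : based L) : valid od -> valid (turn_round od).
Proof. by case: od. Qed.

(** As there is only one strand, a base point can be moved to any other,
    though possibly with the opposite direction. *)
Lemma invariant_unique (L : diagram) (od od' : based L) : valid od -> valid od' ->
  (forall W (M : lab W -> lab W -> algC), central M -> invariant (W := W) od M = invariant od' M)
  \/ (forall W (M : lab W -> lab W -> algC), central M -> invariant (W := W) od M = invariant (turn_round od') M).
Proof.
have nodart (d : dart (crossing L)) : #|crossing L| <> 0%N.
  by move=> L0; have := card0_eq L0 d.1; rewrite inE.
case: od => [d|] vd; case: od' => [d'|] vd'; last by left.
- have [dd'|dd'] := orP (one_strand d d'); [left|right] => W M cM /=;
    by apply: evaluate_connect dd' => //; [apply: edgeK | apply: edge_neq | move=> _; apply: wt_rotative].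
- by case: (nodart d); apply: vd'.
- by case: (nodart d'); apply: vd.
Qed.

(** The state sums agree for all models after insertion of suitable kinks.
    The central matrix M makes it possible to insert further kinks and thus
    to compose such links. *)
Definition linked (L L' : diagram) (od : based L) (od' : based L') (u u' : seq bool) :=
  [/\ valid od, valid od' & forall W (M : lab W -> lab W -> algC), central M ->
    invariant (W := W) od (mmul M (word (W := W) false u)) = invariant od' (mmul M (word (W := W) false u'))].

Definition related (L L' : diagram) := exists od od' u u', @linked L L' od od' u u'.

Lemma related_sym L L' : related L L' -> related L' L.
Proof.
by case=> od [od' [u [u' [vd vd' E]]]]; exists od', od, u', u; split=> // W M /E.
Qed.

Lemma central_word (W : model) M b u : central M -> central (mmul M (word (W := W) b u)).
Proof. by move=> cM; apply: central_mul => //; apply: word_central. Qed.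

Lemma linked_turn L L' (od : based L) (od' : based L') u u' : linked od od' u u' ->
  linked (turn_round od) (turn_round od') (map negb u) (map negb u').
Proof.
case=> vd vd' E; split; try exact: valid_turn.
move=> W M cM; rewrite -!dag_word -[M]dagK -!dag_mul.
have cd := central_dag cM; rewrite -!word_comm //.
by rewrite -!invariant_turn E.
Qed.

Lemma word_cat (W : model) b u v : word (W := W) b (u ++ v) = mmul (word (W := W) b u) (word (W := W) b v).
Proof. by elim: u => [|e u IHu] /=; rewrite ?mmul1 // IHu mmulA. Qed.

Lemma linked_trans L L' L'' (od : based L) (od' : based L') (od'' : based L') (od3 : based L'') u u' v v' :
  linked od od' u u' -> linked od'' od3 v v' ->
  (forall W (M : lab W -> lab W -> algC), central M -> invariant (W := W) od' M = invariant od'' M) ->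
  related L L''.
Proof.
case=> vd vd' E [vd'' vd3 E'] dd; exists od, od3, (v ++ u), (u' ++ v'); split=> // W M cM.
rewrite !word_cat !mmulA E; last exact: central_word.
rewrite dd; last by apply: central_word; apply: central_word.
rewrite -mmulA (word_comm _ _ (word_central _ _)) mmulA E' //; exact: central_word.
Qed.

Lemma related_trans L L' L'' : related L L' -> related L' L'' -> related L L''.
Proof.
move=> [od [od' [u [u' l1]]]] [od'' [od3 [v [v' l2]]]].
have [_ vd' _] := l1; have [vd'' _ _] := l2.
have [E|E] := invariant_unique vd' vd''; first exact: linked_trans l1 l2 E.
exact: linked_trans l1 (linked_turn l2) E.
Qed.

Lemma valid_pick L : valid ([pick d : dart (crossing L)]).
Proof.
case: pickP => // nd _; apply/eqP; rewrite -leqn0 leqNgt; apply/negP => /card_gt0P[x _].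
by have := nd (x, ord0).
Qed.

Lemma related_refl L : related L L.
Proof.
by exists [pick d], [pick d], [::], [::]; split=> //; apply: valid_pick.
Qed.

(** Once the crossings of the polygon are virtual, they can be removed. If
    no crossing is left, then the strand passes only virtual ones and M is
    closed up to its trace. *)
Lemma removal_invariant (L L' : diagram) (cs : seq (dart (crossing L'))) r : removal L cs ->
  exists2 od : based L, valid od & forall W (M : lab W -> lab W -> algC), central M ->
    evaluate (@edge L') (untie (W := W) [seq c.1 | c <- cs]) r M = invariant od M.
Proof.
case=> f [f_inj codom_f passed _]; set removed := map _ _ in codom_f passed *.
case: (pickP (fun _ : dart (crossing L) => true)) => [d0 _|nd].
  have [d rd] := next_kept f (@edgeK L') (@one_strand L') d0 r.
  exists (Some d) => // W M cM.
  rewrite (evaluate_connect (@edgeK L') (@edge_neq L') _ _ rd); last 2 first.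
  - by move=> x; apply: untie_rotative.
  - by move=> x; apply: untie_commutes.
  apply: (evaluate_removal (@edgeK L') f_inj codom_f passed (pass_kept (@edgeK L') codom_f (@one_strand L') d0) d0).
    move=> x; rewrite /untie (_ : f x \in removed = false) //.
    by apply: negbTE; rewrite -codom_f; apply/codomP; exists x.
  by move=> x; rewrite /untie => ->.
have nx (x : crossing L) : False by have := nd (x, ord0).
exists None => [_|W M cM /=].
  by apply: eq_card0 => x; case: (nx x).
rewrite (_ : untie (W := W) removed = fun=> virtual (W := W)).
  exact: evaluate_virtual (@edgeK L') (@edge_neq L') _ _ (@one_strand L' r).
apply: functional_extensionality => x; rewrite /untie.
by have := codom_f x; case: (x \in removed) => //= /codomP[y]; case: (nx y).
Qed.

(** A kink of the type that occurs in words is added to L; one of the other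
    type is cancelled by a kink added to L'. *)
Lemma kink_related (L L' : diagram) (od : based L) (od' : based L') b : valid od -> valid od' ->
  (forall W (M : lab W -> lab W -> algC), central M ->
    invariant od' M = invariant od (mmul M (kink b))) -> related L L'.
Proof.
move=> vd vd'; case: b => E; last first.
  exists od, od', [:: false], [::]; split=> // W M cM.
  by rewrite /= !mulm1 E.
exists od, od', [::], [:: true]; split=> // W M cM.
rewrite /= !mulm1 E; last by apply: central_mul => //; apply: central_dag; apply: kink_central.
by rewrite -mmulA (kink_inv W true) mulm1.
Qed.

Lemma reidemeister1_related L L' : reidemeister1 L L' -> related L L'.
Proof.
case=> p [/andP[_ /andP[/eqP loop _]] rem].
have [od vd E] := removal_invariant (opp p) rem.
apply: (@kink_related L L' od (Some (opp p)) (odd p.2)) => // W M cM /=.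
rewrite (untie_kink (@edgeK L') (@edge_neq L') _ loop) E //.
by apply: central_mul => //; apply: kink_central.
Qed.

Lemma reidemeister2_related L L' : reidemeister2 L L' -> related L L'.
Proof.
case=> p [q [/andP[/= un /and3P[/eqP ep /eqP eq' _]] bits rem]].
have pq : p.1 != q.1 by move: un; rewrite inE andbT.
have [od vd E] := removal_invariant (opp p) rem.
exists od, (Some (opp p)), [::], [::]; split=> // W M cM; rewrite /= !mulm1.
by rewrite (untie_bigon (@edgeK L') (@edge_neq L') _ pq ep eq' bits) E.
Qed.

Lemma reidemeister3_related L L' : reidemeister3 L L' -> related L L'.
Proof.
case=> f [p [q [r]]] /= [f_bij /andP[/= un]].
case/and4P=> /eqP ep /eqP eq' /eqP er _ bits Fs _.
have [pq qr rp] : [/\ p.1 != q.1, q.1 != r.1 & r.1 != p.1].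
  by move: un; rewrite !inE negb_or andbT => /andP[/andP[-> pr] ->]; rewrite eq_sym.
set s := (_ * _)%g in Fs.
have sK := triangle_swapK pq qr rp; rewrite -/s in sK.
pose F (d : dart (crossing L)) := (f d.1, d.2) : dart (crossing L').
have [f' fK f'K] := f_bij.
exists (Some (opp p)), (Some (F (s (opp p)))), [::], [::]; split=> // W M cM; rewrite /= !mulm1.
rewrite /evaluate (weight_triangle _ (@edgeK L) (@edge_neq L) pq qr rp ep eq' er bits).
symmetry; apply: (insert_transport (phi := F \o s)).
- exists (fun d => s (f' d.1, d.2)) => d /=; first by rewrite fK -surjective_pairing sK.
  by rewrite sK /F /= f'K -surjective_pairing.
- by move=> d /=; rewrite /F Fs sK.
move=> g; rewrite /weight (reindex f) /=; last by exists f' => x _.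
by apply: eq_bigr => x _; rewrite /vertex /= !ffunE /= !sK.
Qed.

Lemma isotopic_related L L' : planar_isotopic L L' -> related L L'.
Proof.
case=> f [half] /= [f_bij Fe _]; have [f' fK f'K] := f_bij.
pose F (d : dart (crossing L)) : dart (crossing L') :=
  let d' := (f d.1, d.2) in if half d.1 then opp d' else d'.
have [od vd] : exists od : based L, valid od by exists [pick d]; apply: valid_pick.
exists od, (omap F od), [::], [::]; split=> //.
  case: od vd => // vd _; rewrite -(vd erefl); apply/esym; exact: bij_eq_card f_bij.
move=> W M cM; rewrite !mulm1; case: od {vd} => [d|] //=.
symmetry; apply: (insert_transport (phi := F)).
- pose F' (d : dart (crossing L')) : dart (crossing L) :=
    let d' := (f' d.1, d.2) in if half d'.1 then opp d' else d'.
  exists F' => -[x i]; rewrite /F /F' /=.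
    by case hx: (half x); rewrite /= fK hx //; exact: (oppK (x, i)).
  case hx: (half (f' x)); rewrite /= hx ?f'K //.
  exact: (oppK (x, i)).
- by move=> d0; rewrite /F Fe.
move=> g; rewrite /weight (reindex f) /=; last by exists f' => x _.
apply: eq_bigr => x _.
rewrite -(vertex_rot _ (d := (f x, ord0)) (d' := F (x, ord0)) (@wt_rotative W)); last first.
  by rewrite /F /=; case: ifP.
have odd_opp (d0 : dart (crossing L')) : odd (opp d0).2 = odd d0.2 by rewrite !odd_cw negbK.
have Fcw d0 : F (cw d0) = cw (F d0) by rewrite /F; case: (half _).
have Fopp d0 : F (opp d0) = opp (F d0) by rewrite /opp !Fcw.
have Fccw d0 : F (ccw d0) = ccw (F d0) by rewrite -!cw3 Fcw Fopp.
have -> : vertex (wt (m := W)) [ffun d0 => g (F d0)] (x, ord0) =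
    wt (m := W) (odd (x, ord0 : 'I_4).2) (g (F (x, ord0))) (g (F (cw (x, ord0))))
      (g (F (opp (x, ord0)))) (g (F (ccw (x, ord0)))) by rewrite /vertex !ffunE.
rewrite Fcw Fopp Fccw /vertex; congr (wt (m := W) _ _ _ _ _).
by rewrite /F; case: (half _); rewrite ?odd_opp.
Qed.

Theorem same_knot_related L L' : same_knot L L' -> related L L'.
Proof.
elim=> {L L'} [L L' [/isotopic_related|/reidemeister1_related|/reidemeister2_related|/reidemeister3_related] //|L|L L' _|L L' L'' _ + _].
- exact: related_refl.
- exact: related_sym.
- exact: related_trans.
Qed.

(** * Shadows, and adding kinks to them *)

(** All of a diagram that state sums see. Cables of knots, which can have
    several strands, are shadows as well. *)
Record shadow : Type := Shadow {
  node : finType;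
  join : dart node -> dart node;
  joinK : involutive join;
  join_neq : forall d, join d != d
}.

Definition shadow_sum (P : shadow) (W : model) : algC :=
  state_sum (W := W) (@join P) (weight (fun=> wt (m := W))).

Lemma evaluate_one (P : shadow) (W : model) d :
  evaluate (@join P) (fun=> wt (m := W)) d (@mone W) = shadow_sum P W.
Proof.
apply: eq_bigr => g _; rewrite /insert /mone sum_delta_l; congr (weight _ _).
by apply/ffunP=> d'; rewrite ffunE; case: eqP => [->|].
Qed.

Section AddKink.
Variables (P : shadow) (b t : bool) (d : dart (node P)).
Local Notation X := (node P).
Local Notation e := (@join P).

Definition lift_dart (a : dart X) : dart (option X) := (Some a.1, a.2).
(** Its parity b makes the kink one of type b. *)
Definition kink_dart : dart (option X) := (None, if b then ordS ord0 else ord0).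
Local Notation loop := kink_dart.
Local Notation lift := lift_dart.
(** The arc from d is led to this branch of the kink. The bit t decides on
    which of the two sides of the arc the loop lies. *)
Definition kink_in := if t then opp loop else ccw loop.
Definition kink_out := if t then ccw loop else opp loop.

Definition kink_join (a : dart (option X)) : dart (option X) :=
  if a.1 is Some x then
    if (x, a.2) == d then kink_in else if (x, a.2) == e d then kink_out else lift (e (x, a.2))
  else if a == loop then cw loop else if a == cw loop then loop
  else if a == kink_in then lift d else lift (e d).

Lemma kink_join_loop : kink_join loop = cw loop.
Proof. by rewrite /kink_join /= eqxx. Qed.

Lemma kink_join_cw : kink_join (cw loop) = loop.
Proof. by rewrite /kink_join /= corner_neq eqxx. Qed.

Lemma kink_in_neq : ((kink_in == loop) = false) * ((kink_in == cw loop) = false).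
Proof. by rewrite /kink_in; case: t; rewrite !corner_neq. Qed.

Lemma kink_out_neq : ((kink_out == loop) = false) * ((kink_out == cw loop) = false)
  * ((kink_out == kink_in) = false).
Proof. by rewrite /kink_in /kink_out; case: t; rewrite !corner_neq. Qed.

Lemma kink_join_in : kink_join kink_in = lift d.
Proof.
by rewrite /kink_join !kink_in_neq eqxx /kink_in; case: t.
Qed.

Lemma kink_join_out : kink_join kink_out = lift (e d).
Proof. by rewrite /kink_join !kink_out_neq /kink_out; case: t. Qed.

Lemma kink_join_d : kink_join (lift d) = kink_in.
Proof. by rewrite /kink_join /= -surjective_pairing eqxx. Qed.

Lemma kink_join_ed : kink_join (lift (e d)) = kink_out.
Proof. by rewrite /kink_join /= -surjective_pairing (negPf (join_neq d)) eqxx. Qed.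

Lemma kink_join_lift a : a != d -> a != e d -> kink_join (lift a) = lift (e a).
Proof. by move=> /negPf ad /negPf aed; rewrite /kink_join /= -surjective_pairing ad aed. Qed.

Variant kink_dart_spec : dart (option X) -> Type :=
| KinkLoop : kink_dart_spec loop
| KinkCw : kink_dart_spec (cw loop)
| KinkIn : kink_dart_spec kink_in
| KinkOut : kink_dart_spec kink_out
| KinkD : kink_dart_spec (lift d)
| KinkED : kink_dart_spec (lift (e d))
| KinkLift a of a != d & a != e d : kink_dart_spec (lift a).

Lemma kink_dartP a : kink_dart_spec a.
Proof.
case: a => [[x|] i].
  rewrite -[(Some x, i)]/(lift (x, i)).
  have [->|ad] := eqVneq (x, i) d; first exact: KinkD.
  have [->|aed] := eqVneq (x, i) (e d); first exact: KinkED.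
  exact: KinkLift.
have [->|n1] := eqVneq (None, i) loop; first exact: KinkLoop.
have [->|n2] := eqVneq (None, i) (cw loop); first exact: KinkCw.
have [->|n3] := eqVneq (None, i) kink_in; first exact: KinkIn.
suff -> : (None, i) = kink_out by exact: KinkOut.
have /dart_cases : (@None X, i).1 = loop.1 by [].
by move: n1 n2 n3; rewrite /kink_in /kink_out; case: t => n1 n2 n3 [] E;
  rewrite E ?eqxx in n1 n2 n3 *.
Qed.

Lemma kink_joinK : involutive kink_join.
Proof.
move=> a; case: (kink_dartP a) => [||||||{}a ad aed].
- by rewrite kink_join_loop kink_join_cw.
- by rewrite kink_join_cw kink_join_loop.
- by rewrite kink_join_in kink_join_d.
- by rewrite kink_join_out kink_join_ed.
- by rewrite kink_join_d kink_join_in.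
- by rewrite kink_join_ed kink_join_out.
rewrite kink_join_lift // kink_join_lift ?joinK //.
  by apply: contra aed => /eqP <-; rewrite joinK.
by apply: contra ad => /eqP/(can_inj (@joinK P)) ->.
Qed.

Lemma kink_join_neq a : kink_join a != a.
Proof.
case: (kink_dartP a) => [||||||{}a ad aed].
- by rewrite kink_join_loop corner_neq.
- by rewrite kink_join_cw corner_neq.
- by rewrite kink_join_in /kink_in; case: t.
- by rewrite kink_join_out /kink_out; case: t.
- by rewrite kink_join_d /kink_in; case: t.
- by rewrite kink_join_ed /kink_out; case: t.
rewrite kink_join_lift //; apply: contra (join_neq a) => /eqP[E1 E2].
by rewrite [e a]surjective_pairing E1 E2 -surjective_pairing.
Qed.

Definition add_kink := Shadow kink_joinK kink_join_neq.

(** Untying the kink produces its matrix next to M; the bit t decides in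
    which direction the kink is traversed. *)
Lemma evaluate_kink (W : model) (M : lab W -> lab W -> algC) : central M ->
  evaluate (@join add_kink) (fun=> wt (m := W)) (lift d) M
    = evaluate e (fun=> wt (m := W)) d (mmul (letter b t) M).
Proof.
move=> cM.
pose removed : seq (option X) := [:: None].
have codomS (x : option X) : (x \in codom (@Some X)) = (x \notin removed).
  rewrite inE; case: x => [x|]; first by apply/codomP; exists x.
  by apply/negbTE/codomP => -[].
pose pass := [rel a a' : dart (option X) | (a.1 \in removed) && (a' == kink_join (opp a))].
have pass_loop a : a.1 = None -> connect pass a (kink_join (opp a)).
  by move=> a0; apply: connect1; rewrite /= a0 inE !eqxx.
have through_in : connect pass kink_in (lift (e d)).
  apply: connect_trans (pass_loop _ _) _; first by rewrite /kink_in; case: t.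
  rewrite -kink_join_out /kink_in /kink_out; case: t.
    by rewrite oppK kink_join_loop -opp_cw; apply: pass_loop.
  by rewrite opp_ccw kink_join_cw; apply: pass_loop.
have through_out : connect pass kink_out (lift d).
  apply: connect_trans (pass_loop _ _) _; first by rewrite /kink_out; case: t.
  rewrite -kink_join_in /kink_in /kink_out; case: t.
    by rewrite opp_ccw kink_join_cw; apply: pass_loop.
  by rewrite oppK kink_join_loop -opp_cw; apply: pass_loop.
have passed a : connect pass (kink_join (lift a)) (lift (e a)).
  have [->|ad] := eqVneq a d; first by rewrite kink_join_d.
  have [->|aed] := eqVneq a (e d); first by rewrite kink_join_ed joinK.
  by rewrite kink_join_lift.
have legs : (opp loop = kink_out /\ ccw loop = kink_in) \/ (opp loop = kink_in /\ ccw loop = kink_out).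
  by rewrite /kink_in /kink_out; case: t; [right | left].
have reached r : exists a, connect pass r (lift a).
  have leg c : c = kink_out \/ c = kink_in -> exists a, kink_join c = lift a.
    by case=> ->; [exists (e d); rewrite kink_join_out | exists d; rewrite kink_join_in].
  case: (kink_dartP r) => [||||||a _ _]; first last.
  - by exists a.
  - by exists (e d).
  - by exists d.
  - by exists d; apply: through_out.
  - by exists (e d); apply: through_in.
  - have [|a aE] := leg (ccw loop); first by case: legs => -[_ ->]; [right|left].
    by exists a; rewrite -aE -opp_cw; apply: pass_loop.
  - have [|a aE] := leg (opp loop); first by case: legs => -[-> _]; [left|right].
    by exists a; rewrite -aE; apply: pass_loop.
have bE : odd loop.2 = b by rewrite /loop; case: b.
have kept a N : evaluate kink_join (untie (W := W) removed) (lift a) N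
    = evaluate e (fun=> wt (m := W)) a N.
  apply: (evaluate_removal kink_joinK (f := @Some X) _ codomS passed reached d) => //.
  - by move=> x y [].
  - by move=> x; rewrite /untie => ->.
rewrite /add_kink /=.
have untied N : evaluate kink_join (fun=> wt (m := W)) (opp loop) N =
   evaluate kink_join (untie (W := W) removed) (opp loop) (mmul N (kink b)).
  by rewrite (untie_kink kink_joinK kink_join_neq _ kink_join_cw) bE.
have edgeE V a N : evaluate kink_join V a N = evaluate kink_join V (kink_join a) (dag N).
  exact: (evaluate_edge kink_joinK kink_join_neq).
have nextE a : evaluate kink_join (fun=> wt (m := W)) a M =
    evaluate kink_join (fun=> wt (m := W)) (opp (kink_join a)) M.
  by apply: (evaluate_next kink_joinK kink_join_neq) => // x; apply: wt_rotative.
have Et : t = true -> kink_in = opp loop by rewrite /kink_in => ->.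
have Ef : t = false -> kink_out = opp loop /\ kink_in = ccw loop.
  by rewrite /kink_in /kink_out => ->.
have [tE|tE] : t = true \/ t = false by case: t; [left|right].
  have inE := Et tE; rewrite edgeE kink_join_d inE untied edgeE -inE kink_join_in kept.
  by rewrite dag_mul dagK tE.
have [outE inE] := Ef tE; rewrite nextE kink_join_d inE opp_ccw nextE kink_join_cw untied.
rewrite edgeE -outE kink_join_out kept tE /letter -kink_comm //.
by rewrite [RHS](evaluate_edge (@joinK P) (@join_neq P)).
Qed.
End AddKink.

(** * Doubling a shadow *)

Lemma prod_ord4 (F : 'I_4 -> algC) :
  \prod_i F i = F ord0 * F (ordS ord0) * F (ordS (ordS ord0)) * F (ord_pred ord0).
Proof.
rewrite !big_ord_recl big_ord0 mulr1 !mulrA.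
by congr (F _ * F _ * F _ * F _); apply/val_inj.
Qed.

Lemma sum_ffun4 (T : finType) (F : T -> T -> T -> T -> algC) :
  \sum_(h : {ffun 'I_4 -> T}) F (h ord0) (h (ordS ord0)) (h (ordS (ordS ord0))) (h (ord_pred ord0))
    = \sum_m0 \sum_m1 \sum_m2 \sum_m3 F m0 m1 m2 m3.
Proof.
transitivity (\sum_(u : T * (T * (T * T))) F u.1 u.2.1 u.2.2.1 u.2.2.2); last first.
  by rewrite sum_pair; apply: eq_bigr => m0 _; rewrite sum_pair; apply: eq_bigr => m1 _;
    rewrite sum_pair.
pose mk (u : T * (T * (T * T))) : {ffun 'I_4 -> T} :=
  [ffun i : 'I_4 => nth u.1 [:: u.1; u.2.1; u.2.2.1; u.2.2.2] i].
rewrite (reindex mk) /=; first by apply: eq_bigr => u _; rewrite !ffunE.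
exists (fun h : {ffun 'I_4 -> T} =>
  (h ord0, (h (ordS ord0), (h (ordS (ordS ord0)), h (ord_pred ord0))))) => [[m0 [m1 [m2 m3]]]|h] _.
  by rewrite !ffunE.
apply/ffunP=> i; rewrite ffunE; case: i => [[|[|[|[|]]]]] // ilt /=; congr (h _); exact/val_inj.
Qed.

Section Double.
Variable P : shadow.
Local Notation X := (node P).
Local Notation e := (@join P).
Implicit Type d : dart X.

(** The crossings of the doubled shadow are indexed by the darts of P: the
    crossing d of a grid lies in the angle from d to cw d, where the
    clockwise copy of d meets the counterclockwise copy of cw d. Its
    branches have the same numbers as those of P to which they are parallel,
    so that over and under are kept; the corner of d is the branch of the
    crossing d that is parallel to d. *)
Definition corner d : dart (dart X) := (d, d.2).

(** The first two cases are the arcs parallel to those of P, where the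
    clockwise copy at one end is the counterclockwise copy at the other; the
    others are the sides of the grids. *)
Definition double_join (c : dart (dart X)) : dart (dart X) :=
  let d := c.1 in
  if c == corner d then cw (corner (ccw (e d)))
  else if c == cw (corner d) then corner (e (cw d))
  else if c == opp (corner d) then ccw (corner (cw d))
  else opp (corner (ccw d)).

Lemma double_join0 d : double_join (corner d) = cw (corner (ccw (e d))).
Proof. by rewrite /double_join /= eqxx. Qed.

Lemma double_join1 d : double_join (cw (corner d)) = corner (e (cw d)).
Proof. by rewrite /double_join /= !corner_neq eqxx. Qed.

Lemma double_join2 d : double_join (opp (corner d)) = ccw (corner (cw d)).
Proof. by rewrite /double_join /= !corner_neq eqxx. Qed.

Lemma double_join3 d : double_join (ccw (corner d)) = opp (corner (ccw d)).
Proof. by rewrite /double_join /= !corner_neq. Qed.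

Variant double_dart_spec : dart (dart X) -> Type :=
| Double0 d : double_dart_spec (corner d)
| Double1 d : double_dart_spec (cw (corner d))
| Double2 d : double_dart_spec (opp (corner d))
| Double3 d : double_dart_spec (ccw (corner d)).

Lemma double_dartP c : double_dart_spec c.
Proof.
have [->|n1] := eqVneq c (corner c.1); first exact: Double0.
have [->|n2] := eqVneq c (cw (corner c.1)); first exact: Double1.
have [->|n3] := eqVneq c (opp (corner c.1)); first exact: Double2.
suff -> : c = ccw (corner c.1) by exact: Double3.
have /dart_cases[] : c.1 = (corner c.1).1 by [].
all: move=> E; rewrite -?E ?eqxx // in n1 n2 n3 *.
Qed.

Lemma double_joinK : involutive double_join.
Proof.
move=> c; case: (double_dartP c) => d.
- by rewrite double_join0 double_join1 ccwK joinK.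
- by rewrite double_join1 double_join0 joinK cwK.
- by rewrite double_join2 double_join3 cwK.
- by rewrite double_join3 double_join2 ccwK.
Qed.

Lemma double_join_neq c : double_join c != c.
Proof.
case: (double_dartP c) => d.
- rewrite double_join0; apply/eqP=> E; case/eqP: (ccw_neq (e d)).
  have Ed : ccw (e d) = d := congr1 fst E.
  have E2 : (e d).2 = d.2 by have := congr1 snd E; rewrite /= ord_predK.
  have E1 : (e d).1 = d.1 := congr1 fst Ed.
  by rewrite Ed [RHS]surjective_pairing E1 E2 -surjective_pairing.
- rewrite double_join1; apply/eqP=> E; case/eqP: (cw_neq d).
  by have /= Ed := congr1 fst E; have /(congr1 snd) /= := E; rewrite Ed /cw => <-; rewrite -surjective_pairing.
- by rewrite double_join2; apply/eqP=> /(congr1 fst)/eqP; rewrite /= (negPf (cw_neq d)).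
- by rewrite double_join3; apply/eqP=> /(congr1 fst)/eqP; rewrite /= (negPf (ccw_neq d)).
Qed.

Definition double_shadow := Shadow double_joinK double_join_neq.

Section Total.
Variable W : model.
Local Notation T := (lab W).
Local Notation bar := (@bar W).
Local Notation w := (wt (m := W)).

(** The labels of the arcs parallel to those of P come in pairs, and the
    labels of the sides of the grids are free. *)
Definition glue_labels (u : {ffun dart X -> T * T} * {ffun dart X -> T}) : {ffun dart (dart X) -> T} :=
  [ffun c => let d := c.1 in
     if c == corner d then (u.1 d).2
     else if c == cw (corner d) then (u.1 (cw d)).1
     else if c == opp (corner d) then u.2 d else bar (u.2 (ccw d))].

Lemma glue_labelsE u d :
  ((glue_labels u (corner d) = (u.1 d).2) * (glue_labels u (cw (corner d)) = (u.1 (cw d)).1) *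
   (glue_labels u (opp (corner d)) = u.2 d) * (glue_labels u (ccw (corner d)) = bar (u.2 (ccw d))))%type.
Proof. by rewrite !ffunE /= !(corner_neq, eqxx). Qed.

Definition cut_labels (g : {ffun dart (dart X) -> T}) :
    {ffun dart X -> T * T} * {ffun dart X -> T} :=
  ([ffun d => (g (cw (corner (ccw d))), g (corner d))], [ffun d => g (opp (corner d))]).

Lemma cut_glue u : cut_labels (glue_labels u) = u.
Proof.
case: u => G m; congr (_, _); apply/ffunP=> d; rewrite ffunE !glue_labelsE //.
by rewrite ccwK -surjective_pairing.
Qed.

Lemma glue_cut g : compatible double_join g -> glue_labels (cut_labels g) = g.
Proof.
move=> /forallP cg; apply/ffunP=> c; case: (double_dartP c) => d; rewrite glue_labelsE !ffunE //.
  by rewrite cwK.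
by have := cg (opp (corner (ccw d))); rewrite double_join2 ccwK => /eqP ->.
Qed.

Lemma glue_compatible u :
  compatible double_join (glue_labels u) = compatible (W := double_model W) e u.1.
Proof.
apply/forallP/forallP => cu.
  move=> d; apply/eqP; have := cu (corner d); have := cu (cw (corner (ccw d))).
  rewrite double_join1 double_join0 !glue_labelsE !ccwK => /eqP E2 /eqP E1.
  by rewrite /= /swap_bar -E2 -E1 -surjective_pairing.
move=> c; case: (double_dartP c) => d.
- by rewrite double_join0 !glue_labelsE ccwK (eqP (cu d)).
- by rewrite double_join1 !glue_labelsE (eqP (cu (cw d))).
- by rewrite double_join2 !glue_labelsE cwK.
- by rewrite double_join3 !glue_labelsE barK.
Qed.

Lemma ccw_ccw (Y : finType) (d : dart Y) : ccw (ccw d) = opp d.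
Proof. by rewrite -(opp_cw d) ccw_opp. Qed.

(** Summing over the labels of the sides of all grids gives the weights of
    the doubled model. *)
Lemma shadow_sum_double : shadow_sum double_shadow W = shadow_sum P (double_model W).
Proof.
rewrite /shadow_sum /state_sum (reindex_onto glue_labels cut_labels) /=; last exact: glue_cut.
under eq_bigl => u do rewrite cut_glue eqxx andbT glue_compatible.
rewrite (eq_bigl (fun u => compatible (W := double_model W) e u.1 && true)); last first.
  by move=> u; rewrite andbT.
rewrite -(pair_big (compatible (W := double_model W) e) xpredT
  (fun G m => weight (fun=> w) (glue_labels (G, m)))) /=.
apply: eq_bigr => G _.
pose K x (h : {ffun 'I_4 -> T}) : algC :=
  w false (G (x, ord0)).2 (G (cw (x, ord0))).1 (h ord0) (bar (h (ord_pred ord0))) *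
  w false (bar (h ord0)) (G (cw (x, ord0))).2 (G (opp (x, ord0))).1 (h (ordS ord0)) *
  w false (h (ordS (ordS ord0))) (bar (h (ordS ord0))) (G (opp (x, ord0))).2 (G (ccw (x, ord0))).1 *
  w false (G (x, ord0)).1 (h (ord_pred ord0)) (bar (h (ordS (ordS ord0)))) (G (ccw (x, ord0))).2.
transitivity (\sum_(m : {ffun dart X -> T}) \prod_x K x [ffun i => m (x, i)]).
  apply: eq_bigr => m _.
  transitivity (\prod_(x : X) \prod_(i < 4) vertex w (glue_labels (G, m)) ((x, i), ord0)).
    by rewrite pair_bigA /=; apply: eq_bigr => -[x i].
  apply: eq_bigr => x _; rewrite prod_ord4 /K !ffunE; set d := (x, ord0).
  rewrite -[(x, ordS ord0)]/(cw d) -[(x, ordS (ordS ord0))]/(opp d) -[(x, ord_pred ord0)]/(ccw d).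
  have c1 : (cw d, ord0) = ccw (corner (cw d)) by congr (_, _); apply/val_inj.
  have c2 : (opp d, ord0) = opp (corner (opp d)) by congr (_, _); apply/val_inj.
  have c3 : (ccw d, ord0) = cw (corner (ccw d)) by congr (_, _); apply/val_inj.
  congr (_ * _ * _ * _).
  - by rewrite -[(d, ord0)]/(corner d) /vertex !glue_labelsE.
  - by rewrite c1 /vertex ccwK opp_ccw ccw_ccw !glue_labelsE cwK -[cw (cw d)]/(opp d).
  - by rewrite c2 /vertex cw3 oppK ccw_opp !glue_labelsE cw3 ccw_opp -c2.
  - by rewrite c3 /vertex cwK opp_cw -[cw (cw _)]/(opp _) !glue_labelsE ccwK ccw_ccw -c3.
transitivity (\prod_x \sum_h K x h); last first.
  apply: eq_bigr => x _; rewrite /K; set d := (x, ord0).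
  exact: (sum_ffun4 (fun m0 m1 m2 m3 =>
    w false (G d).2 (G (cw d)).1 m0 (bar m3) * w false (bar m0) (G (cw d)).2 (G (opp d)).1 m1 *
    w false m2 (bar m1) (G (opp d)).2 (G (ccw d)).1 * w false (G d).1 m3 (bar m2) (G (ccw d)).2)).
rewrite bigA_distr_bigA /=.
pose curry (m : {ffun dart X -> T}) : {ffun X -> {ffun 'I_4 -> T}} := [ffun x => [ffun i => m (x, i)]].
rewrite [RHS](reindex curry) /=.
  by apply: eq_bigr => m _; apply: eq_bigr => x _; rewrite ffunE.
exists (fun H : {ffun X -> {ffun 'I_4 -> T}} => [ffun d => H d.1 d.2]) => [m|H] _.
  by apply/ffunP=> d; rewrite !ffunE -surjective_pairing.
by apply/ffunP=> x; apply/ffunP=> i; rewrite !ffunE.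
Qed.
End Total.
End Double.

(** * States, their loops, and labelings constant along the loops *)

Section Turn.
Variable X : finType.
Implicit Type d : dart X.

Lemma odd_ccw d : odd (ccw d).2 = ~~ odd d.2.
Proof. by rewrite -[in RHS](ccwK d) odd_cw negbK. Qed.

Lemma turnK c : involutive (@turn X c).
Proof.
move=> d; rewrite /turn; case dc: (odd d.2 == c).
  by rewrite odd_ccw (_ : ~~ odd d.2 == c = false) ?ccwK //; move: dc; case: odd; case: c.
by rewrite odd_cw (_ : ~~ odd d.2 == c) ?cwK //; move: dc; case: odd; case: c.
Qed.

Lemma turn_neq c d : turn c d != d.
Proof. by rewrite /turn; case: ifP; rewrite ?cw_neq ?ccw_neq. Qed.

Lemma turn1 c d : (turn c d).1 = d.1.
Proof. by rewrite /turn; case: ifP. Qed.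
End Turn.

Section ConstantLabelings.
Variables (D K : finType) (r : rel D).
Hypothesis r_sym : symmetric r.

Definition constant_along := [set g : {ffun D -> K} | [forall x, forall y, r x y ==> (g y == g x)]].

Lemma constant_connect g x y : g \in constant_along -> connect r x y -> g x = g y.
Proof.
rewrite inE => /forallP gP /connectP[p]; elim: p x => [|z p IHp] x /=; first by move=> _ ->.
by case/andP=> xz zp lp; have /forallP/(_ z)/implyP/(_ xz)/eqP <- := gP x; apply: IHp.
Qed.

(** Constant labelings are free on the components of the graph r. *)
Lemma card_constant_along : #|constant_along| = (#|K| ^ n_comp r predT)%N.
Proof.
have csym : connect_sym r by apply: sym_connect_sym.
pose S := {x | roots r x}.
have rootS x : roots r (fingraph.root r x) by apply: roots_root.
pose ext (h : {ffun S -> K}) : {ffun D -> K} := [ffun x => h (Sub (fingraph.root r x) (rootS x))].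
have ext_inj : injective ext.
  move=> h h' /ffunP E; apply/ffunP=> -[x rx]; have := E x; rewrite !ffunE.
  by congr (h _ = h' _); apply: val_inj; apply/eqP.
have -> : constant_along = [set ext h | h in {ffun S -> K}].
  apply/setP=> g; apply/idP/imsetP => [gc|[h _ ->]]; last first.
    rewrite inE; apply/forallP=> x; apply/forallP=> y; apply/implyP=> xy; rewrite !ffunE.
    apply/eqP; congr (h _); apply: val_inj; apply/esym/eqP.
    by rewrite /= (root_connect csym) connect1.
  exists [ffun s => g (val s)] => //; apply/ffunP=> x; rewrite !ffunE /=.
  by apply: constant_connect => //; apply: connect_root.
rewrite card_imset // card_ffun card_sig; congr (_ ^ _)%N.
by apply: eq_card => x; rewrite !inE andbT.
Qed.
End ConstantLabelings.

Section States.
Variable P : shadow.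
Local Notation X := (node P).
Local Notation e := (@join P).
Local Notation state := {ffun X -> bool}.
Implicit Type s : state.

(** At the crossing x, the state s prescribes the smoothing along the angles
    of colour s x: dart and turned dart belong to the same loop. For a
    constant state, the loops are the boundaries of the cells of the atom. *)
Definition arc s : rel (dart X) := [rel d d' | (d' == e d) || (d' == turn (s d.1) d)].

Lemma arc_sym s : symmetric (arc s).
Proof.
have imp d d' : arc s d d' -> arc s d' d.
  case/orP=> /eqP ->; first by rewrite /arc /= joinK eqxx.
  by apply/orP; right; rewrite turn1 turnK.
by move=> d d'; apply/idP/idP; apply: imp.
Qed.

End States.

(** Locked to keep the search for components from being unfolded; it only
    enters through numbers of labelings. *)
HB.lock Definition loops (P : shadow) (s : {ffun node P -> bool}) := n_comp (arc s) predT.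

Section StateSums.
Variable P : shadow.
Local Notation X := (node P).
Local Notation e := (@join P).
Local Notation state := {ffun X -> bool}.
Implicit Type s : state.

Lemma constant_arcP s (K : finType) (g : {ffun dart X -> K}) :
  reflect (forall d, g (e d) = g d /\ g (turn (s d.1) d) = g d) (g \in constant_along K (arc s)).
Proof.
rewrite inE; apply: (iffP forallP) => [gP d|gP d].
  have E d' : arc s d d' -> g d' = g d.
    by move=> dd'; have /forallP/(_ d')/implyP/(_ dd')/eqP := gP d.
  by split; apply: E; apply/orP; [left | right].
by apply/forallP=> d'; apply/implyP=> /orP[]/eqP ->; rewrite ?(gP d).1 ?(gP d).2.
Qed.

Lemma card_bool_arc s : #|constant_along bool (arc s)| = (2 ^ loops s)%N.
Proof. by rewrite (card_constant_along _ (arc_sym s)) card_bool loops.unlock. Qed.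

(** Each of the two summands of the bracket asks for equal labels along one
    smoothing. *)
Lemma vertex_bracket N A (AN : A ^+ 2 + A ^- 2 = - N.+1%:R) (g : {ffun dart X -> 'I_N.+1}) x :
  vertex (wt (m := bracket_model AN)) g (x, ord0) =
  \sum_(c : bool) (if c then A else A^-1) * ([forall i, g (turn c (x, i)) == g (x, i)])%:R.
Proof.
set d := (x, ord0); rewrite big_bool /vertex /= /bracket_wt /=.
have all4 c : [forall i, g (turn c (x, i)) == g (x, i)] =
  if c then (g d == g (cw d)) && (g (opp d) == g (ccw d)) else (g (cw d) == g (opp d)) && (g (ccw d) == g d).
  apply/forallP/idP => [H|H i].
    have Hd d' : d'.1 = x -> g (turn c d') == g d'.
      by case: d' => y i /= ->; apply: H.
    have := Hd d erefl; have := Hd (opp d) erefl; have := Hd (cw d) erefl; have := Hd (ccw d) erefl.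
    rewrite /turn !odd_ccw !odd_cw /=; case: c {H Hd} => /=; rewrite ?opp_cw ?ccw_opp ?cw3 ?cwK ?ccwK.
      by rewrite ccw_ccw => *; apply/andP.
    by rewrite -[cw (cw d)]/(opp d) => *; apply/andP.
  have [E|E|E|E] := @dart_cases X d (x, i) erefl; rewrite E /turn ?odd_ccw ?odd_cw /=;
    move: H; case: c => /andP[/eqP H1 /eqP H2] /=;
    by rewrite ?opp_cw ?ccw_opp ?cw3 ?cwK ?ccwK ?ccw_ccw -?[cw (cw d)]/(opp d) ?H1 ?H2.
by rewrite !all4.
Qed.

(** Kauffman's expansion: choosing a summand at each crossing amounts to
    choosing a state, and the labelings along which the chosen labels agree
    are those constant on its loops. *)
Lemma shadow_sum_bracket N A (AN : A ^+ 2 + A ^- 2 = - N.+1%:R) :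
  shadow_sum P (bracket_model AN) =
  \sum_(s : {ffun X -> bool}) (\prod_x (if s x then A else A^-1)) * (N.+1 ^ loops s)%:R.
Proof.
rewrite /shadow_sum /state_sum.
under eq_bigr => g _ do (rewrite /weight; under eq_bigr => x _ do rewrite vertex_bracket).
under eq_bigr => g _ do rewrite bigA_distr_bigA.
rewrite exchange_big; apply: eq_bigr => s _ /=.
under eq_bigr => g _ do rewrite big_split /=.
rewrite -mulr_sumr; congr (_ * _).
have := card_constant_along 'I_N.+1 (arc_sym s); rewrite card_ord loops.unlock => <-.
rewrite -sum1_card natr_sum big_mkcond [RHS]big_mkcond; apply: eq_bigr => g _ /=.
rewrite prod_indicator (_ : g \in _ = compatible (W := bracket_model AN) e g &&
  [forall x, true ==> [forall i, g (turn (s x) (x, i)) == g (x, i)]]); last first.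
  apply/constant_arcP/andP => [gP|[/forallP cg /forallP sg] d].
    split; first by apply/forallP=> d; apply/eqP; exact: (gP d).1.
    by apply/forallP=> x; apply/forallP=> i; apply/eqP; exact: (gP (x, i)).2.
  split; first exact: (eqP (cg d)).
  by have /forallP/(_ d.2)/eqP := sg d.1; rewrite -surjective_pairing.
by case: (compatible _ _) => //=; case: [forall _, _].
Qed.

(** Labelings in Z/2 that are constant along loops form a group. The
    condition that they agree at two given darts defines a subgroup of index
    at most 2. *)
Definition add_labels (g h : {ffun dart X -> bool}) : {ffun dart X -> bool} := [ffun d => g d (+) h d].

Lemma add_labelsK h : involutive (add_labels^~ h).
Proof. by move=> g; apply/ffunP=> d; rewrite !ffunE addbK. Qed.

Section Halves.
Variables (S : {set {ffun dart X -> bool}}) (d d' : dart X).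
Hypothesis S_add : forall g h, g \in S -> h \in S -> add_labels g h \in S.
Let I := [set g in S | g d == g d'].

Lemma add_labels_half h : h \in S -> h d != h d' -> #|S :\: I| = #|I|.
Proof.
move=> hS hd; rewrite -(card_imset _ (can_inj (add_labelsK h))); apply: eq_card => g.
have dE : (add_labels g h d == add_labels g h d') = (g d != g d').
  by rewrite !ffunE; move: hd; case: (h d); case: (h d'); case: (g d); case: (g d').
have gS : (add_labels g h \in S) = (g \in S).
  apply/idP/idP => [gS|gS]; last exact: S_add.
  by rewrite -[g](add_labelsK h); apply: S_add.
rewrite (can2_imset_pre _ (add_labelsK h) (add_labelsK h)) !inE dE gS.
by case: (g \in S); rewrite ?andbF //= negbK andbT.
Qed.

Lemma card_halves : (#|I| + #|S :\: I|)%N = #|S|.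
Proof.
rewrite -(cardsID I S); congr (_ + _)%N; apply: eq_card => g.
by rewrite !inE; case: (g \in S).
Qed.

Lemma card_half_le : (#|S| <= 2 * #|I|)%N.
Proof.
rewrite -card_halves mul2n -addnn leq_add2l.
have [->|[h]] := set_0Vmem (S :\: I); first by rewrite cards0.
by rewrite !inE => /andP[nI hS]; rewrite (add_labels_half hS) //; move: nI; rewrite hS.
Qed.

Lemma card_half_ge h : h \in S -> h d != h d' -> (2 * #|I| <= #|S|)%N.
Proof. by move=> hS hd; rewrite -card_halves (add_labels_half hS hd) mul2n -addnn. Qed.
End Halves.

Lemma constant_add_labels s g h : g \in constant_along bool (arc s) -> h \in constant_along bool (arc s) ->
  add_labels g h \in constant_along bool (arc s).
Proof.
by move=> /constant_arcP gP /constant_arcP hP; apply/constant_arcP=> d; rewrite !ffunE;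
  split; rewrite ?(gP d).1 ?(hP d).1 ?(gP d).2 ?(hP d).2.
Qed.

(** The two arcs into which s smooths the crossing x lie on different loops.
    Labelings express this in a form that is fit for counting loops. *)
Definition separated s x := exists2 g, g \in constant_along bool (arc s)
  & g (x, ord0) != g (opp (x, ord0)).

(** Labelings with equal labels at all four branches of x are constant along
    either smoothing of x. *)
Lemma merged_sub s s' x : (forall y, y != x -> s y = s' y) ->
  [set g in constant_along bool (arc s) | g (x, ord0) == g (opp (x, ord0))] \subset
  [set g in constant_along bool (arc s') | g (x, ord0) == g (opp (x, ord0))].
Proof.
move=> ss'; apply/subsetP=> g /setIdP[/constant_arcP gP g02].
apply/setIdP; split=> //; apply/constant_arcP=> d.
split; first exact: (gP d).1.
have [dx|/ss' <-] := eqVneq d.1 x; last exact: (gP d).2.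
have four d' : d'.1 = x -> g d' = g (x, ord0).
  set d0 := (x, ord0) in g02 * => d'x; have /eqP/esym E := g02.
  have := (gP d0).2; have := (gP (opp d0)).2; rewrite /= -[opp d0]/(cw (cw d0)) /turn !odd_cw negbK /=.
  have [->|->|->|->] := @dart_cases X d0 d' d'x => //; case: (s x) => /=;
    rewrite -[cw (cw d0)]/(opp d0) ?cw3 ?ccw_opp => E2 E0; rewrite ?E2 ?E0 //.
by rewrite !four ?turn1.
Qed.

(** Resmoothing a crossing changes the number of loops by at most one; it
    does not add a loop where two different ones meet
    (loops_flip_separated), since they are merged. *)
Lemma loops_flip s s' x : (forall y, y != x -> s y = s' y) -> (loops s' <= (loops s).+1)%N.
Proof.
move=> ss'; rewrite -(leq_exp2l _ _ (isT : 1 < 2)%N) (expnS 2 (loops s)) -!card_bool_arc.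
apply: leq_trans (card_half_le (x, ord0) (opp (x, ord0)) (constant_add_labels (s := s'))) _.
have s's y : y != x -> s' y = s y by move=> /ss'.
rewrite leq_mul2l /=; apply: leq_trans (subset_leq_card (merged_sub s's)) _.
by apply: subset_leq_card; apply/subsetP=> g /setIdP[].
Qed.

Lemma loops_flip_separated s s' x : (forall y, y != x -> s y = s' y) -> separated s x ->
  (loops s' <= loops s)%N.
Proof.
move=> ss' [g gs gx]; rewrite -(leq_exp2l _ _ (isT : 1 < 2)%N) -!card_bool_arc.
apply: leq_trans (card_half_le (x, ord0) (opp (x, ord0)) (constant_add_labels (s := s'))) _.
apply: leq_trans (card_half_ge (constant_add_labels (s := s)) gs gx).
rewrite leq_mul2l /=; apply: subset_leq_card; apply: merged_sub.
by move=> y /ss' ->.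
Qed.
End StateSums.

(** * The degree of the bracket *)

Section Degree.
Variables (P : shadow) (c : bool).
Local Notation X := (node P).
Local Notation state := {ffun X -> bool}.
Implicit Type s : state.

Definition uniform : state := [ffun=> c].
Definition flips s := #|[set x | s x != c]|.
(** The half of the adequacy of P that concerns the smoothings of colour c. *)
Definition adequate := forall x, separated uniform x.

Lemma flips_le s : (flips s <= #|X|)%N. Proof. exact: max_card. Qed.

Lemma flips0 s : flips s = 0%N -> s = uniform.
Proof.
move=> /eqP; rewrite cards_eq0 => /eqP s0; apply/ffunP=> x; rewrite ffunE.
by apply/eqP; have := in_set0 x; rewrite -s0 inE => /negbFE.
Qed.

Lemma flips_uniform : flips uniform = 0%N.
Proof. by apply/eqP; rewrite cards_eq0; apply/eqP/setP=> x; rewrite !inE ffunE eqxx. Qed.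

Lemma flip_step s k : flips s = k.+1 -> exists s' x,
  [/\ flips s' = k & forall y, y != x -> s' y = s y].
Proof.
move=> sk; have /card_gt0P[x] : (0 < flips s)%N by rewrite sk.
rewrite inE => sx; exists [ffun y => if y == x then c else s y], x; split; last first.
  by move=> y /negPf yx; rewrite ffunE yx.
apply/eqP; rewrite -eqSS -sk /flips [X in _ == X](cardsD1 x) inE sx add1n eqSS.
apply/eqP; apply: eq_card => y; rewrite !inE ffunE.
by case: (y == x); rewrite ?eqxx.
Qed.

Lemma loops_le s : (loops s <= loops uniform + flips s)%N.
Proof.
move: {2}(flips s) (erefl (flips s)) => k; elim: k s => [|k IHk] s sk.
  by rewrite (flips0 sk) leq_addr.
have [s' [x [s'k s's]]] := flip_step sk; apply: leq_trans (loops_flip s's) _.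
by rewrite sk addnS ltnS -s'k IHk.
Qed.

(** On the way from the uniform state to s, the first flip does not add a
    loop. *)
Lemma loops_lt s : adequate -> (0 < flips s)%N -> (loops s < loops uniform + flips s)%N.
Proof.
move=> adq; case sk: (flips s) => [//|k] _.
elim: k s sk => [|k IHk] s sk; have [s' [x [s'k s's]]] := flip_step sk.
  by rewrite addn1 ltnS; move: s's; rewrite (flips0 s'k) => s's; apply: loops_flip_separated (adq x).
by apply: leq_ltn_trans (loops_flip s's) _; rewrite addnS ltnS IHk.
Qed.

Variable B : nat.
Hypothesis B_big : (loops uniform + #|X| <= B)%N.

(** The summand of s in the expansion of the bracket as a polynomial in x =
    A or A^-1: the number of labels is -(x^4 + 1) / x^2, and multiplication
    by x^(n + 2 B) clears denominators. Its degree decreases by 2 with each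
    flip but increases by 2 with each loop. *)
Definition state_term s : {poly algC} :=
  (- ('X^4 + 1)) ^+ loops s * 'X^(2 * (#|X| - flips s) + 2 * (B - loops s)).
Definition state_poly : {poly algC} := \sum_(s : state) state_term s.

Lemma loops_B s : (loops s <= B)%N.
Proof.
apply: leq_trans (loops_le s) (leq_trans _ B_big).
by rewrite leq_add2l flips_le.
Qed.

Lemma size_state_term s :
  size (state_term s) = (2 * (#|X| - flips s) + 2 * (B - loops s) + 4 * loops s).+1.
Proof.
have s5 : size (- ('X^4 + 1) : {poly algC}) = 5%N by rewrite size_polyN size_XnaddC.
have q0 : (- ('X^4 + 1)) ^+ loops s != 0 :> {poly algC}.
  by rewrite expf_neq0 // -size_poly_eq0 s5.
rewrite /state_term size_mulXn // -addnS; congr (_ + _)%N.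
by rewrite -[LHS]prednK ?size_poly_gt0 // size_exp s5.
Qed.

Lemma size_state_poly : (size state_poly <= (2 * #|X| + 2 * B + 2 * loops uniform).+1)%N.
Proof.
apply: leq_trans (size_sum _ _ _) _; apply/bigmax_leqP => s _.
rewrite size_state_term ltnS; have := loops_le s; have := flips_le s; have := loops_B s; lia.
Qed.

Lemma size_state_poly_adequate : adequate ->
  size state_poly = (2 * #|X| + 2 * B + 2 * loops uniform).+1.
Proof.
move=> adq; have lead : size (state_term uniform) = (2 * #|X| + 2 * B + 2 * loops uniform).+1.
  rewrite size_state_term flips_uniform; have := loops_B uniform; lia.
rewrite /state_poly (bigD1 uniform) //= size_polyDl lead // ltnS.
apply: leq_trans (size_sum _ _ _) _; apply/bigmax_leqP => s su.
have s0 : (0 < flips s)%N by rewrite lt0n; apply: contra su => /eqP/flips0/eqP.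
rewrite size_state_term; have := loops_lt adq s0; have := flips_le s; have := loops_B s; lia.
Qed.

Lemma state_polyE N A (AN : A ^+ 2 + A ^- 2 = - N.+1%:R) x : x = (if c then A else A^-1) ->
  state_poly.[x] = x ^+ (#|X| + 2 * B) * shadow_sum P (bracket_model AN).
Proof.
move=> xA; have A0 := bracket_neq0 AN.
have x0 : x != 0 by rewrite xA; case: (c); rewrite ?invr_eq0.
have xN : - (x ^+ 4 + 1) = x ^+ 2 * N.+1%:R.
  have -> : N.+1%:R = - (x ^+ 2 + x ^- 2).
    by rewrite xA; case: (c); last rewrite exprVn invrK [X in - X]addrC; rewrite AN opprK.
  by field.
rewrite shadow_sum_bracket mulr_sumr /state_poly horner_sum; apply: eq_bigr => s _.
have -> : \prod_y (if s y then A else A^-1) = x ^+ (#|X| - flips s) * x ^- flips s.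
  rewrite (bigID (fun y => s y != c)) /= mulrC; congr (_ * _).
    rewrite (eq_bigr (fun=> x)) => [|y]; last by rewrite negbK => /eqP ->.
    rewrite prodr_const; congr (_ ^+ _); rewrite -(cardC [set y | s y != c]) addKn.
    by apply: eq_card => y; rewrite !inE.
  rewrite (eq_bigr (fun=> x^-1)) => [|y]; last first.
    by rewrite xA; case: (s y); case: (c); rewrite ?invrK.
  by rewrite prodr_const -exprVn; congr (_ ^+ _); apply: eq_card => y; rewrite !inE.
rewrite /state_term hornerM hornerXn horner_exp hornerN hornerD hornerXn hornerC xN.
rewrite natrX exprMn -exprM.
have [k1 k2] := (flips_le s, loops_B s).
have -> : (#|X| + 2 * B = (2 * loops s + 2 * (B - loops s)) + (#|X| - flips s) + flips s)%N by lia.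
have f0 : x ^+ flips s != 0 by rewrite expf_neq0.
rewrite !(mul2n, =^~ addnn) !exprD.
move: (x ^+ flips s) (x ^+ (#|X| - flips s)) (x ^+ loops s) (x ^+ (B - _)) (_ ^+ loops s) f0.
by move=> f a u v w f0; field.
Qed.
End Degree.

(** A^2 is a root of a quadratic polynomial. *)
Lemma ex_bracket N : exists A : algC, A ^+ 2 + A ^- 2 = - N.+1%:R.
Proof.
pose M : algC := N.+1%:R; pose y := (- M + sqrtC (M ^+ 2 - 4)) / 2.
have y2 : y ^+ 2 + M * y + 1 = 0.
  have := sqrtCK (M ^+ 2 - 4); rewrite /y; move: (sqrtC _) => r r2.
  have -> : ((- M + r) / 2) ^+ 2 + M * ((- M + r) / 2) + 1 = (r ^+ 2 - M ^+ 2 + 4) / 4 by field.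
  by rewrite r2; field.
have y0 : y != 0.
  by apply/eqP=> y0; move/eqP: y2; rewrite y0 expr0n mulr0 !add0r oner_eq0.
exists (sqrtC y); rewrite sqrtCK -/M; apply: (mulfI y0).
by rewrite mulrDr divff // mulrN; apply/eqP; rewrite -addr_eq0; apply/eqP; rewrite -y2; ring.
Qed.

(** The polynomials of P and P', multiplied by powers of x, agree at the
    values of x for all N, of which there are infinitely many. Hence they
    are equal. The polynomial of P has the degree of its uniform state, and
    that of P' has at most the degree of the corresponding one. *)
Lemma degree_le (P P' : shadow) c : adequate P c ->
  (forall W, shadow_sum P W = shadow_sum P' W) ->
  (#|node P| + 2 * loops (uniform P c) <= #|node P'| + 2 * loops (uniform P' c))%N.
Proof.
move=> adq same.
set n := #|node P|; set n' := #|node P'|; set l := loops _; set l' := loops _.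
pose B := (l + n + (l' + n'))%N.
have BP : (loops (uniform P c) + #|node P| <= B)%N by apply: leq_addr.
have BP' : (loops (uniform P' c) + #|node P'| <= B)%N by apply: leq_addl.
pose p := state_poly P c B; pose p' := state_poly P' c B.
pose q := p * 'X^n' - p' * 'X^n.
have q_root N : exists2 x, root q x & x ^+ 2 + x ^- 2 = - N.+1%:R.
  have [A AN] := ex_bracket N; exists (if c then A else A^-1).
    rewrite /root /q hornerD hornerN !hornerM !hornerXn.
    rewrite (state_polyE BP AN erefl) (state_polyE BP' AN erefl) same -/n -/n'.
    by rewrite !exprD; apply/eqP; ring.
  by case: (c); last rewrite exprVn invrK addrC.
have q0 : q = 0.
  apply/eqP/negPn/negP => q_neq0.
  have ex N : exists x, root q x && (x ^+ 2 + x ^- 2 == - N.+1%:R).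
    by have [x rx xN] := q_root N; exists x; rewrite rx xN eqxx.
  (* Different N have different roots, and here are more of them than the
     degree allows. *)
  pose rs := [seq xchoose (ex N) | N <- iota 0 (size q)].
  have := max_poly_roots q_neq0 (rs := rs); rewrite size_map size_iota ltnn => H.
  suff : false by []. apply: H.
    by apply/allP=> x /mapP[N _ ->]; have /andP[] := xchooseP (ex N).
  rewrite map_inj_uniq ?iota_uniq // => N N' E.
  have /andP[_ /eqP E1] := xchooseP (ex N); have /andP[_ /eqP E2] := xchooseP (ex N').
  by move: E1; rewrite E E2 => /oppr_inj/eqP; rewrite eqr_nat => /eqP[].
have sz : size (p * 'X^n') = size (p' * 'X^n) by rewrite (subr0_eq q0).
have p0 : p != 0 by rewrite -size_poly_gt0 /p size_state_poly_adequate.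
have p'0 : p' != 0.
  apply: contra_eqN sz => /eqP ->; rewrite mul0r size_poly0 size_mulXn // /p size_state_poly_adequate //.
  by rewrite addnS.
move: sz; rewrite !size_mulXn // /p size_state_poly_adequate //.
have := size_state_poly BP'; rewrite -/p' -/n -/n' -/l -/l'; lia.
Qed.

Local Close Scope ring_scope.

(** * Doubling and adequacy *)

Section Uniform.
Variables (P : shadow) (c : bool).

Lemma uniformP (K : finType) (g : {ffun dart (node P) -> K}) :
  reflect (forall d, g (join d) = g d /\ g (turn c d) = g d)
    (g \in constant_along K (arc (uniform P c))).
Proof.
by apply: (iffP (constant_arcP _ _)) => gP d; have := gP d; rewrite ffunE.
Qed.

(** Any dart at x can be used to tell the two loops at x apart. *)
Lemma separatedI x d (g : {ffun dart (node P) -> bool}) : d.1 = x ->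
  (forall d, g (join d) = g d /\ g (turn c d) = g d) -> g d != g (opp d) ->
  separated (uniform P c) x.
Proof.
move=> <- gP gd; exists g; first exact/uniformP.
set d0 := (d.1, ord0).
have t d1 : g (turn c d1) = g d1 by case: (gP d1).
have := t d0; have := t (opp d0); move: gd; rewrite -[opp d0]/(cw (cw d0)) /turn !odd_cw negbK /=.
have [->|->|->|->] := @dart_cases _ d0 d erefl; case: (c) => /=;
  rewrite -?[cw (cw d0)]/(opp d0) ?cw3 ?ccw_opp ?oppK ?opp_cw ?opp_ccw // => gd E2 E0.
all: by move: gd; rewrite ?E2 ?E0 // eq_sym.
Qed.
End Uniform.

(** For each loop of the uniform state of P, the doubled shadow has two
    loops parallel to it. At a grid, two opposite crossings are met by
    copies of both loops that P has there, and the two others by both copies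
    of one and the same loop. *)
Section DoubleAdequate.
Variables (P : shadow) (c : bool).
Local Notation X := (node P).
Local Notation e := (@join P).
Implicit Type d : dart X.

(** Whether the angle clockwise of d has the colour c. *)
Definition coloured d := odd d.2 != c.

Lemma coloured_cw d : coloured (cw d) = ~~ coloured d.
Proof. by rewrite /coloured odd_cw; case: odd; case: c. Qed.

Lemma coloured_ccw d : coloured (ccw d) = ~~ coloured d.
Proof. by rewrite /coloured odd_ccw; case: odd; case: c. Qed.

Lemma turn_coloured d : turn c d = if coloured d then cw d else ccw d.
Proof. by rewrite /turn /coloured; case: eqP. Qed.

Lemma turn_corner d :
  ((turn c (corner d) = if coloured d then cw (corner d) else ccw (corner d)) *
   (turn c (cw (corner d)) = if coloured d then corner d else opp (corner d)) *
   (turn c (opp (corner d)) = if coloured d then ccw (corner d) else cw (corner d)) *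
   (turn c (ccw (corner d)) = if coloured d then opp (corner d) else corner d))%type.
Proof.
have oddE : odd (corner d).2 = odd d.2 by [].
rewrite /coloured /turn odd_ccw !odd_cw negbK oddE cwK ccwK cw3 ccw_opp ccw_ccw -[cw (cw _)]/(opp _).
by do !split; case: (odd d.2); case: c.
Qed.

(** Both copies of a loop get the label of the loop, and those of different
    loops meet here. *)
Lemma separated_uncoloured d : ~~ coloured d -> separated (uniform P c) d.1 ->
  separated (uniform (double_shadow P) c) d.
Proof.
move=> nd [g0 /uniformP gP sep].
pose g : {ffun dart (dart X) -> bool} := [ffun a => if coloured a.1 then g0 a.1 else g0 (a.1.1, a.2)].
have gj d1 : g0 (e d1) = g0 d1 by case: (gP d1).
have gt d1 : coloured d1 -> g0 (cw d1) = g0 d1.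
  by move=> cd; have [_] := gP d1; rewrite turn_coloured cd.
have g0E d1 : g (corner d1) = g0 d1 by rewrite ffunE -surjective_pairing; case: ifP.
have g1E d1 : g (cw (corner d1)) = g0 (cw d1).
  by rewrite ffunE /=; case: ifP => // cd; rewrite gt.
have g2E d1 : g (opp (corner d1)) = if coloured d1 then g0 d1 else g0 (opp d1) by rewrite ffunE.
have g3E d1 : g (ccw (corner d1)) = if coloured d1 then g0 d1 else g0 (ccw d1) by rewrite ffunE.
apply: (@separatedI (double_shadow P) c d (d, ord0) g) => // [a|]; last first.
  by rewrite !ffunE /= (negPf nd).
split.
  rewrite -[@join _]/(@double_join P); case: (double_dartP a) => d1.
  - by rewrite double_join0 g1E g0E ccwK gj.
  - by rewrite double_join1 g1E g0E gj.
  - rewrite double_join2 g3E g2E coloured_cw cwK; case cd: (coloured d1) => //=.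
    by rewrite (gt (cw d1)) ?coloured_cw ?cd.
  - rewrite double_join3 g3E g2E coloured_ccw opp_ccw; case cd: (coloured d1) => //=.
    by rewrite gt.
have [_] := gP (a.1.1, a.2); rewrite !ffunE turn1 /=; case: ifP => // _ <-.
by congr (g0 _); rewrite [RHS]surjective_pairing turn1 /= /turn /=; case: ifP.
Qed.

Lemma double_orientation : exists o : dart X -> bool, forall d, o (e d) = ~~ o d /\ o (turn c d) = ~~ o d.
Proof.
apply: orientation_exists; [exact: joinK | exact: turnK | exact: join_neq | exact: turn_neq].
Qed.

(** The two copies of one loop meet here. They lie on different sides of the
    loop, and an orientation o of the loops of P makes it possible to tell
    left copies from right ones. *)
Lemma separated_coloured d : coloured d -> separated (uniform (double_shadow P) c) d.
Proof.
move=> cd; have [o oP] := double_orientation.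
have oj d1 : o (e d1) = ~~ o d1 by case: (oP d1).
have ot d1 : coloured d1 -> o (cw d1) = ~~ o d1.
  by move=> cd1; have [_] := oP d1; rewrite turn_coloured cd1.
pose g : {ffun dart (dart X) -> bool} := [ffun a => let d1 := a.1 in
  if a == corner d1 then ~~ o d1 else if a == cw (corner d1) then o (cw d1)
  else if coloured d1 then o d1 else if a == opp (corner d1) then o (cw d1) else ~~ o d1].
have gE d1 : ((g (corner d1) = ~~ o d1) * (g (cw (corner d1)) = o (cw d1)) *
    (g (opp (corner d1)) = if coloured d1 then o d1 else o (cw d1)) *
    (g (ccw (corner d1)) = if coloured d1 then o d1 else ~~ o d1))%type.
  by rewrite !ffunE /= !(corner_neq, eqxx).
apply: (@separatedI (double_shadow P) c d (corner d) g) => // [a|]; last by rewrite !gE cd; case: (o d).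
rewrite -[@join _]/(@double_join P).
case: (double_dartP a) => d1; rewrite !turn_corner.
- rewrite double_join0 !gE ccwK oj; split=> //.
  by case cd1: (coloured d1); rewrite !gE ?cd1 ?ot.
- rewrite double_join1 !gE oj negbK; split=> //.
  by case cd1: (coloured d1); rewrite !gE ?cd1 // ot.
- rewrite double_join2 !gE coloured_cw; case cd1: (coloured d1); rewrite /= !gE ?cd1 //=.
  by rewrite ot ?negbK.
rewrite double_join3 !gE coloured_ccw ccwK; case cd1: (coloured d1); rewrite /= !gE ?cd1 //=.
by rewrite -[d1 in ~~ o d1]ccwK ot ?negbK // coloured_ccw cd1.
Qed.

Lemma double_adequate : adequate P c -> adequate (double_shadow P) c.
Proof.
move=> adq d; have [cd|cd] := boolP (coloured d); first exact: separated_coloured.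
exact: separated_uncoloured.
Qed.

Section DoubleLabels.
Variable g : {ffun dart (dart X) -> bool}.
Hypothesis gP : g \in constant_along bool (arc (uniform (double_shadow P) c)).

(** The labels of the two arcs parallel to d, the clockwise one for i =
    true. *)
Definition border d (i : bool) := if i then g (corner d) else g (cw (corner (ccw d))).

Let gj a : g (double_join a) = g a.
Proof. by have /uniformP/(_ a)[] := gP. Qed.
Let gt a : g (turn c a) = g a.
Proof. by have /uniformP/(_ a)[] := gP. Qed.

Lemma double_corner d :
  ((g (opp (corner d)) = if coloured d then g (corner (cw d)) else g (cw (corner d))) *
   (g (ccw (corner d)) = if coloured d then g (opp (corner d)) else g (corner d)))%type.
Proof.
split; last by rewrite -[LHS]gt turn_corner; case: ifP.
case: ifP => cd; last by rewrite -[LHS]gt turn_corner cd.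
by rewrite -[LHS]gj double_join2 -[LHS]gt turn_corner coloured_cw cd.
Qed.

Lemma border_join d i : border (e d) i = border d (~~ i).
Proof.
by case: i; rewrite /border /= -[LHS]gj ?double_join0 ?double_join1 ?ccwK joinK.
Qed.

Let border_coloured d i : coloured d -> border (cw d) i = border d (~~ i).
Proof.
move=> cd; case: i; rewrite /border /= ?cwK; last by rewrite -[LHS]gt turn_corner cd.
have [od _] := double_corner d; rewrite cd in od; rewrite -od -[LHS]gt turn_corner cd.
by rewrite -[LHS]gj double_join3 (double_corner (ccw d)).1 coloured_ccw cd.
Qed.

Lemma border_turn d i : border (turn c d) i = border d (~~ i).
Proof.
rewrite turn_coloured; case: ifP => cd; first exact: border_coloured.
by rewrite -{2}[d]ccwK border_coloured ?negbK // coloured_ccw cd.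
Qed.

(** Along a loop of P, both edges and turns exchange the sides as well as
    the directions, so that the label on a side that is fixed relative to
    the orientation is constant. *)
Lemma border_constant (o : dart X -> bool) b :
  (forall d, o (e d) = ~~ o d /\ o (turn c d) = ~~ o d) ->
  [ffun d => border d (b (+) o d)] \in constant_along bool (arc (uniform P c)).
Proof.
move=> oP; apply/uniformP => d; have [oj ot] := oP d.
by rewrite !ffunE border_join border_turn oj ot -addbN !addbN negbK.
Qed.
End DoubleLabels.

Lemma border_inj g h :
  g \in constant_along bool (arc (uniform (double_shadow P) c)) ->
  h \in constant_along bool (arc (uniform (double_shadow P) c)) ->
  border g =2 border h -> g = h.
Proof.
move=> gP hP gh; have gh0 d : g (corner d) = h (corner d) := gh d true.
have gh1 d : g (cw (corner d)) = h (cw (corner d)).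
  by have := gh (cw d) false; rewrite /border cwK.
apply/ffunP=> a; case: (double_dartP a) => d //; have G := double_corner gP d; have H := double_corner hP d.
  by rewrite G.1 H.1 gh0 gh1.
by rewrite G.2 H.2 G.1 H.1 !gh0 gh1.
Qed.

(** A labeling of the loops of the doubled shadow is determined by the
    labels of the left and of the right copies of loops of P. *)
Lemma loops_double : loops (uniform (double_shadow P) c) <= 2 * loops (uniform P c).
Proof.
have [o oP] := double_orientation.
rewrite -(leq_exp2l _ _ (isT : 1 < 2)) mul2n -addnn expnD -!card_bool_arc -cardsX.
pose halves g := ([ffun d => border g d (o d)], [ffun d => border g d (~~ o d)]).
rewrite -(card_in_imset (f := halves)) => [|g h gP hP [/ffunP E1 /ffunP E2]].
  apply: subset_leq_card; apply/subsetP => _ /imsetP[g gP ->]; apply/setXP; split.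
    exact: (border_constant gP false oP).
  exact: (border_constant gP true oP).
apply: (border_inj gP hP) => d i; have := E1 d; have := E2 d; rewrite !ffunE.
by case: (o d); case: i.
Qed.
End DoubleAdequate.

(** * Kinks, goodness and adequacy *)

(** In the smoothing of the colour opposite to b, the loop of the kink is
    split off, so the crossing is met by a new loop and by the old one
    through d. *)
Lemma adequate_kink P b t d : adequate P (~~ b) -> adequate (@add_kink P b t d) (~~ b).
Proof.
set loop := @kink_dart P b; set c := ~~ b.
have oddl : odd loop.2 = b by rewrite /loop /=; case: (b).
pose ext (g : {ffun dart (node P) -> bool}) v : {ffun dart (node (@add_kink P b t d)) -> bool} :=
  [ffun a => if a.1 is Some x then g (x, a.2)
             else if (a == loop) || (a == cw loop) then v else g d].
have extP (g : {ffun dart (node P) -> bool}) v : (forall a, g (join a) = g a /\ g (turn c a) = g a) ->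
    forall a, ext g v (@kink_join P b t d a) = ext g v a /\ ext g v (turn c a) = ext g v a.
  move=> gP.
  have lift_ext a : ext g v (lift_dart a) = g a by rewrite ffunE /= -surjective_pairing.
  have loop_ext : ext g v loop = v by rewrite ffunE eqxx.
  have cw_ext : ext g v (cw loop) = v by rewrite ffunE /= eqxx orbT.
  have opp_ext : ext g v (opp loop) = g d by rewrite ffunE /= !corner_neq.
  have ccw_ext : ext g v (ccw loop) = g d by rewrite ffunE /= !corner_neq.
  have in_ext : ext g v (@kink_in P b t) = g d by rewrite /kink_in; case: (t).
  have out_ext : ext g v (@kink_out P b t) = g d by rewrite /kink_out; case: (t).
  move=> a; split.
    case: (kink_dartP b t d a) => [||||||{}a ad aed].
    - by rewrite kink_join_loop cw_ext loop_ext.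
    - by rewrite kink_join_cw cw_ext loop_ext.
    - by rewrite kink_join_in in_ext lift_ext.
    - by rewrite kink_join_out out_ext lift_ext; have [] := gP d.
    - by rewrite kink_join_d in_ext lift_ext.
    - by rewrite kink_join_ed out_ext lift_ext; have [] := gP d.
    by rewrite kink_join_lift // !lift_ext; have [] := gP a.
  case: a => [[x|] i].
    rewrite (_ : turn c (Some x, i) = lift_dart (turn c (x, i))); last by rewrite /turn /=; case: ifP.
    by rewrite -[(Some x, i)]/(lift_dart (x, i)) !lift_ext; case: (gP (x, i)).
  have [->|->|->|->] := @dart_cases _ loop (None, i) erefl;
    rewrite /turn ?odd_ccw ?odd_cw ?oddl /c; case: (b); rewrite /= ?cwK ?ccwK ?ccw_opp ?ccw_ccw ?cw3 -?[cw (cw loop)]/(opp loop) ?opp_ext ?ccw_ext ?loop_ext ?cw_ext //.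
move=> adq [x|].
  have [g /uniformP gP sep] := adq x.
  apply: (@separatedI (@add_kink P b t d) c _ (Some x, ord0) (ext g false)) => //; first exact: extP.
  by rewrite !ffunE.
apply: (@separatedI (@add_kink P b t d) c _ loop (ext [ffun=> false] true)) => //.
  by apply: extP => a; rewrite !ffunE.
by rewrite !ffunE eqxx !corner_neq.
Qed.

Definition diagram_shadow (L : diagram) := Shadow (@edgeK L) (@edge_neq L).

(** The cell containing the branch (x, i) is the set of darts on the loop
    through it; at x, the loops through opposite branches bound the pieces
    of two cells of the same colour. *)
Lemma good_adequate L c : good L -> adequate (diagram_shadow L) c.
Proof.
move=> gL x; set r : rel (dart (crossing L)) := [rel a b | (b == edge a) || (b == turn c a)].
pose i : 'I_4 := if c then ord0 else ordS ord0.
pose g : {ffun dart (node (diagram_shadow L)) -> bool} := [ffun d => connect r (x, i) d].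
have rsym : symmetric r.
  by move=> a b; have := arc_sym (uniform (diagram_shadow L) c) a b; rewrite /arc /= !ffunE.
have csym := sym_connect_sym rsym.
have odd_i : odd i = ~~ c by rewrite /i; case: (c).
apply: (@separatedI (diagram_shadow L) c x (x, i) g) => // [d|].
  have gr b : r d b -> g b = g d.
    by move=> rdb; rewrite !ffunE; apply/esym/(same_connect_r csym)/connect1.
  by split; apply: gr; rewrite /r /= eqxx ?orbT.
rewrite !ffunE connect0; apply/negP=> same.
suff /(gL x) ii : piece_cell x (opp (x, i)).2 = piece_cell x i.
  by have /eqP[] := opp_neq (x, i); rewrite [LHS]surjective_pairing ii.
rewrite /piece_cell /atom_cell !odd_cw !negbK odd_i negbK; congr (_, _); apply/setP=> d.
by rewrite !inE -/r; apply/esym/(same_connect csym).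
Qed.

(** * Comparing the numbers of crossings *)

(** For k-fold doubles, degree_le gives 4^k n <= 4^k n' + 2 2^k s', so that
    n > n' implies 2^k <= 2 s', which is absurd for k = 2 s'. *)
Lemma adequate_le P P' c : adequate P c ->
  (forall W, shadow_sum P W = shadow_sum P' W) -> #|node P| <= #|node P'|.
Proof.
move=> adq same; set s' := loops (uniform P' c).
have iterated k : exists Q Q', [/\ adequate Q c, forall W, shadow_sum Q W = shadow_sum Q' W,
    #|node Q| = 4 ^ k * #|node P|, #|node Q'| = 4 ^ k * #|node P'|
    & loops (uniform Q' c) <= 2 ^ k * s'].
  elim: k => [|k [Q [Q' [aQ sQ nQ nQ' lQ']]]]; first by exists P, P'; rewrite !mul1n.
  exists (double_shadow Q), (double_shadow Q'); split; first exact: double_adequate.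
  - by move=> W; rewrite !shadow_sum_double sQ.
  - by rewrite card_prod card_ord nQ expnS; ring.
  - by rewrite card_prod card_ord nQ' expnS; ring.
  by apply: leq_trans (loops_double _ _) _; rewrite expnS -mulnA leq_mul2l.
rewrite leqNgt; apply/negP => lt; pose k := 2 * s'.
have [Q [Q' [aQ sQ nQ nQ' lQ']]] := iterated k.
have le : 4 ^ k + 4 ^ k * #|node P'| <= 4 ^ k * #|node P'| + 2 * (2 ^ k * s').
  rewrite -mulnS; apply: (@leq_trans (4 ^ k * #|node P|)); first by rewrite leq_mul2l lt orbT.
  rewrite -nQ -nQ'; apply: leq_trans (leq_trans (degree_le aQ sQ) _); first exact: leq_addr.
  by rewrite leq_add2l leq_mul2l.
move: le; rewrite addnC leq_add2l -[4]/(2 ^ 2) -expnM mul2n -addnn expnD mulnCA leq_pmul2l ?expn_gt0 //.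
by rewrite leqNgt ltn_expl.
Qed.

Lemma add_word P d b u : exists Q d', [/\ #|node Q| = #|node P| + size u,
  adequate P (~~ b) -> adequate Q (~~ b) &
  forall (W : model) (M : lab W -> lab W -> algC), central M ->
    evaluate (@join Q) (fun=> wt (m := W)) d' M
    = evaluate (@join P) (fun=> wt (m := W)) d (mmul (word (W := W) b u) M)].
Proof.
elim: u => [|t u [Q [d' [nQ aQ QE]]]].
  by exists P, d; rewrite addn0; split=> // W M _; rewrite /= mmul1.
exists (@add_kink Q b t d'), (lift_dart d'); split.
- by rewrite card_option nQ addnS.
- by move=> /aQ; apply: adequate_kink.
move=> W M cM; have cl := @letter_central W b t.
rewrite evaluate_kink // QE; last exact: central_mul.
by rewrite /= -mmulA mmulA letter_comm ?mmulA //; apply: word_central.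
Qed.

(** The diagram without crossings has no dart at which a kink could be
    added; the first one turns it into a figure eight. *)
Section FigureEight.
Variable b : bool.
Local Notation loop := ((tt, if b then ordS ord0 else ord0) : dart unit).

Local Notation eight_join := (@turn unit (~~ b)).
Local Notation eight_joinK := (@turnK unit (~~ b)).
Local Notation eight_join_neq := (@turn_neq unit (~~ b)).

Definition eight := Shadow eight_joinK eight_join_neq.

Let eight_cases d : [\/ d = loop, d = cw loop, d = opp loop | d = ccw loop].
Proof. by apply: (@dart_cases _ loop d); case: d => -[]. Qed.

Let odd_loop : odd loop.2 = b. Proof. by case: (b). Qed.

Let join_loop : eight_join loop = cw loop.
Proof. by rewrite /turn odd_loop; case: (b). Qed.

Let join_opp : eight_join (opp loop) = ccw loop.
Proof. by rewrite /turn !odd_cw negbK odd_loop cw3; case: (b). Qed.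

Lemma evaluate_eight t : exists d, forall (W : model) (M : lab W -> lab W -> algC), central M ->
  evaluate (@join eight) (fun=> wt (m := W)) d M = (\sum_s mmul (letter b t) M s s)%R.
Proof.
have join_cw : eight_join (cw loop) = loop by rewrite -join_loop eight_joinK.
have E (W : model) (M : lab W -> lab W -> algC) :
    evaluate (@join eight) (fun=> wt (m := W)) (opp loop) M = (\sum_s mmul M (kink b) s s)%R.
  rewrite (untie_kink eight_joinK eight_join_neq _ join_cw) odd_loop.
  rewrite (_ : untie (W := W) [:: loop.1] = fun=> virtual (W := W)); last first.
    by apply: functional_extensionality => -[].
  apply: evaluate_virtual eight_joinK eight_join_neq _ _ _ => d.
  have next_cw : fconnect (fun d => opp (eight_join d)) (opp loop) (cw loop).
    by apply: connect1; rewrite /= join_opp opp_ccw.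
  have [->|->|->|->] := eight_cases d.
  - by rewrite join_loop next_cw orbT.
  - by rewrite next_cw.
  - by rewrite connect0.
  by rewrite -join_opp eight_joinK connect0 orbT.
case: t; [exists (ccw loop) | exists (opp loop)] => W M cM; last first.
  by rewrite E; apply: eq_bigr => s _; rewrite kink_comm.
rewrite (evaluate_edge eight_joinK eight_join_neq) -join_opp eight_joinK E -[LHS]sum_bar.
apply: eq_bigr => s _; rewrite -[LHS]/(dag (mmul (dag M) (kink b)) s s).
by rewrite dag_mul dagK.
Qed.

Lemma eight_adequate : adequate eight (~~ b).
Proof.
pose g : {ffun dart (node eight) -> bool} := [ffun d => (d == loop) || (d == cw loop)].
move=> [] ; apply: (@separatedI eight (~~ b) tt loop g) => [//|d|]; last first.
  by rewrite !ffunE eqxx !corner_neq.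
suff E : g (eight_join d) = g d by [].
have [->|->|->|->] := eight_cases d.
- by rewrite join_loop !ffunE !eqxx !orbT.
- by rewrite -join_loop eight_joinK join_loop !ffunE !eqxx orbT.
- by rewrite join_opp !ffunE !corner_neq.
by rewrite -join_opp eight_joinK join_opp !ffunE !corner_neq.
Qed.
End FigureEight.

(** Words are not empty, so that there is a dart even if L has no crossings. *)
Lemma kinked_shadow (L : diagram) (od : based L) b t u : valid od -> exists Q,
  [/\ #|node Q| = #|crossing L| + (size u).+1,
      adequate (diagram_shadow L) (~~ b) -> adequate Q (~~ b) &
      forall W, shadow_sum Q W = invariant od (word (W := W) b (t :: u))].
Proof.
case: od => [d|] vd.
  have [Q [d' [nQ aQ QE]]] := @add_word (diagram_shadow L) d b (t :: u).
  exists Q; split=> // W; rewrite -(evaluate_one _ d') QE; last exact: central_one.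
  by rewrite mulm1.
have [d dE] := evaluate_eight b t; have [Q [d' [nQ aQ QE]]] := @add_word (eight b) d b u.
exists Q; split=> [|_|W].
- by rewrite nQ vd // card_unit add0n add1n.
- by apply: aQ; apply: eight_adequate.
rewrite -(evaluate_one _ d') QE; last exact: central_one.
by rewrite mulm1 dE //; apply: word_central.
Qed.

Lemma kinked_le L L' (od : based L) (od' : based L') b t u u' : valid od -> valid od' ->
  (forall W, invariant od (word (W := W) b (t :: u)) = invariant od' (word (W := W) b (t :: u'))) ->
  good L -> #|crossing L| + size u <= #|crossing L'| + size u'.
Proof.
move=> vd vd' E gL.
have [Q [nQ aQ QE]] := kinked_shadow b t u vd; have [Q' [nQ' _ QE']] := kinked_shadow b t u' vd'.
have := @adequate_le Q Q' (~~ b); rewrite nQ nQ' !addnS ltnS; apply.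
  exact/aQ/good_adequate.
by move=> W; rewrite QE QE'.
Qed.

Lemma word_cancel (W : model) (M : lab W -> lab W -> algC) u v :
  mmul (mmul M (mmul (word true (map negb u)) (word true v))) (word false u) = mmul M (word true v).
Proof.
rewrite -mmulA word_comm; last by apply: central_mul; apply: word_central.
by rewrite [mmul (word false u) _]mmulA (@word_inv W false) mmul1.
Qed.

Theorem theorem1 (L : diagram) (n : nat) (hn : #|crossing L| = n)
    (hgood : good L) (L' : diagram) (hL' : same_knot L L') :
  n <= #|crossing L'|.
Proof.
have [od [od' [u [u' [vd vd' E]]]]] := same_knot_related hL'.
have le1 : #|crossing L| + size u <= #|crossing L'| + size u'.
  apply: (kinked_le (b := false) (t := false) vd vd') => // W.
  by apply: E; apply: letter_central.
have le2 : #|crossing L| + size (map negb u') <= #|crossing L'| + size (map negb u).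
  apply: (kinked_le (b := true) (t := false) vd vd') => // W.
  have cl := @letter_central W true false; have cw u0 := @word_central W true u0.
  have := E W (mmul (letter true false) (mmul (word true (map negb u)) (word true (map negb u')))).
  rewrite word_cancel [mmul (word true (map negb u)) _]word_comm // word_cancel; apply.
  by do !apply: central_mul.
by move: le1 le2; rewrite !size_map; lia.
Qed.
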